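(* Let $n\ge 3$ be an integer. In $\mathcal{F}(n,2)$ put $$\mathcal{R}(n)_{n,2}:=\pi_{n,0}\rho_{0,2}-2\pi_{n-1,1}\rho_{1,1}+\pi_{n-2,2}\rho_{2,0},$$ and for $k=1,\dots,\lfloor \frac n2\rfloor$ put $$\mathcal{R}(n)_{2n-2k,2k}:=(-1)^k\tfrac 12\tbinom{2k}{k}\pi_{n-k,k}^2+\sum_{j=0}^{k-1}(-1)^j\tbinom{2k}{j}\pi_{n-j,j}\pi_{n-2k+j,2k-j}-4^k\rho_{2,0}^{n-2k}(\rho_{1,1}^2-\rho_{2,0}\rho_{0,2})^k.$$ Let $\Lambda=\{(n,2),(2n-2,2),(2n-4,4),\dots,(2n-2\lfloor\frac n2\rfloor,2\lfloor\frac n2\rfloor)\}$. Then: (i) For every $m\ge 2$ and every $\lambda\in\Lambda$, the element $\mathcal{R}(n)_\lambda\in\mathcal{F}(n,2)\subseteq\mathcal{F}(n,m)$ generates a $GL_m(\mathbb{C})$-submodule of $\ker(\varphi(n,m))$ isomorphic to $S^{\lambda}(\mathbb{C}^m)$. (ii) For $m=2$ the ideal $\ker(\varphi(n,2))$ is minimally generated as a $GL_2(\mathbb{C})$-ideal by the elements $\mathcal{R}(n)_\lambda$, $\lambda\in\Lambda$.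
   Context: Let $n\ge 3$, $\omega\in\mathbb{C}$ a primitive $n$th root of $1$, and $D_{2n}\subset GL_2(\mathbb{C})$ the dihedral group of order $2n$ generated by $\begin{pmatrix}\omega&0\\0&\omega^{-1}\end{pmatrix}$ and $\begin{pmatrix}0&1\\1&0\end{pmatrix}$. It acts on $V=\mathbb{C}^2$ and diagonally on $V^m$. Let $x_i,y_i$ be the first and second coordinate of the $i$th vector component, so $\mathbb{C}[V^m]=\mathbb{C}[x_1,y_1,\dots,x_m,y_m]$; $\mathbb{C}[V^m]^{D_{2n}}$ is the algebra of invariants. For $\beta\in\mathbb{N}_0^m$ with $\sum\beta_i=n$ put $p_\beta=x_1^{\beta_1}\cdots x_m^{\beta_m}+y_1^{\beta_1}\cdots y_m^{\beta_m}$. For $\alpha\in\mathbb{N}_0^m$ with $\sum\alpha_i=2$ put $q_\alpha=x_iy_i$ if $\alpha_i=2$, and $q_\alpha=\frac12(x_iy_j+y_ix_j)$ if $\alpha_i=\alpha_j=1$, $i\neq j$. The $p_\beta$ and $q_\alpha$ form a minimal homogeneous generating system of $\mathbb{C}[V^m]^{D_{2n}}$. $\mathcal{F}(n,m)=\mathbb{C}[\rho_\alpha,\pi_\beta\mid \alpha,\beta\in\mathbb{N}_0^m,\ \sum\alpha_i=2,\ \sum\beta_j=n]$ is the polynomial ring, graded by $\deg\rho_\alpha=2$, $\deg\pi_\beta=n$, and $\varphi(n,m):\mathcal{F}(n,m)\to\mathbb{C}[V^m]^{D_{2n}}$ is the surjective graded algebra homomorphism with $\rho_\alpha\mapsto q_\alpha$,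 $\pi_\beta\mapsto p_\beta$. For $l\le m$, $\mathcal{F}(n,l)$ is viewed as a subalgebra of $\mathcal{F}(n,m)$ by appending zeros to the indices. $GL_m(\mathbb{C})$ acts on $\mathbb{C}[V^m]$ by algebra automorphisms with $g\cdot x_j=\sum_i g_{ij}x_i$, $g\cdot y_j=\sum_i g_{ij}y_i$. The spans of $\{q_\alpha\}$ and of $\{p_\beta\}$ are $GL_m(\mathbb{C})$-stable; transporting the action along $\rho_\alpha\leftrightarrow q_\alpha$, $\pi_\beta\leftrightarrow p_\beta$ and extending by algebra automorphisms gives the action on $\mathcal{F}(n,m)$, and $\varphi(n,m)$ is equivariant. $S^\lambda(\mathbb{C}^m)$ is the irreducible polynomial $GL_m(\mathbb{C})$-module with highest weight the partition $\lambda$ (Schur functor applied to $\mathbb{C}^m$). A $GL$-ideal ($GL_m(\mathbb{C})$-ideal) is a $GL_m(\mathbb{C})$-stable ideal. Elements $r_1,\dots,r_s$ minimally generate a $GL$-ideal $I$ as a $GL$-ideal if each $r_i$ generates an irreducible $GL_m(\mathbb{C})$-submodule, the sum of these submodules is direct, and this sum is a minimal generating subspace of the ideal $I$ (it generates $I$ as an ideal and no proper subspace of it does). *)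

(* Defs.v *)
From HB Require Import structures.
From mathcomp Require Import all_boot all_order all_algebra all_fingroup.
From mathcomp Require Import reals complex.
From mathcomp Require Export mpoly.

Set Implicit Arguments.
Unset Strict Implicit.
Unset Printing Implicit Defensive.

Import GRing.Theory.
Local Open Scope ring_scope.

(* Subspaces, submodules and ideals are Prop-valued predicates. An action is a
   function act : 'M_m -> W -> W, of which only the values act g with g
   invertible matter: those matrices form GL_m(K). *)

Section GLModules.
Variables (K : fieldType) (m : nat).

Definition incl (T : Type) (U V : T -> Prop) : Prop := forall w, U w -> V w.

Definition subspace (W : lmodType K) (U : W -> Prop) : Prop :=
  U 0 /\ forall (a : K) (u v : W), U u -> U v -> U (a *: u + v).

Definition GL_submodule (W : lmodType K) (act : 'M[K]_m -> W -> W)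
    (U : W -> Prop) : Prop :=
  subspace U /\ forall g u, g \in unitmx -> U u -> U (act g u).

Definition GL_generated (W : lmodType K) (act : 'M[K]_m -> W -> W)
    (r : W) : W -> Prop :=
  fun w => forall U : W -> Prop, GL_submodule act U -> U r -> U w.

Definition GL_irreducible (W : lmodType K) (act : 'M[K]_m -> W -> W)
    (U : W -> Prop) : Prop :=
  [/\ GL_submodule act U,
      exists2 u, U u & u <> 0
    & forall U' : W -> Prop, GL_submodule act U' -> incl U' U ->
        (forall u, U' u -> u = 0) \/ incl U U'].

(* The values of the isomorphism f outside U1 are irrelevant. *)
Definition GL_isomorphic (W1 W2 : lmodType K)
    (act1 : 'M[K]_m -> W1 -> W1) (U1 : W1 -> Prop)
    (act2 : 'M[K]_m -> W2 -> W2) (U2 : W2 -> Prop) : Prop :=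
  exists f : W1 -> W2,
    [/\ forall (a : K) (u v : W1), U1 u -> U1 v ->
          f (a *: u + v) = a *: f u + f v,
        forall u, U1 u -> f u = 0 -> u = 0,
        forall w, U2 w <-> exists2 u, U1 u & f u = w
      & forall g u, g \in unitmx -> U1 u -> f (act1 g u) = act2 g (f u)].

Definition ideal (A : comAlgType K) (I : A -> Prop) : Prop :=
  [/\ I 0, forall a b, I a -> I b -> I (a + b) & forall a b, I b -> I (a * b)].

Definition ideal_generated (A : comAlgType K) (S : A -> Prop) : A -> Prop :=
  fun a => forall I : A -> Prop, ideal I -> incl S I -> I a.

Definition GL_ideal (A : comAlgType K) (act : 'M[K]_m -> A -> A)
    (I : A -> Prop) : Prop :=
  ideal I /\ forall g a, g \in unitmx -> I a -> I (act g a).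

Definition sum_of_subspaces (W : lmodType K) (s : nat)
    (U : 'I_s -> W -> Prop) : W -> Prop :=
  fun w => exists2 u : 'I_s -> W, forall i, U i (u i) & w = \sum_i u i.

Definition direct_sum (W : lmodType K) (s : nat)
    (U : 'I_s -> W -> Prop) : Prop :=
  forall u : 'I_s -> W, (forall i, U i (u i)) -> \sum_i u i = 0 ->
    forall i, u i = 0.

Definition minimal_generating_subspace (A : comAlgType K)
    (I S : A -> Prop) : Prop :=
  [/\ subspace S,
      forall a, ideal_generated S a <-> I a
    & forall S' : A -> Prop, subspace S' -> incl S' S ->
        (forall a, ideal_generated S' a <-> I a) -> incl S S'].

Definition minimally_generates (A : comAlgType K) (act : 'M[K]_m -> A -> A)
    (I : A -> Prop) (r : seq A) : Prop :=
  let U (i : 'I_(size r)) := GL_generated act r`_i in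
  [/\ GL_ideal act I,
      forall i, GL_irreducible act (U i),
      direct_sum U
    & minimal_generating_subspace I (sum_of_subspaces U)].

End GLModules.

(* The Schur functor: S^lam(K^m) is the image of the Young symmetrizer of lam
   on (K^m)^(x)d, d = |lam|. A tensor is the function t of its coordinates,
   t i being the coefficient of e_(i 0) (x) ... (x) e_(i (d-1)). *)

Section SchurFunctor.
Variables (K : fieldType) (m : nat) (lam : seq nat).

Local Notation d := (sumn lam).

Definition tensor := {ffun {ffun 'I_d -> 'I_m} -> K^o}.

Definition tensor_act (g : 'M[K]_m) (t : tensor) : tensor :=
  [ffun i : {ffun 'I_d -> 'I_m} =>
    \sum_(j : {ffun 'I_d -> 'I_m}) (\prod_(k < d) g (i k) (j k)) * t j].

Definition permute_places (s : 'S_d) (t : tensor) : tensor :=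
  [ffun i : {ffun 'I_d -> 'I_m} => t [ffun k => i (s k)]].

(* The boxes of the Young diagram are numbered row after row: box k lies in
   row reshape_index lam k and column reshape_offset lam k. *)
Definition row_group : {set 'S_d} :=
  [set s : 'S_d | [forall k, reshape_index lam (s k) == reshape_index lam k]].

Definition col_group : {set 'S_d} :=
  [set s : 'S_d | [forall k, reshape_offset lam (s k) == reshape_offset lam k]].

(* As for the right action of the symmetric group on tensors,
   t . (a_lam * b_lam) = (t . a_lam) . b_lam: rows first, then columns. *)
Definition young_symmetrizer (t : tensor) : tensor :=
  \sum_(s in col_group) (-1) ^+ s *:
    permute_places s (\sum_(s' in row_group) permute_places s' t).

Definition schur_module : tensor -> Prop :=
  fun t => exists u, t = young_symmetrizer u.

End SchurFunctor.

Section MultiIndex.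
Variables (m d : nat).

Record mindex := MIndex { mindex_val :> 'X_{1..m}; _ : mdeg mindex_val == d }.

HB.instance Definition _ := [isSub for mindex_val].
HB.instance Definition _ := [Countable of mindex by <:].

Lemma mindex_lt (a : mindex) : (mdeg a < d.+1)%N.
Proof. by case: a => a /= /eqP ->. Qed.

Definition mindex_bound (a : mindex) : 'X_{1..m < d.+1} :=
  BMultinom (mindex_lt a).

Definition mindex_unbound (b : 'X_{1..m < d.+1}) : option mindex :=
  insub (b : 'X_{1..m}).

Lemma mindex_boundK : pcancel mindex_bound mindex_unbound.
Proof. by move=> a; rewrite /mindex_unbound /= valK. Qed.

HB.instance Definition _ : isFinite mindex := PCanIsFinite mindex_boundK.

End MultiIndex.

Section Dihedral.
Variables (K : fieldType) (n m : nat).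

(* K[V^m] for V = K^2: the first m variables are the x_i, the others the y_i. *)

Definition KV := {mpoly K[m + m]}.

Definition x_ (i : 'I_m) : KV := 'X_(lshift m i).
Definition y_ (i : 'I_m) : KV := 'X_(rshift m i).

Definition GL_act_KV (g : 'M[K]_m) (P : KV) : KV :=
  P \mPo [tuple match split k with
                | inl j => \sum_(i < m) g i j *: x_ i
                | inr j => \sum_(i < m) g i j *: y_ i
                end | k < m + m].

Definition p_ (b : 'X_{1..m}) : KV :=
  \prod_(i < m) x_ i ^+ b i + \prod_(i < m) y_ i ^+ b i.

(* If the entries of a sum to 2, exactly one term is present. *)
Definition q_ (a : 'X_{1..m}) : KV :=
  \sum_(i < m | a i == 2) x_ i * y_ i
  + \sum_(i < m) \sum_(j < m | [&& (i < j)%N, a i == 1%N & a j == 1%N])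
      2%:R^-1 *: (x_ i * y_ j + y_ i * x_ j).

(* Indices of the variables of F(n,m): inl a for rho_a, inr b for pi_b. *)

Definition Fvar := (mindex m 2 + mindex m n)%type.

Definition F := {mpoly K[#|{: Fvar}|]}.

(* Zero when a (resp. b) does not have sum 2 (resp. n). *)
Definition rho (a : 'X_{1..m}) : F :=
  if insub a is Some a' then 'X_(enum_rank (inl a' : Fvar)) else 0.
Definition pi_ (b : 'X_{1..m}) : F :=
  if insub b is Some b' then 'X_(enum_rank (inr b' : Fvar)) else 0.

Definition Fgen (v : Fvar) : KV :=
  match v with inl a => q_ a | inr b => p_ b end.

(* The values are invariant under the dihedral group of order 2n, generated by
   x_i -> w x_i, y_i -> w^-1 y_i (w a primitive n-th root of 1) and
   x_i <-> y_i. Enlarging the codomain from the algebra of its invariants to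
   K[V^m] does not change the kernel. *)
Definition phi (f : F) : KV := f \mPo [tuple Fgen (enum_val k) | k < _].

Definition ker_phi : F -> Prop := fun f => phi f = 0.

(* Inverses, on the spans of the q_c and of the p_c, of the identifications
   rho_c <-> q_c and pi_c <-> p_c: P has the coordinate on q_c (resp. p_c)
   that is read off from its coefficients at the x_i y_j with e_i + e_j = c
   (resp. from its coefficient at x^c). *)
Definition lift_q (P : KV) : F :=
  \sum_(c : mindex m 2)
    (\sum_(i < m) \sum_(j < m | (U_(i) + U_(j))%MM == c)
       P@_(U_(lshift m i) + U_(rshift m j))%MM) *: rho c.
Definition lift_p (P : KV) : F :=
  \sum_(c : mindex m n)
    P@_[multinom match split k with inl i => c i | inr _ => 0%N end
         | k < m + m] *: pi_ c.

Definition GL_act_F (g : 'M[K]_m) (f : F) : F :=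
  f \mPo [tuple match enum_val k : Fvar with
                | inl a => lift_q (GL_act_KV g (q_ a))
                | inr b => lift_p (GL_act_KV g (p_ b))
                end | k < _].

End Dihedral.

(* Meant for l <= m: otherwise entries would be dropped. *)
Definition append_zeros (l m : nat) (a : 'X_{1..l}) : 'X_{1..m} :=
  [multinom nth 0%N a i | i < m].

Definition F_incl (K : fieldType) (n l m : nat) (f : F K n l) : F K n m :=
  f \mPo [tuple match enum_val k : Fvar n l with
                | inl a => rho K n (append_zeros m a)
                | inr b => pi_ K n (append_zeros m b)
                end | k < _].

Section Relations.
Variables (K : fieldType) (n : nat).

Let rho2 (a b : nat) : F K n 2 := rho K n [multinom [tuple a; b]].
Let pi2 (a b : nat) : F K n 2 := pi_ K n [multinom [tuple a; b]].

Definition R_n2 : F K n 2 :=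
  pi2 n 0 * rho2 0 2 - 2%:R *: (pi2 (n - 1) 1 * rho2 1 1)
  + pi2 (n - 2) 2 * rho2 2 0.

Definition R_2k (k : nat) : F K n 2 :=
  ((-1) ^+ k * 2%:R^-1 * 'C(2 * k, k)%:R) *: pi2 (n - k) k ^+ 2
  + \sum_(0 <= j < k) ((-1) ^+ j * 'C(2 * k, j)%:R) *:
      (pi2 (n - j) j * pi2 (n - 2 * k + j) (2 * k - j))
  - 4%:R ^+ k *: (rho2 2 0 ^+ (n - 2 * k)
                  * (rho2 1 1 ^+ 2 - rho2 2 0 * rho2 0 2) ^+ k).

Definition Lambda : seq (seq nat) :=
  [:: n; 2%N] :: [seq [:: 2 * n - 2 * k; 2 * k]%N | k <- iota 1 n./2].

(* Used for lam in Lambda only. For 3 <= n the elements of Lambda are pairwise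
   distinct, so the test recognizes the first one. *)
Definition R_ (lam : seq nat) : F K n 2 :=
  if lam == [:: n; 2%N] then R_n2 else R_2k (nth 0%N lam 1)./2.

End Relations.

(* Main.v *)
(** A map psi from the words of length d = a + b to F(n,m) that transforms like
    the tensors e_w extends to a GL-equivariant map from the tensor power, and
    each relation is the image of the column-antisymmetrized tensor
    e_1^a (x) e_2^b under such a map. This tensor generates S^(a,b), and it lies in
    every nonzero submodule U: otherwise U would be orthogonal to it, hence to
    S^(a,b), for the standard Hermitian form. So the relations generate copies of
    the Schur modules, in the kernel of phi.

    For m = 2 let J be the ideal generated by these modules and let P_j be
    pi_(n-j,j). The lowering operator carries the relation of weight (n,2) to
    P_j rho_02 - 2 P_(j+1) rho_11 + P_(j+2) rho_20, and, by descending induction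
    on the order of the iterated differences of P_i P_j, the other ones yield
    P_i P_(j+1) = P_(i+1) P_j modulo J and K[rho]. Hence modulo J every element is
    a K[rho]-combination of the products of d of the P_j with index sum e, one
    product for each (d, e). Evaluate an element of the kernel at
    x = z^-1 (1, T), y = z (r, 2s - rT). The term of lowest order in z is a
    polynomial in T whose coefficients are those of the products of maximal d, so
    the latter form a multiple of the quadric rho_02 - 2 rho_11 T + rho_20 T^2;
    that is, the part of maximal d reduces modulo J to smaller d.

    The relations lie in degree 2 of the variables of F up to an element of
    K[rho], and phi is injective on K[rho]: an element of the span of the modules
    is determined by its quadratic part, which yields minimality. The sum is
    direct because the weight of each generator does not occur in the later
    modules. *)

From HB Require Import structures.
Require Import Defs.
From mathcomp Require Import all_boot all_order all_algebra all_fingroup.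
From mathcomp Require Import reals complex.
From mathcomp Require Import ring zify.
From mathcomp Require boolp.

Set Implicit Arguments.
Unset Strict Implicit.
Unset Printing Implicit Defensive.

Import GRing.Theory Num.Theory.
Local Open Scope ring_scope.

(** * Interpolation in subspaces and permanents *)

(** The shape of the relations: in the alternating binomial sum of products of two p, the pure terms
    cancel as (1 - 1)^(2k) and the mixed ones give twice (x_1 y_1)^(n-2k) D^(2k), where D = x_1 y_2
    - y_1 x_2; since q_11^2 - q_20 q_02 = D^2 / 4, the constant 4^k appears. The exchange relations
    hold modulo the subspace J + K[rho], and the descent can take place there because J and K[rho]
    are both stable under lowering. At the chosen point every rho, of bidegree (1, 1) in x and y, is
    free of z, whereas each pi has a pole z^-n coming from x: the number of factors pi becomes
    visible as a pole order. Moreover r, s and T are independent there, and the quadric is the only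
    condition that ties rho_02 to them. Two obstacles shape the first half: a submodule is stable
    under invertible matrices only, whereas row symmetrization produces singular ones, which
    interpolation in a parameter repairs; and orthogonality yields irreducibility because the
    adjoint of an invertible matrix is again invertible. *)

Section Subspaces.
Variables (K : fieldType) (W : lmodType K) (U : W -> Prop).
Hypothesis subU : subspace U.

Lemma subspace0 : U 0. Proof. by case: subU. Qed.

Lemma subspaceZD a u v : U u -> U v -> U (a *: u + v).
Proof. by case: subU => _; apply. Qed.

Lemma subspaceZ a u : U u -> U (a *: u).
Proof. by move=> Uu; rewrite -[_ *: _]addr0; apply: subspaceZD => //; apply: subspace0. Qed.

Lemma subspaceD u v : U u -> U v -> U (u + v).
Proof. by move=> Uu Uv; rewrite -[u]scale1r; apply: subspaceZD. Qed.

Lemma subspaceN u : U u -> U (- u).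
Proof. by move=> Uu; rewrite -scaleN1r; apply: subspaceZ. Qed.

Lemma subspaceB u v : U u -> U v -> U (u - v).
Proof. by move=> Uu Uv; apply: subspaceD => //; apply: subspaceN. Qed.

Lemma subspace_sum (I : Type) (r : seq I) (P : pred I) (F : I -> W) :
  (forall i, P i -> U (F i)) -> U (\sum_(i <- r | P i) F i).
Proof.
by move=> UF; apply: big_ind => //; [apply: subspace0 | apply: subspaceD].
Qed.

Lemma subspaceZ_inv a u : a != 0 -> U (a *: u) -> U u.
Proof.
by move=> a0 Uau; rewrite -[u]scale1r -(mulVf a0) -scalerA; apply: subspaceZ.
Qed.

End Subspaces.

Section Vandermonde.
Variable K : numFieldType.

Lemma nonroots (q : {poly K}) N : q != 0 ->
  exists s : seq K, [/\ uniq s, size s = N & all (fun t => ~~ root q t) s].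
Proof.
move=> q0; pose s0 : seq K := [seq i%:R | i <- iota 0 (N + size q)].
have s0U : uniq s0.
  by rewrite map_inj_in_uniq ?iota_uniq // => i j _ _ /(mulrIn (oner_neq0 _)).
pose s1 := filter (predC (root q)) s0.
have szs : (N <= size s1)%N.
  have := count_predC (root q) s0; rewrite size_map size_iota size_filter.
  have : (size (filter (root q) s0) < size q)%N.
    by apply: max_poly_roots; rewrite ?filter_all ?filter_uniq.
  by rewrite size_filter; lia.
exists (take N s1); split; first by rewrite take_uniq ?filter_uniq.
  by rewrite size_takel.
by apply/allP => x /mem_take; rewrite mem_filter => /andP[].
Qed.

(** The Vandermonde matrix at [N] distinct non-roots of [q] is invertible, so each coefficient of
    the curve is a combination of its values. The polynomial [q] excludes finitely many parameters,
    such as those at which a matrix is singular. *)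
Lemma vandermonde_subspace (W : lmodType K) (U : W -> Prop) (q : {poly K})
    (N : nat) (u : nat -> W) :
  subspace U -> q != 0 ->
  (forall t, ~~ root q t -> U (\sum_(k < N) t ^+ k *: u k)) ->
  forall k, (k < N)%N -> U (u k).
Proof.
move=> subU q0 Ut k ltkN.
have [s [sU ssz snr]] := nonroots N q0.
pose V : 'M[K]_N := Vandermonde N (\row_j s`_j).
have Vu : V \in unitmx.
  rewrite unitmxE det_Vandermonde unitfE; apply/prodf_neq0 => i _.
  apply/prodf_neq0 => j ltij; rewrite !mxE subr_eq0 nth_uniq ?ssz ?ltn_ord //.
  by rewrite gtn_eqF.
pose k' := Ordinal ltkN.
have -> : u k = \sum_j invmx V j k' *: \sum_(i < N) s`_j ^+ i *: u i.
  under eq_bigr do rewrite scaler_sumr.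
  rewrite exchange_big /= (bigD1 k') //= [X in _ + X]big1.
    rewrite addr0 (eq_bigr (fun j => (V k' j * invmx V j k') *: u k)).
      rewrite -scaler_suml; have /matrixP/(_ k' k') := mulmxV Vu.
      by rewrite !mxE eqxx => ->; rewrite scale1r.
    by move=> j _; rewrite scalerA !mxE mulrC.
  move=> i ik; rewrite (eq_bigr (fun j => (V i j * invmx V j k') *: u i)).
    rewrite -scaler_suml; have /matrixP/(_ i k') := mulmxV Vu.
    by rewrite !mxE (negPf ik) => ->; rewrite scale0r.
  by move=> j _; rewrite scalerA !mxE mulrC.
apply: subspace_sum => // j _; apply: subspaceZ => //; apply: Ut.
by apply: (allP snr); rewrite mem_nth // ssz.
Qed.

End Vandermonde.

Section Ryser.
Variable K : comNzRingType.

(** Inclusion and exclusion over sets [e] of columns: after expansion, the signs cancel every choice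
    function [f] that is not onto, and the remaining ones are permutations. *)
Lemma ryser d (M : 'I_d -> 'I_d -> K) :
  \sum_(s : 'S_d) \prod_k M k (s k) =
  \sum_(e : {ffun 'I_d -> bool}) (\prod_l (-1) ^+ (~~ e l)) *
     \prod_k \sum_l (e l)%:R * M k l.
Proof.
symmetry.
under eq_bigr do rewrite bigA_distr_bigA big_distrr /=.
rewrite exchange_big /=.
pose A (f : {ffun 'I_d -> 'I_d}) := \prod_k M k (f k).
pose ch (f : {ffun 'I_d -> 'I_d}) l : K := (l \in codom f)%:R.
rewrite (eq_bigr (fun f => A f * \prod_l ch f l)); last first.
  move=> f _; rewrite /A.
  (* For fixed [f] the sum over [e] factors over the columns: a column [l] in the image of [f]
     forces [e l] and contributes 1, any other one contributes 1 - 1 = 0. *)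
  rewrite (eq_bigr (fun e : {ffun 'I_d -> bool} => \prod_k M k (f k) *
     \prod_l (if e l then 1 else if l \in codom f then 0 else -1))); last first.
    move=> e _; rewrite big_split /= mulrA mulrC; congr (_ * _).
    have [/forallP cod|/forallPn[k ek]] := boolP [forall k, e (f k)].
      rewrite [X in _ * X]big1 ?mulr1; last by move=> k _; rewrite cod.
      apply: eq_bigr => l _; case el: (e l) => //=.
      by case: codomP => // -[k lk]; rewrite lk cod in el.
    rewrite [X in _ * X](bigD1 k) //= (negPf ek) mul0r mulr0.
    by rewrite (bigD1 (f k)) //= (negPf ek) codom_f mul0r.
  rewrite -big_distrr /= -(bigA_distr_bigA (fun l (b : bool) =>
    if b then 1 else if l \in codom f then 0 else -1)) /=.
  congr (_ * _); apply: eq_bigr => l _; rewrite big_bool /ch /=.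
  by case: (l \in codom f) => /=; rewrite ?addr0 ?subrr.
rewrite (bigID (fun f : {ffun 'I_d -> 'I_d} => injectiveb f) predT) /=.
rewrite [X in _ + X]big1 ?addr0; last first.
  move=> f nif; suff [l lf] : exists l, l \notin codom f.
    by rewrite [X in _ * X](bigD1 l) //= /ch (negPf lf) mul0r mulr0.
  apply/existsP; apply: contraR nif; rewrite negb_exists => /forallP cf.
  apply/injectiveP => x y; suff /image_injP fI : #|codom f| == #|{: ordinal d}|.
    exact: fI.
  apply/eqP.
  by apply: eq_card => z; have := cf z; rewrite negbK inE.
rewrite (reindex (@pval _)) /=.
  apply: eq_big => [s|s _]; first by rewrite (valP s).
  rewrite [X in _ * X]big1 ?mulr1 => [|l _].
    by apply: eq_bigr => k _; rewrite -pvalE.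
  by rewrite /ch -[l](permKV s) -pvalE codom_f.
exists (insubd (1%g : 'S_d)) => [s _|f]; first exact: valKd.
by move=> f_inj; rewrite insubdK.
Qed.

End Ryser.

(** * Schur modules of two-row shapes *)

Section TensorAction.
Variables (K : fieldType) (m : nat) (lam : seq nat).
Local Notation d := (sumn lam).
Local Notation word := {ffun 'I_d -> 'I_m}.
Local Notation tens := (tensor K m lam).

Lemma tensor_actE (g : 'M[K]_m) (t : tens) (i : word) :
  tensor_act g t i = \sum_(j : word) (\prod_(k < d) g (i k) (j k)) * t j.
Proof. by rewrite ffunE. Qed.

Lemma tensor_actZD (g : 'M[K]_m) c (t u : tens) :
  tensor_act g (c *: t + u) = c *: tensor_act g t + tensor_act g u.
Proof.
apply/ffunP => i; rewrite !ffunE /GRing.scale /= mulr_sumr -big_split /=.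
by apply: eq_bigr => j _; rewrite !ffunE mulrDr mulrCA.
Qed.

Lemma permute_placesE s (t : tens) (i : word) :
  permute_places s t i = t [ffun k => i (s k)].
Proof. by rewrite ffunE. Qed.

Lemma permute_placesZD s c (t u : tens) :
  permute_places s (c *: t + u) = c *: permute_places s t + permute_places s u.
Proof. by apply/ffunP => i; rewrite !ffunE. Qed.

Lemma permute_places_act (g : 'M[K]_m) s (t : tens) :
  permute_places s (tensor_act g t) = tensor_act g (permute_places s t).
Proof.
apply/ffunP => i; rewrite permute_placesE !tensor_actE.
pose h (j : word) : word := [ffun k => j (s k)].
have h_bij : bijective h.
  exists (fun j : word => [ffun k => j ((s^-1)%g k)]) => j; apply/ffunP => k.
    by rewrite !ffunE permKV.
  by rewrite !ffunE permK.
rewrite (reindex h) /=; last exact: onW_bij.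
apply: eq_bigr => j _; rewrite permute_placesE; congr (_ * _).
by rewrite [RHS](reindex_perm s); apply: eq_bigr => k _; rewrite !ffunE.
Qed.

Section LinearMaps.
Variables (V W : lmodType K) (f : V -> W).
Hypothesis fZD : forall c u v, f (c *: u + v) = c *: f u + f v.

Lemma lin0 : f 0 = 0.
Proof. by have := fZD (-1) 0 0; rewrite scaler0 addr0 scaleN1r addNr. Qed.
Lemma linZ c u : f (c *: u) = c *: f u.
Proof. by have := fZD c u 0; rewrite !addr0 lin0 addr0. Qed.
Lemma linD u v : f (u + v) = f u + f v.
Proof. by have := fZD 1 u v; rewrite !scale1r. Qed.
Lemma lin_sum (I : Type) (r : seq I) (P : pred I) (F : I -> V) :
  f (\sum_(i <- r | P i) F i) = \sum_(i <- r | P i) f (F i).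
Proof. exact: (big_morph _ linD lin0). Qed.

End LinearMaps.

Definition row_sum (t : tens) : tens :=
  \sum_(s in row_group lam) permute_places s t.

Definition col_antisym (t : tens) : tens :=
  \sum_(s in col_group lam) (-1) ^+ s *: permute_places s t.

Lemma young_symmetrizerE t : young_symmetrizer t = col_antisym (row_sum t).
Proof. by []. Qed.

Lemma row_sumZD c t u : row_sum (c *: t + u) = c *: row_sum t + row_sum u.
Proof.
rewrite /row_sum scaler_sumr -big_split /=.
by apply: eq_bigr => s _; rewrite permute_placesZD.
Qed.

Lemma col_antisymZD c t u :
  col_antisym (c *: t + u) = c *: col_antisym t + col_antisym u.
Proof.
rewrite /col_antisym scaler_sumr -big_split /=.
by apply: eq_bigr => s _; rewrite permute_placesZD scalerDr !scalerA mulrC.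
Qed.

Lemma row_sum_act g t : row_sum (tensor_act g t) = tensor_act g (row_sum t).
Proof.
rewrite (lin_sum (tensor_actZD g)).
by apply: eq_bigr => s _; rewrite permute_places_act.
Qed.

Lemma col_antisym_act g t :
  col_antisym (tensor_act g t) = tensor_act g (col_antisym t).
Proof.
rewrite (lin_sum (tensor_actZD g)).
by apply: eq_bigr => s _; rewrite permute_places_act (linZ (tensor_actZD g)).
Qed.

Lemma schur_module_submod :
  GL_submodule (@tensor_act K m lam) (@schur_module K m lam).
Proof.
split; first split.
- exists 0; rewrite young_symmetrizerE (lin0 row_sumZD).
  by rewrite (lin0 col_antisymZD).
- move=> c _ _ [u ->] [v ->]; exists (c *: u + v).
  by rewrite !young_symmetrizerE row_sumZD col_antisymZD.
move=> g _ _ [u ->]; exists (tensor_act g u).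
by rewrite !young_symmetrizerE row_sum_act col_antisym_act.
Qed.

Lemma col_antisymP (t : tens) s (x : word) : s \in col_group lam ->
  col_antisym t [ffun k => x (s k)] = (-1) ^+ s * col_antisym t x.
Proof.
move=> cs; rewrite !sum_ffunE mulr_sumr.
rewrite [RHS](reindex_inj (mulIg s)) /=.
apply: eq_big => [s'|s' _].
  rewrite !inE; apply: eq_forallb => k; rewrite permM.
  by move: cs; rewrite inE => /forallP/(_ (s' k))/eqP ->.
rewrite !ffunE /GRing.scale /= odd_permM signr_addb mulrA.
rewrite [_ * (_ * (-1) ^+ s)]mulrCA -[X in _ = _ * X * _]signr_addb addbb mulr1.
congr (_ * t _).
by apply/ffunP => k; rewrite !ffunE permM.
Qed.

Definition delta_tens (w : word) : tens := [ffun x => (x == w)%:R].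

Lemma tensor_delta (t : tens) : t = \sum_w t w *: delta_tens w.
Proof.
apply/ffunP => x; rewrite sum_ffunE (bigD1 x) //= big1 ?addr0.
  by rewrite !ffunE /GRing.scale /= eqxx mulr1.
by move=> w wx; rewrite !ffunE /GRing.scale /= eq_sym (negPf wx) mulr0.
Qed.

Lemma tensor_act_delta (g : 'M[K]_m) (w x : word) :
  tensor_act g (delta_tens w) x = \prod_k g (x k) (w k).
Proof.
rewrite tensor_actE (bigD1 w) //= [X in _ + X]big1 => [|j jw].
  by rewrite addr0 ffunE eqxx mulr1.
by rewrite ffunE (negPf jw) mulr0.
Qed.

End TensorAction.

(** * Stability of submodules under singular matrices *)

Section EndClosure.
Variables (K : numClosedFieldType) (m : nat) (lam : seq nat).
Local Notation d := (sumn lam).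
Local Notation word := {ffun 'I_d -> 'I_m}.
Local Notation tens := (tensor K m lam).

Lemma unitmx_shift (g : 'M[K]_m) t :
  ~~ root (char_poly (- g)) t -> g + t%:M \in unitmx.
Proof.
rewrite -eigenvalue_root_char negbK /eigenspace kermx_eq0 row_free_unit.
by rewrite -opprD -scaleN1r unitmxZ // unitrN unitr1.
Qed.

(** Serves for the curve [g + t], whose constant coefficient gives the action of a singular [g], and
    for a torus, whose coefficients are the weight components. *)
Lemma tensor_poly_coef (U : tens -> Prop) (P : word -> {poly K}) q :
  subspace U -> q != 0 ->
  (forall t, ~~ root q t -> U [ffun x => (P x).[t]]) ->
  forall l, U [ffun x => (P x)`_l].
Proof.
move=> subU q0 Ut l; pose N := (l.+1 + \max_x size (P x))%N.
apply: (@vandermonde_subspace K tens U q N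
          (fun k => [ffun x => (P x)`_k]) subU q0); last by rewrite /N; lia.
move=> t /Ut; congr U; apply/ffunP => x; rewrite sum_ffunE ffunE.
rewrite (@horner_coef_wide _ N).
  by apply: eq_bigr => k _; rewrite !ffunE /GRing.scale /= mulrC.
exact: leq_trans (leq_bigmax (F := fun y => size (P y)) x) (leq_addl _ _).
Qed.

(** The matrix [g + t%:M] is invertible unless [t] is an eigenvalue of [-g], and the image of [v]
    under it is polynomial in [t] with constant coefficient the image under [g]. *)
Lemma GL_submodule_End (U : tens -> Prop) (v : tens) (g : 'M[K]_m) :
  GL_submodule (@tensor_act K m lam) U -> U v -> U (tensor_act g v).
Proof.
move=> [subU GLU] Uv.
pose P (x : word) : {poly K} :=
  \sum_(j : word) (\prod_k ((g (x k) (j k))%:P + (x k == j k)%:R *: 'X)) * (v j)%:P.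
have PE t : [ffun x => (P x).[t]] = tensor_act (g + t%:M) v.
  apply/ffunP => x; rewrite ffunE tensor_actE horner_sum.
  apply: eq_bigr => j _; rewrite hornerM horner_prod hornerC; congr (_ * _).
  apply: eq_bigr => k _; rewrite hornerD hornerC hornerZ hornerX !mxE.
  by rewrite mulr_natl.
have -> : tensor_act g v = [ffun x => (P x)`_0].
  by rewrite -[g]addr0 -(raddf0 (@scalar_mx K m)) -PE; apply/ffunP => x; rewrite !ffunE horner_coef0.
apply: (@tensor_poly_coef U P (char_poly (- g))) => //.
  by rewrite monic_neq0 ?char_poly_monic.
by move=> t /unitmx_shift gu; rewrite PE; apply: GLU.
Qed.

End EndClosure.

Lemma natr_forall (R : comNzRingType) (I : finType) (B : pred I) :
  \prod_(i : I) (B i)%:R = [forall i, B i]%:R :> R.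
Proof.
have [/forallP allB|/forallPn[i nB]] := boolP [forall i, B i].
  by rewrite big1 // => i _; rewrite allB.
by rewrite (bigD1 i) //= (negPf nB) mul0r.
Qed.

Section TwoRows.
Variables (K : numClosedFieldType) (m a b : nat).
Hypothesis leba : (b <= a)%N.
Local Notation lam := [:: a; b].
Local Notation d := (sumn lam).
Local Notation word := {ffun 'I_d -> 'I_m.+2}.
Local Notation tens := (tensor K m.+2 lam).

Definition i0 : 'I_m.+2 := ord0.
Definition i1 : 'I_m.+2 := lift ord0 ord0.

Lemma reshape_index2 k : (k < a + b)%N -> reshape_index lam k = (a <= k)%N.
Proof.
move=> ltk; rewrite /reshape_index /= subn_eq0; case: leqP => //= lak.
by rewrite -subnDA subn_eq0 ltk.
Qed.

Lemma reshape_offset2 k : (k < a + b)%N ->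
  reshape_offset lam k = (if k < a then k else k - a)%N.
Proof.
move=> ltk; rewrite /reshape_offset reshape_index2 //.
by case: leqP => _ /=; lia.
Qed.

Lemma ltn_d (k : 'I_d) : (k < a + b)%N.
Proof. by apply: leq_trans (ltn_ord k) _; rewrite /= addn0. Qed.

Definition top_word : word := [ffun k : 'I_d => if (k < a)%N then i0 else i1].

Lemma top_word_eq (k l : 'I_d) :
  (top_word k == top_word l) = (reshape_index lam k == reshape_index lam l).
Proof.
rewrite !ffunE !reshape_index2 ?ltn_d // !(leqNgt a).
by case: (k < a)%N; case: (l < a)%N.
Qed.

(* A highest weight vector of weight (a, b). *)
Definition hwv : tens := col_antisym (delta_tens K top_word).

(* Ryser's formula for permanents turns the sum over the row group into a
   combination of images of e_top_word under matrices, possibly singular. *)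
Lemma row_sum_delta (w : word) :
  row_sum (delta_tens K w) =
  \sum_(e : {ffun 'I_d -> bool}) (\prod_l (-1) ^+ (~~ e l)) *:
    tensor_act (\matrix_(i, j) \sum_l (e l)%:R *
                  ((w l == i) && (top_word l == j))%:R) (delta_tens K top_word).
Proof.
apply/ffunP => x; rewrite !sum_ffunE.
pose M k l : K := ((w l == x k) && (top_word l == top_word k))%:R.
transitivity (\sum_(s : 'S_d) \prod_k M k (s k)); last first.
  rewrite ryser; apply: eq_bigr => e _; rewrite ffunE tensor_act_delta.
  by rewrite /GRing.scale /=; congr (_ * _); apply: eq_bigr => k _; rewrite mxE.
(* After inversion the 0/1 factors say that [x] composed with [s] is [w] and, as [top_word] labels
   the places by their rows, that [s] lies in the row group. *)
rewrite (reindex_inj invg_inj) /= big_mkcond /=; apply: eq_bigr => s _.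
rewrite natr_forall inE; case: forallP => [rs|nrs]; last first.
  case: forallP => // E; case: nrs => k.
  by have /andP[_] := E (s^-1 k)%g; rewrite permKV top_word_eq eq_sym.
rewrite !ffunE; congr (_ %:R); congr nat_of_bool.
apply/eqP/forallP => [/ffunP E k|E].
  apply/andP; split; first by rewrite -E ffunE permK.
  by rewrite top_word_eq; have := rs (s k); rewrite permK eq_sym.
apply/ffunP => k; rewrite ffunE; have /andP[/eqP <- _] := E ((s^-1)%g k).
by rewrite permKV.
Qed.

(** By [row_sum_delta] a row-symmetrized word is a combination of images of [e_top_word] under
    matrices; column antisymmetrization commutes with these and turns [e_top_word] into [hwv]. The
    matrices may be singular, whence [GL_submodule_End]. *)
Lemma schur_sub_hwv (U : tens -> Prop) :
  GL_submodule (@tensor_act K m.+2 lam) U -> U hwv ->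
  incl (@schur_module K m.+2 lam) U.
Proof.
move=> GLU Uv _ [u ->]; have subU := proj1 GLU.
rewrite young_symmetrizerE [u in row_sum u]tensor_delta.
rewrite (lin_sum (@row_sumZD _ _ _)) (lin_sum (@col_antisymZD _ _ _)).
apply: subspace_sum => // w _.
rewrite (linZ (@row_sumZD _ _ _)) (linZ (@col_antisymZD _ _ _)).
apply: subspaceZ => //; rewrite row_sum_delta (lin_sum (@col_antisymZD _ _ _)).
apply: subspace_sum => // e _; rewrite (linZ (@col_antisymZD _ _ _)).
by apply: subspaceZ => //; rewrite col_antisym_act; apply: GL_submodule_End.
Qed.

(** [top_word] is constant on rows, so row symmetrization only multiplies it by the order of the row
    group, which is invertible in characteristic 0. *)
Lemma hwv_schur : schur_module hwv.
Proof.
have rowT : row_sum (delta_tens K top_word) =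
            #|row_group lam|%:R *: delta_tens K top_word.
  apply/ffunP => x; rewrite sum_ffunE -sum1_card natr_sum scaler_suml sum_ffunE.
  apply: eq_bigr => s; rewrite inE => /forallP rs.
  rewrite scale1r !ffunE; congr (_ %:R); congr nat_of_bool.
  apply/eqP/eqP => [/ffunP E|->].
    apply/ffunP => k; have := E ((s^-1)%g k); rewrite ffunE permKV => ->.
    by apply/eqP; rewrite top_word_eq; have := rs ((s^-1)%g k); rewrite permKV eq_sym.
  by apply/ffunP => k; rewrite ffunE; apply/eqP; rewrite top_word_eq.
exists (#|row_group lam|%:R^-1 *: delta_tens K top_word).
rewrite young_symmetrizerE (linZ (@row_sumZD _ _ _)) rowT scalerA mulVf ?scale1r //.
rewrite pnatr_eq0 -lt0n; apply/card_gt0P; exists 1%g; rewrite inE.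
by apply/forallP => k; rewrite perm1.
Qed.

End TwoRows.

Section Columns.
Variables (K : numClosedFieldType) (m a b : nat).
Hypothesis leba : (b <= a)%N.
Local Notation lam := [:: a; b].
Local Notation d := (sumn lam).
Local Notation word := {ffun 'I_d -> 'I_m.+2}.
Local Notation tens := (tensor K m.+2 lam).
Local Notation i0 := (i0 m).
Local Notation i1 := (i1 m).
Local Notation top_word := (top_word m a b).
Local Notation hwv := (hwv K m a b).

Lemma lo_proof (c : 'I_b) : (c < d)%N.
Proof. by rewrite /= addn0; apply: ltn_addl. Qed.
Lemma hi_proof (c : 'I_b) : (a + c < d)%N.
Proof. by rewrite /= addn0 ltn_add2l. Qed.

(* The two boxes of column c. *)
Definition lo (c : 'I_b) : 'I_d := Ordinal (lo_proof c).
Definition hi (c : 'I_b) : 'I_d := Ordinal (hi_proof c).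

Lemma ltc (c : 'I_b) : (c < a)%N. Proof. exact: leq_trans leba. Qed.

Lemma lo_neq_hi c : lo c != hi c.
Proof. by rewrite -val_eqE /= neq_ltn (leq_trans (ltc c)) ?leq_addr. Qed.

Definition antisym (z : tens) := forall c (x : word),
  z [ffun k => x (tperm (lo c) (hi c) k)] = - z x.

Lemma offset_lo c : reshape_offset lam (lo c) = c.
Proof. by rewrite reshape_offset2 ?ltn_d //= ltc. Qed.

Lemma offset_hi c : reshape_offset lam (hi c) = c.
Proof. by rewrite reshape_offset2 ?ltn_d //= ltnNge leq_addr /= addKn. Qed.

Lemma col_antisym_anti t : antisym (col_antisym t).
Proof.
move=> c x; rewrite col_antisymP.
  by rewrite odd_tperm lo_neq_hi expr1 mulN1r.
rewrite inE; apply/forallP => k; case: tpermP => [->|->|//].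
  by rewrite offset_lo offset_hi.
by rewrite offset_lo offset_hi.
Qed.

Lemma antisym_eq z c (x : word) : antisym z -> x (lo c) = x (hi c) -> z x = 0.
Proof.
move=> az xc; have := az c x.
have -> : [ffun k => x (tperm (lo c) (hi c) k)] = x.
  by apply/ffunP => k; rewrite ffunE; case: tpermP => // ->.
by move/eqP; rewrite -addr_eq0 -mulr2n mulrn_eq0 => /eqP.
Qed.

(** False for [k >= b], so that in [col_word] a box of the first row with no box beneath keeps its
    letter. *)
Definition in_set_nat (S : {set 'I_b}) (k : nat) :=
  [exists c, (c \in S) && (val c == k)].

Lemma in_set_natE S (c : 'I_b) : in_set_nat S c = (c \in S).
Proof.
apply/existsP/idP => [[c' /andP[c'S /eqP/val_inj cc']]|cS]; first by rewrite -cc'.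
by exists c; rewrite cS eqxx.
Qed.

Lemma in_set_nat_ge S k : (b <= k)%N -> in_set_nat S k = false.
Proof.
move=> lebk; rewrite /in_set_nat; apply/negbTE/negP => /existsP[c /andP[_ /eqP E]].
by have := ltn_ord c; rewrite E ltnNge lebk.
Qed.

(* [top_word], with the two letters of each column in S exchanged. *)
Definition col_word (S : {set 'I_b}) : word :=
  [ffun k : 'I_d => if (k < a)%N then (if in_set_nat S k then i1 else i0)
                    else (if in_set_nat S (k - a) then i0 else i1)].

Lemma col_word_lo S c : col_word S (lo c) = if c \in S then i1 else i0.
Proof. by rewrite ffunE /= ltc in_set_natE. Qed.

Lemma col_word_hi S c : col_word S (hi c) = if c \in S then i0 else i1.
Proof. by rewrite ffunE /= ltnNge leq_addr /= addKn in_set_natE. Qed.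

Lemma col_word0 : col_word set0 = top_word.
Proof.
have e k : in_set_nat set0 k = false.
  by rewrite /in_set_nat; apply/negbTE/negP => /existsP[c]; rewrite inE.
by apply/ffunP => k; rewrite !ffunE !e.
Qed.

Lemma place_ind (P : 'I_d -> Prop) :
  (forall c, P (lo c)) -> (forall c, P (hi c)) ->
  (forall k : 'I_d, (b <= k < a)%N -> P k) -> forall k, P k.
Proof.
move=> Plo Phi Pm k; case: (ltnP k b) => kb.
  by rewrite (_ : k = lo (Ordinal kb)) //; apply: val_inj.
case: (ltnP k a) => ka; first by apply: Pm; rewrite kb.
have kb' : (k - a < b)%N by have := ltn_d k; lia.
by rewrite (_ : k = hi (Ordinal kb')) //; apply: val_inj; rewrite /= subnKC.
Qed.

Lemma col_word_mid S (k : 'I_d) : (b <= k < a)%N -> col_word S k = i0.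
Proof. by case/andP => bk ka; rewrite ffunE ka in_set_nat_ge. Qed.

Lemma lo_inj : injective lo.
Proof. by move=> c c' /(congr1 val) /= /val_inj. Qed.

Lemma hi_inj : injective hi.
Proof. by move=> c c' /(congr1 val) /= /addnI /val_inj. Qed.

Lemma lo_hi c c' : (lo c == hi c') = false.
Proof. by rewrite -val_eqE /= ltn_eqF // (leq_trans (ltc c)) ?leq_addr. Qed.

Lemma col_wordU1 (S : {set 'I_b}) c : c \notin S ->
  col_word (c |: S) = [ffun k => col_word S (tperm (lo c) (hi c) k)].
Proof.
move=> cS; apply/ffunP; apply: place_ind => [c'|c'|k km]; rewrite [RHS]ffunE.
- have [->|nc] := eqVneq c' c.
    by rewrite tpermL col_word_lo col_word_hi !inE eqxx (negPf cS).
  rewrite tpermD ?(inj_eq lo_inj) 1?eq_sym ?lo_hi //.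
  by rewrite !col_word_lo !inE (negPf nc).
- have [->|nc] := eqVneq c' c.
    by rewrite tpermR col_word_lo col_word_hi !inE eqxx (negPf cS).
  rewrite tpermD ?(inj_eq hi_inj) ?lo_hi //; last by rewrite eq_sym.
  by rewrite !col_word_hi !inE (negPf nc).
rewrite tpermD ?col_word_mid // -val_eqE /=.
  by rewrite ltn_eqF //; apply: leq_trans (ltn_ord c) _; case/andP: km.
by rewrite gtn_eqF //; case/andP: km => _ ka; rewrite (leq_trans ka) ?leq_addr.
Qed.

Lemma antisym_col_word z S : antisym z ->
  z (col_word S) = (-1) ^+ #|S| * z top_word.
Proof.
move=> az; elim: {S}_.+1 {-2}S (ltnSn #|S|) => // n IHn S.
have [->|[c cS]] := set_0Vmem S; first by rewrite cards0 col_word0 mul1r.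
rewrite (cardsD1 c) cS ltnS => leSn.
rewrite -(setD1K cS) col_wordU1 ?setD11 // az IHn //.
by rewrite setD1K // exprS mulN1r mulNr.
Qed.

Definition place_ext (F : 'I_d -> nat) (j : nat) : nat :=
  if insub j is Some k then F k else 0%N.

Lemma place_extE F (k : 'I_d) : place_ext F k = F k.
Proof. by rewrite /place_ext valK. Qed.

Lemma place_split (F : 'I_d -> nat) :
  (\sum_k F k = \sum_(c : 'I_b) (F (lo c) + F (hi c)) +
     \sum_(b <= j < a) place_ext F j)%N.
Proof.
rewrite (eq_bigr (fun k : 'I_d => place_ext F k)) => [|k _]; last by rewrite place_extE.
rewrite -(big_mkord xpredT (place_ext F)).
have le_ad : (a <= d)%N by rewrite /= leq_addr.
rewrite (big_cat_nat (n := a)) //= (big_cat_nat (n := b)) //= addn0.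
rewrite big_split /= -!addnA; congr (_ + _)%N.
  by rewrite big_mkord; apply: eq_bigr => c _; rewrite -(place_extE F (lo c)).
rewrite addnC; congr (_ + _)%N.
rewrite -{1}[a]add0n big_addn addKn big_mkord.
by apply: eq_bigr => c _; rewrite -(place_extE F (hi c)) /= addnC.
Qed.

(** The exponent with which the torus element diag(1, t, t^2, ...) scales the basis tensor [e_x]. *)
Definition wt (x : word) : nat := (\sum_k x k)%N.

Lemma wt_ge (x : word) : (forall c, x (lo c) != x (hi c)) -> (b <= wt x)%N.
Proof.
move=> dx; rewrite /wt place_split -[X in (X <= _)%N]addn0 leq_add //.
rewrite -[X in (X <= _)%N]card_ord -sum1_card leq_sum // => c _.
by have := dx c; rewrite -val_eqE /=; lia.
Qed.

Lemma addn_eq1 p q : (p + q = 1)%N -> (p = 1 /\ q = 0)%N \/ (p = 0 /\ q = 1)%N.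
Proof. by lia. Qed.

(** Two distinct letters have sum at least 1, so weight [b] leaves no slack: each column of two
    boxes carries the letters 0 and 1, and all other letters are 0. *)
Lemma wt_eq (x : word) : (forall c, x (lo c) != x (hi c)) -> wt x = b ->
  exists S, x = col_word S.
Proof.
move=> dx; rewrite /wt place_split => E.
have gt1 c : (0 < x (lo c) + x (hi c))%N.
  by have := dx c; rewrite -val_eqE /= => ?; lia.
have E1 : (\sum_(c : 'I_b) (x (lo c) + x (hi c) - 1) = 0)%N.
  rewrite sumnB // sum1_card card_ord; apply/eqP; rewrite subn_eq0 -[X in (_ <= X)%N]E; exact: leq_addr.
have E2 : (\sum_(b <= j < a) place_ext (fun k => x k) j = 0)%N.
  have : (\sum_(c : 'I_b) 1 <= \sum_(c : 'I_b) (x (lo c) + x (hi c)))%N.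
    exact: leq_sum.
  rewrite sum1_card card_ord -[X in (X <= _)%N]E -[X in (_ <= X)%N]addn0.
  by rewrite leq_add2l leqn0 => /eqP.
have {}E1 c : (x (lo c) + x (hi c) = 1)%N.
  move/eqP: E1; rewrite sum_nat_eq0 => /forallP/(_ c)/eqP; have := gt1 c; lia.
exists [set c | x (lo c) == i1]; apply/ffunP; apply: place_ind => [c|c|k km].
- rewrite col_word_lo inE; case: eqP => [//|nx]; apply: ord_inj.
  have nx1 : nat_of_ord (x (lo c)) <> 1%N by move=> e; apply: nx; apply: ord_inj.
  by have [[]|[]] := addn_eq1 (E1 c).
- rewrite col_word_hi inE; case: eqP => [xc|nx]; apply: ord_inj.
    by have [[_]|[]] := addn_eq1 (E1 c); rewrite // xc.
  have nx1 : nat_of_ord (x (lo c)) <> 1%N by move=> e; apply: nx; apply: ord_inj.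
  by have [[]|[]] := addn_eq1 (E1 c).
rewrite col_word_mid //; apply: ord_inj.
move/eqP: E2; rewrite sum_nat_seq_eq0 => /allP/(_ (val k)).
by rewrite mem_index_iota place_extE => /(_ km) /eqP.
Qed.

Lemma col_word_inj : injective col_word.
Proof.
move=> S S' /ffunP E; apply/setP => c; have := E (lo c).
by rewrite !col_word_lo; case: (c \in S); case: (c \in S').
Qed.

Lemma wt_col_word S : wt (col_word S) = b.
Proof.
rewrite /wt place_split [X in (X + _)%N](eq_bigr (fun=> 1%N)); last first.
  by move=> c _; rewrite col_word_lo col_word_hi; case: ifP.
rewrite sum1_card card_ord big_nat big1 ?addn0 // => j /andP[bj ja].
have jd : (j < d)%N by rewrite (leq_trans ja) //= leq_addr.
by rewrite -[j]/(val (Ordinal jd)) place_extE col_word_mid //= bj.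
Qed.

(** In weight [b] an antisymmetric tensor lives on the words [col_word S], where its coordinates
    agree up to sign with the one at [top_word]: this weight space has dimension at most 1. *)
Lemma antisym_wt_eq z z' : antisym z -> antisym z' -> z' top_word = 1 ->
  (forall x, wt x != b -> z' x = 0) ->
  [ffun x => if wt x == b then z x else 0] = z top_word *: z'.
Proof.
move=> az az' z'1 z'0; apply/ffunP => x; rewrite !ffunE /GRing.scale /=.
case: eqP => [wx|/eqP wx]; last by rewrite z'0 ?mulr0.
have [/forallP dx|/forallPn[c /negPn/eqP ex]] := boolP [forall c, x (lo c) != x (hi c)].
  by have [S ->] := wt_eq dx wx; rewrite !antisym_col_word // z'1 mulr1 mulrC.
by rewrite !(antisym_eq _ ex) ?mulr0.
Qed.

Lemma antisym_wt_lt z x : antisym z -> (wt x < b)%N -> z x = 0.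
Proof.
move=> az wx; have [/forallP dx|/forallPn[c /negPn/eqP ex]] := boolP [forall c, x (lo c) != x (hi c)].
  by have := wt_ge dx; rewrite leqNgt wx.
exact: antisym_eq az ex.
Qed.

Lemma schur_antisym z : schur_module z -> antisym z.
Proof. by case=> u ->; rewrite young_symmetrizerE; apply: col_antisym_anti. Qed.

Lemma hwv_anti : antisym hwv. Proof. exact: col_antisym_anti. Qed.

Lemma hwv_wt x : wt x != b -> hwv x = 0.
Proof.
move=> wx; rewrite sum_ffunE big1 // => s _; rewrite !ffunE.
case: eqP => [E|]; last by rewrite /GRing.scale /= mulr0.
case/eqP: wx; rewrite -(wt_col_word set0) col_word0 -E /wt (reindex_perm s) /=.
by apply: eq_bigr => k _; rewrite ffunE.
Qed.

(** A column permutation that fixes [top_word] preserves rows as well as columns, hence is the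
    identity. *)
Lemma hwv_top : hwv top_word = 1.
Proof.
rewrite sum_ffunE (bigD1 1%g) /=; last by rewrite inE; apply/forallP => k; rewrite perm1.
rewrite big1 ?addr0; last first.
  move=> s /andP[]; rewrite inE => /forallP cs s1; rewrite !ffunE.
  case: eqP => [/ffunP E|]; last by rewrite /GRing.scale /= mulr0.
  case/eqP: s1; apply/permP => k; rewrite perm1; apply: ord_inj.
  rewrite -(reshape_indexK lam (s k)) -[RHS](reshape_indexK lam k).
  rewrite (eqP (cs k)); congr (flatten_index _ _ _); apply/eqP.
  by have := E k; rewrite ffunE => /eqP; rewrite top_word_eq.
rewrite !ffunE odd_perm1 expr0 scale1r; case: eqP => // -[].
by apply/ffunP => k; rewrite ffunE perm1.
Qed.

(** Reduces the image of [hwv] under any map given on words to a signed sum over the sets of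
    exchanged columns; the relations are computed from it. *)
Lemma hwv_sum (W : lmodType K) (psi : word -> W) :
  \sum_x hwv x *: psi x = \sum_(S : {set 'I_b}) (-1) ^+ #|S| *: psi (col_word S).
Proof.
rewrite (bigID (mem [set col_word S | S : {set 'I_b}])) /=.
rewrite [X in _ + X]big1 ?addr0; last first.
  move=> x; have [wx|wx nx] := eqVneq (wt x) b; last by rewrite hwv_wt ?scale0r.
  have [/forallP dx|/forallPn[c /negPn/eqP ex]] := boolP [forall c, x (lo c) != x (hi c)].
    by have [S ->] := wt_eq dx wx; rewrite imset_f.
  by rewrite (antisym_eq hwv_anti ex) scale0r.
rewrite big_imset /=; last by move=> S S' _ _; apply: col_word_inj.
apply: eq_big => [S|S _]; first by rewrite inE.
by rewrite (antisym_col_word _ hwv_anti) hwv_top mulr1.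
Qed.

End Columns.

Lemma tensor_act_diag (K : fieldType) (m : nat) (lam : seq nat) (D : 'rV[K]_m)
    (t : tensor K m lam) x :
  tensor_act (diag_mx D) t x = (\prod_k D 0 (x k)) * t x.
Proof.
rewrite tensor_actE (bigD1 x) //= [X in _ + X]big1 ?addr0 => [|j jx].
  by congr (_ * _); apply: eq_bigr => k _; rewrite mxE eqxx mulr1n.
have [k jk] : exists k, j k != x k.
  by apply/existsP; apply: contraR jx; rewrite negb_exists => /forallP e;
    apply/eqP/ffunP => k; apply/eqP; rewrite -[_ == _]negbK e.
by rewrite (bigD1 k) //= mxE eq_sym (negPf jk) mulr0n !mul0r.
Qed.

(** * Irreducibility of Schur modules and of their equivariant images *)

Section Irreducibility.
Variables (K : numClosedFieldType) (m a b : nat).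
Hypothesis leba : (b <= a)%N.
Local Notation lam := [:: a; b].
Local Notation d := (sumn lam).
Local Notation word := {ffun 'I_d -> 'I_m.+2}.
Local Notation tens := (tensor K m.+2 lam).
Local Notation hwv := (hwv K m a b).
Local Notation tact := (@tensor_act K m.+2 lam).
Local Notation schur := (@schur_module K m.+2 lam).

Lemma weight_component (U : tens -> Prop) (u : tens) w :
  GL_submodule tact U -> U u -> U [ffun x => if wt x == w then u x else 0].
Proof.
move=> [subU GLU] Uu; pose P (x : word) : {poly K} := u x *: 'X^(wt x).
have -> : [ffun x => if wt x == w then u x else 0] = [ffun x => (P x)`_w].
  apply/ffunP => x; rewrite !ffunE coefZ coefXn eq_sym.
  by case: eqP; rewrite ?mulr1 ?mulr0.
apply: (@tensor_poly_coef K m.+2 lam U P 'X subU); first by rewrite polyX_eq0.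
move=> t; rewrite rootX => t0; pose g : 'M[K]_m.+2 := diag_mx (\row_i t ^+ i).
have gu : g \in unitmx.
  rewrite unitmxE det_diag unitfE; apply/prodf_neq0 => i _.
  by rewrite mxE expf_neq0.
have := GLU g u gu Uu; congr U; apply/ffunP => x; rewrite tensor_act_diag ffunE.
rewrite hornerZ hornerXn mulrC; congr (_ * _); rewrite /wt -prodrXr.
by apply: eq_bigr => k _; rewrite mxE.
Qed.

(* Weight components of U are multiples of [hwv] in the weight of [hwv]; were
   they all zero, [hwv], hence the whole module, would be orthogonal to U for
   the standard Hermitian form. *)
Lemma schur_irreducible (U : tens -> Prop) (u : tens) :
  GL_submodule tact U -> incl U schur -> U u -> u != 0 -> U hwv.
Proof.
move=> GLU Us Uu u0; apply: boolp.contrapT => nU; case/eqP: (u0).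
have subU := proj1 GLU.
pose Z (w : tens) := forall t, U t -> \sum_x t x * (w x)^* = 0.
have GLZ : GL_submodule tact Z.
  split; first split.
  - by move=> t _; apply: big1 => x _; rewrite ffunE rmorph0 mulr0.
  - move=> c v w Zv Zw t Ut; under eq_bigr => x _ do
      rewrite !ffunE /GRing.scale /= rmorphD rmorphM mulrDr mulrCA.
    by rewrite big_split /= -mulr_sumr Zv // Zw // mulr0 addr0.
  move=> g w gu Zw t Ut.
  (* The adjoint of [g] for the Hermitian form is its conjugate transpose, again an invertible
     matrix, so it preserves [U]. *)
  have Uht : U (tensor_act (map_mx Num.conj g)^T t).
    by apply: (proj2 GLU) => //; rewrite unitmx_tr map_unitmx.
  rewrite -[RHS](Zw _ Uht) /=.
  have E (x : word) : (tensor_act g w x)^* = \sum_(j : word) (\prod_k g (x k) (j k) * w j)^*.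
    by rewrite tensor_actE rmorph_sum.
  under eq_bigr => x _ do rewrite E mulr_sumr.
  rewrite exchange_big /=; apply: eq_bigr => j _.
  rewrite (tensor_actE _ t j : tensor_act _ t j = _) mulr_suml.
  apply: eq_bigr => x _.
  rewrite rmorphM rmorph_prod mulrCA -mulrA; congr (_ * _).
  by apply: eq_bigr => k _; rewrite !mxE.
have Zv : Z hwv.
  move=> t Ut; have st := Us t Ut.
  have := weight_component b GLU Ut.
  rewrite (antisym_wt_eq leba (schur_antisym leba st) (hwv_anti K leba)
             (hwv_top K m a b) (hwv_wt K leba)) => Uw.
  have [t0|tn0] := eqVneq (t (top_word m a b)) 0; last first.
    by case: nU; apply: subspaceZ_inv Uw.
  have := antisym_wt_eq leba (schur_antisym leba st) (hwv_anti K leba)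
             (hwv_top K m a b) (hwv_wt K leba).
  rewrite t0 scale0r => /ffunP wt0; apply: big1 => x _.
  have [wx|wx] := eqVneq (wt x) b; last by rewrite hwv_wt // rmorph0 mulr0.
  by have := wt0 x; rewrite !ffunE wx eqxx => ->; rewrite mul0r.
have Zu := schur_sub_hwv GLZ Zv (Us u Uu) u Uu.
apply/ffunP => x; rewrite ffunE; apply/eqP; rewrite -mul_conjC_eq0; apply/eqP.
by apply: (psumr_eq0P _ Zu) => // y _; apply: mul_conjC_ge0.
Qed.

Section Model.
Variables (W : lmodType K) (act : 'M[K]_m.+2 -> W -> W) (Psi : tens -> W).
Hypothesis PsiZD : forall c t u, Psi (c *: t + u) = c *: Psi t + Psi u.
Hypothesis PsiG : forall g t, g \in unitmx -> act g (Psi t) = Psi (tensor_act g t).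
Hypothesis Psi_hwv : Psi hwv != 0.
Local Notation M := (GL_generated act (Psi hwv)).

Lemma Psi_preim (U : W -> Prop) :
  GL_submodule act U -> GL_submodule tact (fun z => U (Psi z)).
Proof.
move=> [subU GLU]; split; first split.
- by rewrite (lin0 PsiZD); apply: subspace0.
- by move=> c t u Ut Uu; rewrite PsiZD; apply: subspaceZD.
by move=> g u gu Uu; rewrite -PsiG //; apply: GLU.
Qed.

Lemma GL_generated_submod (r : W) : GL_submodule act (GL_generated act r).
Proof.
split; first split.
- by move=> U GLU _; apply: subspace0; case: GLU.
- move=> c u v Mu Mv U GLU Ur; apply: subspaceZD; first by case: GLU.
    exact: Mu.
  exact: Mv.
by move=> g u gu Mu U GLU Ur; apply: (proj2 GLU) => //; apply: Mu.
Qed.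

Lemma GL_generated_mem (r : W) : GL_generated act r r.
Proof. by move=> U _. Qed.

(** The image of the Schur module is a submodule containing the generator; conversely the preimage
    of a submodule that contains [Psi hwv] contains [hwv], hence the whole Schur module. *)
Lemma modelP w : M w <-> exists2 z, schur z & Psi z = w.
Proof.
split=> [Mw|[z sz <-] U GLU Ur].
  apply: (Mw (fun w => exists2 z, schur z & Psi z = w)); last by exists hwv => //; apply: hwv_schur.
  have [[s0 sZD] sG] := schur_module_submod K m.+2 lam.
  split; first split.
  - by exists 0 => //; apply: (lin0 PsiZD).
  - move=> c _ _ [u su <-] [v sv <-]; exists (c *: u + v); last by rewrite PsiZD.
    exact: sZD.
  by move=> g _ gu [u su <-]; exists (tensor_act g u); [apply: sG|rewrite PsiG].
by apply: (schur_sub_hwv (Psi_preim GLU)).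
Qed.

(** The kernel within the Schur module is a submodule; were it nonzero, it would contain [hwv],
    against [Psi_hwv]. *)
Lemma Psi_inj z : schur z -> Psi z = 0 -> z = 0.
Proof.
move=> sz Pz; apply/eqP; apply: contraNT Psi_hwv => z0.
pose N (t : tens) := schur t /\ Psi t = 0.
suff [_ ->] : N hwv by [].
have [[s0 sZD] sG] := schur_module_submod K m.+2 lam.
apply: (@schur_irreducible N z) => //; last by move=> t [].
split; first split.
- by split=> //; apply: (lin0 PsiZD).
- move=> c u v [su Pu] [sv Pv]; split; first exact: sZD.
  by rewrite PsiZD Pu Pv scaler0 addr0.
move=> g u gu [su Pu]; split; first exact: sG.
(* Linearity of [act] is not among the assumptions; [act g 0 = 0] follows by writing 0 as
   [Psi 0]. *)
by rewrite -PsiG // Pu -(lin0 PsiZD) PsiG // (lin0 (@tensor_actZD _ _ _ g)).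
Qed.

Lemma model_irreducible : GL_irreducible act M.
Proof.
split; first exact: GL_generated_submod.
  by exists (Psi hwv); [apply: GL_generated_mem|apply/eqP].
move=> U GLU UM.
case: (boolp.pselect (exists2 u, U u & u <> 0)) => [[u Uu un0]|nU]; last first.
  by left=> u Uu; apply: boolp.contrapT => un0; apply: nU; exists u.
right=> w Mw; apply: Mw => //.
have [[s0 sZD] sG] := schur_module_submod K m.+2 lam.
have [[subU UZD] UG] := GLU; have [[_ U'ZD] U'G] := Psi_preim GLU.
pose N (t : tens) := schur t /\ U (Psi t).
suff [] : N hwv by [].
have /modelP[z sz zu] := UM u Uu.
apply: (@schur_irreducible N z) => [|t []//||].
- split; first split.
  + by split=> //; rewrite (lin0 PsiZD).
  + by move=> c t t' [? ?] [? ?]; split; [apply: sZD|apply: U'ZD].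
  by move=> g t gu [? ?]; split; [apply: sG|apply: U'G].
- by split; rewrite ?zu.
by apply/eqP => z0; apply: un0; rewrite -zu z0 (lin0 PsiZD).
Qed.

(** [GL_isomorphic] asks for a map defined on all of [W], going from the generated module to the
    Schur module: the inverse of [Psi], obtained by choice and extended by 0. *)
Definition model_inv (w : W) : tens :=
  match boolp.pselect (exists2 z, schur z & Psi z = w) with
  | left h => s2val (boolp.cid2 h)
  | right _ => 0
  end.

Lemma model_invK z : schur z -> model_inv (Psi z) = z.
Proof.
move=> sz; rewrite /model_inv; case: boolp.pselect => [h|]; last by case; exists z.
case: (boolp.cid2 h) => z' sz' /= E; apply/eqP; rewrite -subr_eq0; apply/eqP.
apply: Psi_inj; first by apply: subspaceB => //; case: (schur_module_submod K m.+2 lam).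
by rewrite addrC -scaleN1r PsiZD E scaleN1r addNr.
Qed.

Lemma model_iso : GL_isomorphic act M tact schur.
Proof.
have [[s0 sZD] sG] := schur_module_submod K m.+2 lam.
exists model_inv; split.
- move=> c _ _ /modelP[u su <-] /modelP[v sv <-].
  by rewrite -PsiZD !model_invK //; apply: sZD.
- by move=> _ /modelP[u su <-]; rewrite model_invK // => ->; apply: (lin0 PsiZD).
- move=> z; split=> [sz|[_ /modelP[u su <-] <-]]; last by rewrite model_invK.
  by exists (Psi z); rewrite ?model_invK //; apply/modelP; exists z.
by move=> g _ gu /modelP[u su <-]; rewrite PsiG // !model_invK //; apply: sG.
Qed.

End Model.
End Irreducibility.

(** * The algebra F(n,m) *)

Section Generators.
Variables (K : numClosedFieldType) (n m : nat).
Local Notation F := (F K n m).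
Local Notation rho := (@rho K n m).
Local Notation pi_ := (@pi_ K n m).

Lemma rhoE (a : mindex m 2) : rho a = 'X_(enum_rank (inl a : Fvar n m)).
Proof. by rewrite /rho valK. Qed.

Lemma piE (b : mindex m n) : pi_ b = 'X_(enum_rank (inr b : Fvar n m)).
Proof. by rewrite /pi_ valK. Qed.

Lemma mindexP d (P : 'X_{1..m} -> Prop) :
  (forall a : mindex m d, P a) -> forall a, mdeg a = d -> P a.
Proof. by move=> Pa a ad; apply: (Pa (MIndex (introT eqP ad))). Qed.

Section Homs.
Variables (A : comNzRingType) (f : {rmorphism K -> A}) (h : Fvar n m -> A).

Definition Fhom (x : F) : A := mmap f (fun k => h (enum_val k)) x.

HB.instance Definition _ := GRing.RMorphism.copy Fhom
  (mmap f (fun k => h (enum_val k))).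

Lemma FhomX v : Fhom 'X_(enum_rank v) = h v.
Proof. by rewrite /Fhom mmapX mmap1U enum_rankK. Qed.

Lemma FhomZ c x : Fhom (c *: x) = f c * Fhom x.
Proof. exact: mmapZ. Qed.

End Homs.

Lemma F_ind (P : F -> Prop) :
  (forall c, P c%:MP) -> (forall x y, P x -> P y -> P (x + y)) ->
  (forall v x, P x -> P ('X_(enum_rank v) * x)) -> forall x, P x.
Proof.
move=> PC PD PX; have PM (mm : 'X_{1..#|{: Fvar n m}|}) x : P x -> P ('X_[mm] * x).
  move=> Px; rewrite mpolyXE_id.
  elim/big_rec: _ => [|k y _ Py]; first by rewrite mul1r.
  elim: (mm k) => [|e IH]; first by rewrite expr0 mul1r.
  by rewrite exprS -!mulrA -{1}[k]enum_valK; apply: PX; rewrite mulrA.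
elim/mpolyind => [|c mm x _ _ Px]; first by rewrite -mpolyC0; apply: PC.
by apply: PD => //; rewrite -mul_mpolyC mulrC; apply: PM; apply: PC.
Qed.

Lemma phiX v : phi ('X_(enum_rank v) : F) = Fgen K v.
Proof.
by rewrite /phi comp_mpolyXU -tnth_nth tnth_mktuple enum_rankK.
Qed.

Lemma phi_rho a : mdeg a = 2 -> phi (rho a) = q_ K a.
Proof. by move: a; apply: mindexP => a; rewrite rhoE phiX. Qed.

Lemma phi_pi b : mdeg b = n -> phi (pi_ b) = p_ K b.
Proof. by move: b; apply: mindexP => b; rewrite piE phiX. Qed.

Lemma phiM x y : phi (x * y : F) = phi x * phi y. Proof. exact: rmorphM. Qed.
Lemma phiD x y : phi (x + y : F) = phi x + phi y. Proof. exact: rmorphD. Qed.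
Lemma phiZ c x : phi (c *: x : F) = c *: phi x. Proof. exact: linearZ. Qed.
Lemma phiC c : phi (c%:MP : F) = c%:MP. Proof. exact: comp_mpolyC. Qed.

Section Action.
Variable g : 'M[K]_m.
Local Notation actF := (@GL_act_F K n m g).
Local Notation actV := (@GL_act_KV K m g).

Lemma GL_act_FM x y : actF (x * y) = actF x * actF y.
Proof. exact: rmorphM. Qed.
Lemma GL_act_FD x y : actF (x + y) = actF x + actF y.
Proof. exact: rmorphD. Qed.
Lemma GL_act_FZ c x : actF (c *: x) = c *: actF x.
Proof. exact: linearZ. Qed.
Lemma GL_act_FC c : actF c%:MP = c%:MP. Proof. exact: comp_mpolyC. Qed.
Lemma GL_act_F_prod (I : Type) (r : seq I) (P : pred I) f :
  actF (\prod_(i <- r | P i) f i) = \prod_(i <- r | P i) actF (f i).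
Proof. exact: rmorph_prod. Qed.

Lemma GL_act_F_rho a : mdeg a = 2 -> actF (rho a) = lift_q n (actV (q_ K a)).
Proof.
move: a; apply: mindexP => a.
by rewrite rhoE /GL_act_F comp_mpolyXU -tnth_nth tnth_mktuple enum_rankK.
Qed.

Lemma GL_act_F_pi b : mdeg b = n -> actF (pi_ b) = lift_p n (actV (p_ K b)).
Proof.
move: b; apply: mindexP => b.
by rewrite piE /GL_act_F comp_mpolyXU -tnth_nth tnth_mktuple enum_rankK.
Qed.

Lemma GL_act_x i : actV (x_ K i) = \sum_j g j i *: x_ K j.
Proof.
by rewrite /GL_act_KV /x_ comp_mpolyXU -tnth_nth tnth_mktuple
   (unsplitK (inl _ i : 'I_m + 'I_m)).
Qed.

Lemma GL_act_y i : actV (y_ K i) = \sum_j g j i *: y_ K j.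
Proof.
by rewrite /GL_act_KV /y_ comp_mpolyXU -tnth_nth tnth_mktuple
   (unsplitK (inr _ i : 'I_m + 'I_m)).
Qed.

Lemma GL_act_KVM x y : actV (x * y) = actV x * actV y.
Proof. exact: rmorphM. Qed.
Lemma GL_act_KVD x y : actV (x + y) = actV x + actV y.
Proof. exact: rmorphD. Qed.
Lemma GL_act_KVZ c x : actV (c *: x) = c *: actV x.
Proof. exact: linearZ. Qed.
Lemma GL_act_KV_prod (I : Type) (r : seq I) (P : pred I) f :
  actV (\prod_(i <- r | P i) f i) = \prod_(i <- r | P i) actV (f i).
Proof. exact: rmorph_prod. Qed.

End Action.

(** One formula for both cases of [q_]: for [i = j] the factor 1/2 absorbs the doubled term. In this
    form q is bilinear in its two letters, like a tensor. *)
Lemma q_UU (i j : 'I_m) : q_ K (U_(i) + U_(j))%MM =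
  2%:R^-1 *: (x_ K i * y_ K j + y_ K i * x_ K j).
Proof.
wlog leij : i j / (i <= j)%N.
  move=> W; case: (leqP i j) => [/W //|/ltnW/W E].
  by rewrite addmC E; congr (_ *: _); rewrite addrC mulrC [X in _ + X]mulrC.
rewrite /q_; have [<-|nij] := eqVneq i j.
  rewrite (big_pred1 i) => [|k]; last first.
    by rewrite mnmDE !mnm1E [i == k]eq_sym /=; case: (k == i).
  rewrite big1 => [|k _]; last first.
    by rewrite big1 // => l /and3P[_]; rewrite mnmDE mnm1E; case: (i == k).
  rewrite addr0 [y_ K i * _]mulrC -mulr2n -scaler_nat scalerA mulVf ?scale1r //.
  by rewrite pnatr_eq0.
have {leij} ltij : (i < j)%N by rewrite ltn_neqAle leij andbT; move: nij; rewrite -val_eqE.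
rewrite big1 ?add0r => [|k]; last first.
  rewrite mnmDE !mnm1E; case: (eqVneq i k) => [<-|_]; last by case: (j == k).
  by rewrite [j == i]eq_sym (negPf nij).
rewrite (bigD1 i) //= [X in _ + X]big1 ?addr0 => [|k ki].
  rewrite (big_pred1 j) // => l /=.
  rewrite !mnmDE !mnm1E eqxx [j == i]eq_sym (negPf nij) /=.
  case: (eqVneq l j) => [->|lj]; first by rewrite ltij (negPf nij) eqxx.
  by case: (eqVneq i l) => [->|]; rewrite ?ltnn ?andbF.
rewrite big1 // => l /and3P[ltkl]; rewrite !mnmDE !mnm1E [i == k]eq_sym (negPf ki).
case: (eqVneq j k) => // jk; case: (eqVneq i l) => [il|_].
  by move: ltkl; rewrite -jk -il => /(ltn_trans ltij); rewrite ltnn.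
by case: (eqVneq j l) => // jl; move: ltkl; rewrite -jk jl ltnn.
Qed.

(** The content of a word. Indexing [p_] and [q_] by words instead of multi-indices makes the
    formula for the action the same as for basis tensors, without multinomial coefficients. *)
Definition cont (I : finType) (w : {ffun I -> 'I_m}) : 'X_{1..m} :=
  (\sum_(k : I) U_(w k))%MM.

Lemma contE (I : finType) (w : {ffun I -> 'I_m}) i :
  cont w i = (\sum_k (w k == i))%N.
Proof.
by rewrite /cont mnm_sumE; apply: eq_bigr => k _; rewrite mnm1E.
Qed.

Lemma mdeg_cont (I : finType) (w : {ffun I -> 'I_m}) : mdeg (cont w) = #|I|.
Proof.
by rewrite mdeg_sum -sum1_card; apply: eq_bigr => k _; rewrite mdeg1.
Qed.

Lemma prod_cont (R : comNzRingType) (I : finType) (w : {ffun I -> 'I_m}) (f : 'I_m -> R) :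
  \prod_(i < m) f i ^+ cont w i = \prod_k f (w k).
Proof.
rewrite (eq_bigr (fun i => \prod_k f i ^+ (w k == i))) => [|i _]; last first.
  by rewrite contE prodrXr.
rewrite exchange_big /=; apply: eq_bigr => k _.
rewrite (bigD1 (w k)) //= big1 ?mulr1 => [|i ik]; first by rewrite eqxx.
by rewrite eq_sym (negPf ik).
Qed.

Lemma p_cont (I : finType) (w : {ffun I -> 'I_m}) :
  p_ K (cont w) = \prod_k x_ K (w k) + \prod_k y_ K (w k).
Proof. by rewrite /p_ !prod_cont. Qed.

(** The places form the disjoint union of [b i] copies of each letter [i]; words over arbitrary
    finite types of places allow for this. *)
Lemma cont_surj (b : 'X_{1..m}) : exists w : {ffun {i : 'I_m & 'I_(b i)} -> 'I_m}, cont w = b.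
Proof.
exists [ffun s => tag s]; apply/mnmP => i; rewrite contE.
rewrite (eq_bigr (fun s : {i : 'I_m & 'I_(b i)} => (tag s == i)%N : nat)); last first.
  by move=> s _; rewrite ffunE.
transitivity (\sum_(j < m) \sum_(k < b j) (j == i))%N.
  by rewrite sig_big_dep.
rewrite (bigD1 i) //= [X in (_ + X)%N]big1 ?addn0 => [|j /negPf ->]; last by rewrite big1.
by rewrite eqxx sum1_card card_ord.
Qed.

End Generators.

(** * Equivariance of [phi], and words that transform like basis tensors *)

Section Equivariance.
Variables (K : numClosedFieldType) (n m : nat).
Hypothesis n_gt0 : (0 < n)%N.
Local Notation F := (F K n m).
Local Notation KV := (KV K m).
Local Notation rho := (@rho K n m).
Local Notation pi_ := (@pi_ K n m).
Local Notation actF := (@GL_act_F K n m).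
Local Notation actV := (@GL_act_KV K m).

Lemma lift_qZD c (P Q : KV) :
  lift_q n (c *: P + Q) = c *: lift_q n P + lift_q n Q.
Proof.
rewrite /lift_q scaler_sumr -big_split /=; apply: eq_bigr => a _.
rewrite scalerA -scalerDl; congr (_ *: _).
rewrite mulr_sumr -big_split /=; apply: eq_bigr => i _.
rewrite mulr_sumr -big_split /=; apply: eq_bigr => j _.
by rewrite mcoeffD mcoeffZ.
Qed.

Lemma lift_pZD c (P Q : KV) :
  lift_p n (c *: P + Q) = c *: lift_p n P + lift_p n Q.
Proof.
rewrite /lift_p scaler_sumr -big_split /=; apply: eq_bigr => a _.
by rewrite scalerA -scalerDl mcoeffD mcoeffZ.
Qed.

Lemma sum_delta_mindex d (W : lmodType K) (f : 'X_{1..m} -> W) a : mdeg a = d ->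
  \sum_(c : mindex m d) (a == c)%:R *: f c = f a.
Proof.
move: a; apply: mindexP => a; rewrite (bigD1 a) //= big1 ?addr0 => [|c ca].
  by rewrite eqxx scale1r.
by rewrite -val_eqE eq_sym in ca; rewrite (negPf ca) scale0r.
Qed.

Lemma lift_q_xy i j : lift_q n (x_ K i * y_ K j) = rho (U_(i) + U_(j))%MM.
Proof.
rewrite -(@sum_delta_mindex 2 _ rho) ?mdegD ?mdeg1 //.
apply: eq_bigr => c _; congr (_ *: _); rewrite /x_ /y_ -mpolyXD.
have co i' j' : ('X_[U_(lshift m i) + U_(rshift m j)] : KV)@_(U_(lshift m i') + U_(rshift m j'))%MM
    = ((i' == i) && (j' == j))%:R.
  rewrite mcoeffX; congr (nat_of_bool _)%:R; apply/eqP/andP => [/mnmP E|[/eqP-> /eqP->] //].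
  have := E (lshift m i); have := E (rshift m j).
  rewrite !mnmDE !mnm1E !eq_lrshift !eq_rlshift !eq_lshift !eq_rshift !eqxx /=.
  by case: (i' == i); case: (j' == j).
rewrite big_mkcond; under eq_bigr => i' _ do rewrite big_mkcond.
have [ec|nc] := eqVneq (U_(i) + U_(j))%MM (c : 'X_{1..m}).
  rewrite (bigD1 i) //= [X in _ + X]big1 ?addr0 => [|i' ii'].
    rewrite (bigD1 j) //= [X in _ + X]big1 ?addr0 => [|j' jj'].
      by rewrite ec eqxx co !eqxx.
    by case: ifP => // _; rewrite co (negPf jj') andbF.
  by apply: big1 => j' _; case: ifP => // _; rewrite co (negPf ii').
apply: big1 => i' _; apply: big1 => j' _; case: ifP => // ec.
rewrite co; case: eqP => //= ei; case: eqP => //= ej.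
by move: nc; rewrite -ei -ej ec.
Qed.

Lemma mdeg2P (a : 'X_{1..m}) : mdeg a = 2 ->
  exists i j, a = (U_(i) + U_(j))%MM.
Proof.
move=> a2; have : a != 0%MM by rewrite -mdeg_eq0 a2.
move=> a0; have [i ai] : exists i, (0 < a i)%N.
  apply/existsP; apply: contraR a0; rewrite negb_exists => /forallP e.
  by apply/eqP/mnmP => i; rewrite mnm0E; have := e i; rewrite -leqNgt leqn0 => /eqP.
have le : (U_(i) <= a)%MM by apply/mnm_lepP => j; rewrite mnm1E; case: eqP => // <-.
have E := submK le.
have : mdeg (a - U_(i))%MM == 1%N.
  by rewrite -(eqn_add2r (mdeg U_(i)%MM)) -mdegD E mdeg1 a2.
by case/mdeg1P => j /eqP ej; exists i, j; rewrite -{1}E ej addmC.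
Qed.

Lemma lift_q_q a : mdeg a = 2 -> lift_q n (q_ K a) = rho a.
Proof.
move=> /mdeg2P[i [j ->]].
rewrite q_UU (linZ lift_qZD) (linD lift_qZD) lift_q_xy mulrC lift_q_xy.
rewrite [(U_(j) + _)%MM]addmC -mulr2n -scaler_nat scalerA mulVf ?scale1r //.
by rewrite pnatr_eq0.
Qed.

Lemma lift_p_p b : mdeg b = n -> lift_p n (p_ K b) = pi_ b.
Proof.
move=> bn; rewrite -(@sum_delta_mindex n _ pi_) //.
apply: eq_bigr => c _; congr (_ *: _).
pose X (c : 'X_{1..m}) : 'X_{1..m + m} :=
  [multinom match split k with inl i => c i | inr _ => 0%N end | k < m + m].
pose Y (c : 'X_{1..m}) : 'X_{1..m + m} :=
  [multinom match split k with inl _ => 0%N | inr i => c i end | k < m + m].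
have Xl c' i : X c' (lshift m i) = c' i by rewrite mnmE (unsplitK (inl _ i)).
have Xr c' i : X c' (rshift m i) = 0%N by rewrite mnmE (unsplitK (inr _ i)).
have Yl c' i : Y c' (lshift m i) = 0%N by rewrite mnmE (unsplitK (inl _ i)).
have Yr c' i : Y c' (rshift m i) = c' i by rewrite mnmE (unsplitK (inr _ i)).
have -> : p_ K b = 'X_[X b] + 'X_[Y b].
  rewrite /p_ !mpolyXE_id !big_split_ord /=; congr (_ + _).
    rewrite [X in _ = _ * X]big1 ?mulr1 => [|i _]; last by rewrite Xr expr0.
    by apply: eq_bigr => i _; rewrite Xl.
  rewrite [X in _ = X * _]big1 ?mul1r => [|i _]; last by rewrite Yl expr0.
  by apply: eq_bigr => i _; rewrite Yr.
rewrite mcoeffD !mcoeffX -/(X c).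
(* The monomials in x and in y could only coincide for exponent 0; here [n_gt0] enters. *)
have -> : (Y b == X c) = false.
  apply/eqP => /mnmP E; have : b == 0%MM.
    by apply/eqP/mnmP => i; have := E (rshift m i); rewrite Yr Xr mnm0E.
  by rewrite -mdeg_eq0 bn; case: (n) n_gt0.
rewrite addr0; congr (nat_of_bool _)%:R; apply/eqP/eqP => [/mnmP E|-> //].
by apply/mnmP => i; have := E (lshift m i); rewrite !Xl.
Qed.

Lemma actV_mon (I : finType) (z : 'I_m -> KV) g (w : {ffun I -> 'I_m}) :
  (forall i, actV g (z i) = \sum_j g j i *: z j) ->
  actV g (\prod_k z (w k)) =
  \sum_(w' : {ffun I -> 'I_m}) (\prod_k g (w' k) (w k)) *: \prod_k z (w' k).
Proof.
move=> gz; rewrite GL_act_KV_prod.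
under eq_bigr do rewrite gz.
rewrite bigA_distr_bigA; apply: eq_bigr => w' _.
by rewrite scaler_prod.
Qed.

Lemma actV_p g (I : finType) (w : {ffun I -> 'I_m}) :
  actV g (p_ K (cont w)) =
  \sum_(w' : {ffun I -> 'I_m}) (\prod_k g (w' k) (w k)) *: p_ K (cont w').
Proof.
rewrite p_cont GL_act_KVD !actV_mon; [|exact: GL_act_y|exact: GL_act_x].
rewrite -big_split /=; apply: eq_bigr => w' _.
by rewrite p_cont scalerDr.
Qed.

Lemma actV_q g (w : {ffun bool -> 'I_m}) :
  actV g (q_ K (cont w)) =
  \sum_(w' : {ffun bool -> 'I_m}) (\prod_k g (w' k) (w k)) *: q_ K (cont w').
Proof.
have E (w' : {ffun bool -> 'I_m}) : q_ K (cont w') =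
    2%:R^-1 *: (x_ K (w' true) * y_ K (w' false) + y_ K (w' true) * x_ K (w' false)).
  by rewrite /cont big_bool q_UU.
have D (z t : 'I_m -> KV) :
    (forall i, actV g (z i) = \sum_j g j i *: z j) ->
    (forall i, actV g (t i) = \sum_j g j i *: t j) ->
    actV g (z (w true) * t (w false)) = \sum_(w' : {ffun bool -> 'I_m})
      (\prod_k g (w' k) (w k)) *: (z (w' true) * t (w' false)).
  move=> gz gt; rewrite GL_act_KVM gz gt.
  pose G (b : bool) j := g j (w b) *: (if b then z j else t j).
  transitivity (\prod_(b : bool) \sum_j G b j); first by rewrite big_bool.
  rewrite bigA_distr_bigA; apply: eq_bigr => w' _.
  by rewrite /G scaler_prod [in X in _ *: X]big_bool.
rewrite E GL_act_KVZ GL_act_KVD.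
rewrite (D (@x_ K m) (@y_ K m)); [|exact: GL_act_x|exact: GL_act_y].
rewrite (D (@y_ K m) (@x_ K m)); [|exact: GL_act_y|exact: GL_act_x].
rewrite -big_split scaler_sumr /=; apply: eq_bigr => w' _.
by rewrite E -scalerDr !scalerA mulrC.
Qed.

(* psi w transforms like the basis tensor e_w. *)
Definition equivariant_words (I : finType) (psi : {ffun I -> 'I_m} -> F) :=
  forall g w, actF g (psi w) =
    \sum_(w' : {ffun I -> 'I_m}) (\prod_k g (w' k) (w k)) *: psi w'.

Lemma equivariant_pi (I : finType) : #|I| = n ->
  equivariant_words (fun w : {ffun I -> 'I_m} => pi_ (cont w)).
Proof.
move=> cI g w; rewrite GL_act_F_pi ?mdeg_cont // actV_p (lin_sum lift_pZD).
by apply: eq_bigr => w' _; rewrite (linZ lift_pZD) lift_p_p ?mdeg_cont.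
Qed.

Lemma equivariant_rho :
  equivariant_words (fun w : {ffun bool -> 'I_m} => rho (cont w)).
Proof.
move=> g w; rewrite GL_act_F_rho ?mdeg_cont ?card_bool // actV_q (lin_sum lift_qZD).
by apply: eq_bigr => w' _; rewrite (linZ lift_qZD) lift_q_q ?mdeg_cont ?card_bool.
Qed.

Lemma phi_actF g x : phi (actF g x) = actV g (phi x).
Proof.
elim/F_ind: x => [c|x y IHx IHy|[a|b] x IHx].
- by rewrite GL_act_FC !phiC /GL_act_KV comp_mpolyC.
- by rewrite GL_act_FD !phiD IHx IHy GL_act_KVD.
- rewrite GL_act_FM !phiM IHx GL_act_KVM -rhoE; congr (_ * _).
  have a2 : mdeg a = 2 by apply/eqP; case: a.
  have [i [j aij]] := mdeg2P a2.
  pose w : {ffun bool -> 'I_m} := [ffun b => if b then i else j].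
  have -> : val a = cont w by rewrite /cont big_bool /w !ffunE.
  have cb := card_bool.
  rewrite equivariant_rho phi_rho ?mdeg_cont // actV_q.
  rewrite (big_morph (@phi K n m) (@phiD K n m) (raddf0 _)).
  by apply: eq_bigr => w' _; rewrite phiZ phi_rho ?mdeg_cont.
rewrite GL_act_FM !phiM IHx GL_act_KVM -piE; congr (_ * _).
have bn : mdeg b = n by apply/eqP; case: b.
have [w wb] := cont_surj b; have cI := mdeg_cont w.
rewrite -[X in pi_ X]wb equivariant_pi -?cI ?wb // phi_pi ?wb //.
rewrite -[in RHS]wb actV_p (big_morph (@phi K n m) (@phiD K n m) (raddf0 _)).
by apply: eq_bigr => w' _; rewrite phiZ phi_pi ?mdeg_cont // -cI wb.
Qed.

(** The bijection cuts the places into two groups, so a word is a pair of words, and the product of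
    matrix entries over its places is the product over the two groups. *)
Lemma equivariant_pair (I1 I2 I : finType) (h1 : I1 -> I) (h2 : I2 -> I) psi1 psi2 :
  bijective (fun s : I1 + I2 => match s with inl k => h1 k | inr k => h2 k end) ->
  equivariant_words psi1 -> equivariant_words psi2 ->
  equivariant_words (fun w : {ffun I -> 'I_m} =>
    psi1 [ffun k => w (h1 k)] * psi2 [ffun k => w (h2 k)]).
Proof.
set h := fun s : _ => _; move=> hb e1 e2 g w; have [h' hK h'K] := hb.
rewrite GL_act_FM e1 e2 big_distrlr pair_big /=.
pose r (w' : {ffun I -> 'I_m}) := ([ffun k => w' (h1 k)], [ffun k => w' (h2 k)]).
rewrite (reindex r); last first.
  exists (fun p : {ffun I1 -> 'I_m} * {ffun I2 -> 'I_m} => [ffun k =>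
    match h' k with inl k1 => p.1 k1 | inr k2 => p.2 k2 end]).
    move=> w' _; apply/ffunP => k; rewrite !ffunE -[in RHS](h'K k).
    by case: (h' k) => k'; rewrite ffunE.
  move=> [w1 w2] _; congr (_, _); apply/ffunP => k; rewrite !ffunE.
    by rewrite -[h1 k]/(h (inl k)) hK.
  by rewrite -[h2 k]/(h (inr k)) hK.
apply: eq_bigr => w' _; rewrite -scalerAl -scalerAr scalerA; congr (_ *: _).
rewrite (reindex h) /=; last exact: onW_bij.
rewrite big_sumType /=; congr (_ * _).
  by apply: eq_bigr => k _; rewrite !ffunE.
by apply: eq_bigr => k _; rewrite !ffunE.
Qed.

Lemma equivariant_prod (J I0 I : finType) (h : J * I0 -> I) psi :
  bijective h -> equivariant_words psi ->
  equivariant_words (fun w : {ffun I -> 'I_m} => \prod_j psi [ffun k => w (h (j, k))]).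
Proof.
move=> hb e g w; have [h' hK h'K] := hb.
rewrite GL_act_F_prod; under eq_bigr do rewrite e.
rewrite bigA_distr_bigA /=.
pose r (w' : {ffun I -> 'I_m}) : {ffun J -> {ffun I0 -> 'I_m}} :=
  [ffun j => [ffun k => w' (h (j, k))]].
rewrite (reindex r); last first.
  exists (fun p : {ffun J -> {ffun I0 -> 'I_m}} => [ffun k => p (h' k).1 (h' k).2]).
    by move=> w' _; apply/ffunP => k; rewrite !ffunE -surjective_pairing h'K.
  move=> p _; apply/ffunP => j; apply/ffunP => k; rewrite !ffunE.
  by rewrite hK.
apply: eq_bigr => w' _; rewrite scaler_prod; congr (_ *: _); last first.
  by apply: eq_bigr => j _; rewrite ffunE.
rewrite (reindex h) /=; last exact: onW_bij.
rewrite pair_big /=; apply: eq_bigr => -[j k] _.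
by rewrite !ffunE.
Qed.

End Equivariance.

(** * The relations as images of highest weight vectors *)

Section Realization.
Variables (K : numClosedFieldType) (n m : nat).
Hypothesis n_gt0 : (0 < n)%N.
Local Notation F := (F K n m.+2).
Local Notation rho := (@rho K n m.+2).
Local Notation pi_ := (@pi_ K n m.+2).
Local Notation actF := (@GL_act_F K n m.+2).
Local Notation i0 := (i0 m).
Local Notation i1 := (i1 m).

Section Psi.
Variables (a b : nat).
Local Notation lam := [:: a; b].
Local Notation d := (sumn lam).
Local Notation word := {ffun 'I_d -> 'I_m.+2}.
Local Notation tens := (tensor K m.+2 lam).

Definition Psi (psi : word -> F) (t : tens) : F := \sum_(w : word) t w *: psi w.

Lemma PsiZD psi c t u : Psi psi (c *: t + u) = c *: Psi psi t + Psi psi u.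
Proof.
rewrite /Psi scaler_sumr -big_split /=; apply: eq_bigr => w _.
by rewrite !ffunE scalerDl scalerA.
Qed.

Lemma Psi_act psi g t : equivariant_words psi ->
  actF g (Psi psi t) = Psi psi (tensor_act g t).
Proof.
move=> epsi; rewrite /Psi.
rewrite (big_morph (@GL_act_F K n m.+2 g) (GL_act_FD g) (raddf0 _)).
rewrite (eq_bigr (fun w : word => \sum_(w' : word)
  (t w * \prod_k g (w' k) (w k)) *: psi w')) => [|w _]; last first.
  by rewrite GL_act_FZ epsi scaler_sumr; apply: eq_bigr => w' _; rewrite scalerA.
rewrite exchange_big /=; apply: eq_bigr => w' _.
rewrite -scaler_suml (tensor_actE g t w' : tensor_act g t w' = _); congr (_ *: _).
by apply: eq_bigr => w _; rewrite mulrC.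
Qed.

Lemma Psi_hwv psi : (b <= a)%N -> Psi psi (hwv K m a b) =
  \sum_(S : {set 'I_b}) (-1) ^+ #|S| *: psi (col_word m a S).
Proof. by move=> leba; rewrite /Psi hwv_sum. Qed.

Lemma equivariant_lin (psi psi' : word -> F) c c' : equivariant_words psi ->
  equivariant_words psi' ->
  equivariant_words (fun w : word => c *: psi w + c' *: psi' w).
Proof.
move=> e e' g w; rewrite GL_act_FD !GL_act_FZ e e' !scaler_sumr -big_split /=.
by apply: eq_bigr => w' _; rewrite scalerDr !scalerA ![_ * c]mulrC ![_ * c']mulrC.
Qed.

Lemma Psi_lin (psi psi' : word -> F) c c' t :
  Psi (fun w => c *: psi w + c' *: psi' w) t = c *: Psi psi t + c' *: Psi psi' t.
Proof.
rewrite /Psi !scaler_sumr -big_split; apply: eq_bigr => w _ /=.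
by rewrite scalerDr !scalerA ![_ * t w]mulrC.
Qed.

Lemma cont01 (I : finType) (w : {ffun I -> 'I_m.+2}) : (forall k, w k <= 1)%N ->
  cont w = (U_(i0) *+ (#|I| - \sum_k w k) + U_(i1) *+ (\sum_k w k))%MM.
Proof.
move=> w1; apply/mnmP => i; rewrite contE mnmDE !mulmnE !mnm1E.
have e0 : (\sum_k (w k == i0) = #|I| - \sum_k w k)%N.
  rewrite -sum1_card -sumnB //; apply: eq_bigr => k _.
  by rewrite -val_eqE /=; case: (nat_of_ord (w k)) (w1 k) => [|[|]].
have e1 : (\sum_k (w k == i1) = \sum_k w k)%N.
  apply: eq_bigr => k _.
  by rewrite -val_eqE /=; case: (nat_of_ord (w k)) (w1 k) => [|[|]].
have [<-|n0] := eqVneq i0 i; first by rewrite e0 mul1n (_ : (i1 == i0) = false) // mul0n addn0.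
have [<-|n1] := eqVneq i1 i; first by rewrite e1 mul0n mul1n add0n.
rewrite !mul0n big1 // => k _; case: eqP => // ek; have := w1 k; rewrite ek.
move: n0 n1; rewrite -!val_eqE /=.
by case: (nat_of_ord i) => [|[|]].
Qed.

Lemma col_word01 (S : {set 'I_b}) k : (col_word m a S k <= 1)%N.
Proof. by rewrite ffunE; case: ifP => _; case: ifP. Qed.

Lemma sum_in_set (S : {set 'I_b}) N : (b <= N)%N ->
  (\sum_(k < N) in_set_nat S k = #|S|)%N.
Proof.
move=> leN; rewrite -(big_mkord xpredT (fun k => in_set_nat S k : nat)).
rewrite (big_cat_nat (n := b)) //= [X in (_ + X)%N]big_nat [X in (_ + X)%N]big1.
  rewrite addn0 big_mkord -sum1_card [RHS]big_mkcond.
  by apply: eq_bigr => c _; rewrite in_set_natE; case: (c \in S).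
by move=> j /andP[bj _]; rewrite in_set_nat_ge.
Qed.

Lemma sum_set_card (W : lmodType K) (f : nat -> W) :
  \sum_(S : {set 'I_b}) f #|S| = \sum_(j < b.+1) 'C(b, j)%:R *: f j.
Proof.
have lec (S : {set 'I_b}) : (#|S| < b.+1)%N by rewrite ltnS -[X in (_ <= X)%N]card_ord max_card.
rewrite (partition_big (fun S => Ordinal (lec S)) xpredT) //=.
apply: eq_bigr => j _; rewrite (eq_bigr (fun=> f j)) => [|S /eqP <- //].
rewrite sumr_const scaler_nat; congr (_ *+ _).
rewrite -[X in 'C(X, _)]card_ord -card_draws; apply: eq_card => S.
by rewrite !inE.
Qed.

End Psi.

Definition Pm j := pi_ (U_(i0) *+ (n - j) + U_(i1) *+ j)%MM.
Definition Rm j := rho (U_(i0) *+ (2 - j) + U_(i1) *+ j)%MM.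

(** This and [rel_2k] are the relations written directly in F(n, m+2); they are identified with the
    images of [R_n2] and [R_2k] under [F_incl] further on. *)
Definition rel_n2 : F := Pm 0 * Rm 2 - 2%:R *: (Pm 1 * Rm 1) + Pm 2 * Rm 0.

Definition rel_2k (k : nat) : F :=
  ((-1) ^+ k * 2%:R^-1 * 'C(2 * k, k)%:R) *: Pm k ^+ 2
  + \sum_(0 <= j < k) ((-1) ^+ j * 'C(2 * k, j)%:R) *: (Pm j * Pm (2 * k - j))
  - 4%:R ^+ k *: (Rm 0 ^+ (n - 2 * k) * (Rm 1 ^+ 2 - Rm 0 * Rm 2) ^+ k).

Section RowN2.
Hypothesis n_ge2 : (2 <= n)%N.
Local Notation d := (sumn [:: n; 2]).

Lemma place_n2_pi (k : 'I_n) : (k < d)%N.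
Proof. exact: ltn_addr. Qed.
Lemma place_n2_rho (e : bool) : (n + ~~ e < d)%N.
Proof. by case: e; rewrite /= ltn_add2l. Qed.

(** The first row of the diagram feeds pi and the second row feeds rho, so that exchanging the
    letters of a column moves one letter [i1] from rho to pi. *)
Definition psi_n2 (w : {ffun 'I_d -> 'I_m.+2}) : F :=
  pi_ (cont [ffun k => w (Ordinal (place_n2_pi k))]) *
  rho (cont [ffun e => w (Ordinal (place_n2_rho e))]).

Lemma places_n2_bij : bijective (fun s : 'I_n + bool => match s with
  inl k => Ordinal (place_n2_pi k) | inr e => Ordinal (place_n2_rho e) end).
Proof.
apply: inj_card_bij; last by rewrite card_sum !card_ord card_bool.
move=> [k|e] [k'|e'] /(congr1 val) /=.
- by move/ord_inj => ->.
- by move=> E; have := ltn_ord k; rewrite E ltnNge leq_addr.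
- by move=> E; have := ltn_ord k'; rewrite -E ltnNge leq_addr.
by move/addnI; case: e; case: e'.
Qed.

Lemma psi_n2_equivariant : equivariant_words psi_n2.
Proof.
apply: (equivariant_pair places_n2_bij (psi1 := fun w => pi_ (cont w))
  (psi2 := fun w => rho (cont w))).
  by apply: equivariant_pi; rewrite ?card_ord.
exact: equivariant_rho.
Qed.

Lemma psi_n2_col (S : {set 'I_2}) :
  psi_n2 (col_word m n S) = Pm #|S| * Rm (2 - #|S|).
Proof.
have := wt_col_word m n_ge2 S.
rewrite /wt (reindex _ (onW_bij _ places_n2_bij)) big_sumType /=.
have e1 : (\sum_(k < n) col_word m n S (Ordinal (place_n2_pi k)) = #|S|)%N.
  rewrite -(sum_in_set S n_ge2); apply: eq_bigr => k _.
  by rewrite ffunE /= ltn_ord; case: ifP.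
rewrite e1 => E; rewrite /psi_n2 !cont01 => [|e|k]; try by rewrite ffunE col_word01.
rewrite (eq_bigr (fun k : 'I_n => col_word m n S (Ordinal (place_n2_pi k)) : nat));
  last by move=> k _; rewrite ffunE.
rewrite e1 card_ord card_bool.
rewrite (eq_bigr (fun e : bool => col_word m n S (Ordinal (place_n2_rho e)) : nat));
  last by move=> e _; rewrite ffunE.
by have -> : (\sum_(e : bool) col_word m n S (Ordinal (place_n2_rho e)) = 2 - #|S|)%N
  by rewrite -[X in (X - _)%N]E addKn.
Qed.

Lemma Psi_n2_hwv : Psi psi_n2 (hwv K m n 2) = rel_n2.
Proof.
rewrite Psi_hwv //; under eq_bigr => S _ do rewrite psi_n2_col.
rewrite (sum_set_card _ (fun j => (-1) ^+ j *: (Pm j * Rm (2 - j)))).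
rewrite !big_ord_recl big_ord0 /= addr0 /bump /= !add1n.
rewrite bin0 bin1 binn !expr0 !expr1 !scale1r /rel_n2 expr2 mulN1r opprK !scale1r.
by rewrite scaleN1r scalerN addrA.
Qed.

End RowN2.

Section Row2k.
Variable k : nat.
Hypotheses (k_gt0 : (0 < k)%N) (le2k : (2 * k <= n)%N).
Local Notation a := (2 * n - 2 * k)%N.
Local Notation b := (2 * k)%N.
Local Notation d := (sumn [:: a; b]).

Lemma dE : d = (2 * n)%N.
Proof. by rewrite /= addn0 subnK //; lia. Qed.

Lemma leba_2k : (b <= a)%N. Proof. by lia. Qed.

Lemma place_pi1 (l : 'I_n) : (l < d)%N.
Proof. by rewrite dE; have := ltn_ord l; lia. Qed.
Lemma place_pi2 (l : 'I_n) : (n + l < d)%N.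
Proof. by rewrite dE; have := ltn_ord l; lia. Qed.
Lemma place_rho (p : 'I_n * bool) : (2 * p.1 + ~~ p.2 < d)%N.
Proof. by rewrite dE; case: p => l [] /=; have := ltn_ord l; lia. Qed.

(** The first [n] places feed one pi and the last [n] the other. As [2 * k <= n], each column with
    two boxes has its upper box in the first half and its lower box in the second. *)
Definition psi_pipi (w : {ffun 'I_d -> 'I_m.+2}) : F :=
  pi_ (cont [ffun l => w (Ordinal (place_pi1 l))]) *
  pi_ (cont [ffun l => w (Ordinal (place_pi2 l))]).

(** Consecutive places [2 l] and [2 l + 1] feed one rho. The first row has even length, so no pair
    straddles the two rows, and columns are treated two at a time. *)
Definition psi_rhos (w : {ffun 'I_d -> 'I_m.+2}) : F :=
  \prod_(l < n) rho (cont [ffun e => w (Ordinal (place_rho (l, e)))]).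

Lemma places_pipi_bij : bijective (fun s : 'I_n + 'I_n => match s with
  inl l => Ordinal (place_pi1 l) | inr l => Ordinal (place_pi2 l) end).
Proof.
apply: inj_card_bij; last by rewrite card_sum !card_ord dE mul2n addnn.
move=> [l|l] [l'|l'] /(congr1 val) /=.
- by move/ord_inj => ->.
- by move=> E; have := ltn_ord l; rewrite E ltnNge leq_addr.
- by move=> E; have := ltn_ord l'; rewrite -E ltnNge leq_addr.
by move/addnI/ord_inj => ->.
Qed.

Lemma places_rho_bij : bijective (fun p : 'I_n * bool => Ordinal (place_rho p)).
Proof.
apply: inj_card_bij; last by rewrite card_prod !card_ord card_bool dE mulnC.
move=> [l e] [l' e'] /(congr1 val) /= E.
have [-> El] : e = e' /\ nat_of_ord l = l' by case: e e' E => [] [] /= ?; split=> //; lia.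
by rewrite (ord_inj El).
Qed.

Lemma psi_pipi_equivariant : equivariant_words psi_pipi.
Proof.
by apply: (equivariant_pair places_pipi_bij (psi1 := fun w => pi_ (cont w))
  (psi2 := fun w => pi_ (cont w))); apply: equivariant_pi; rewrite ?card_ord.
Qed.

Lemma psi_rhos_equivariant : equivariant_words psi_rhos.
Proof. exact: equivariant_prod places_rho_bij (@equivariant_rho _ _ _). Qed.

Lemma psi_pipi_col (S : {set 'I_b}) :
  psi_pipi (col_word m a S) = Pm #|S| * Pm (2 * k - #|S|).
Proof.
have := wt_col_word m leba_2k S.
rewrite /wt (reindex _ (onW_bij _ places_pipi_bij)) big_sumType /=.
have e1 : (\sum_(l < n) col_word m a S (Ordinal (place_pi1 l)) = #|S|)%N.
  rewrite -(sum_in_set S le2k); apply: eq_bigr => l _.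
  have la : (l < a)%N by have := ltn_ord l; lia.
  by rewrite ffunE /= la; case: ifP.
rewrite e1 => E; rewrite /psi_pipi !cont01 => [|e|l]; try by rewrite ffunE col_word01.
rewrite (eq_bigr (fun l : 'I_n => col_word m a S (Ordinal (place_pi1 l)) : nat));
  last by move=> l _; rewrite ffunE.
rewrite e1 !card_ord.
rewrite (eq_bigr (fun l : 'I_n => col_word m a S (Ordinal (place_pi2 l)) : nat));
  last by move=> l _; rewrite ffunE.
by have -> : (\sum_(l < n) col_word m a S (Ordinal (place_pi2 l)) = 2 * k - #|S|)%N
  by apply: (@addnI #|S|); rewrite E subnKC //; apply: leq_trans (eq_leq E); apply: leq_addr.
Qed.

Lemma sum_symmetric (W : lmodType K) (f : nat -> W) :
  (forall j, (j <= 2 * k)%N -> f (2 * k - j)%N = f j) ->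
  \sum_(j < (2 * k).+1) f j = f k + (\sum_(0 <= j < k) f j) *+ 2.
Proof.
move=> fs; rewrite -(big_mkord xpredT f) (big_cat_nat (n := k)) //=; last by lia.
rewrite [X in _ + X]big_ltn; last by lia.
rewrite mulr2n addrCA addrA -addrA; congr (_ + (_ + _)).
rewrite -{1}[k.+1]add0n big_addn big_nat_rev /= add0n.
have -> : ((2 * k).+1 - k.+1 = k)%N by lia.
rewrite big_nat [RHS]big_nat; apply: eq_bigr => j jk.
by rewrite -fs; [congr f; lia | lia].
Qed.

Lemma Psi_pipi_hwv : Psi psi_pipi (hwv K m a b) =
  \sum_(j < (2 * k).+1) ((-1) ^+ j * 'C(2 * k, j)%:R) *: (Pm j * Pm (2 * k - j)).
Proof.
rewrite Psi_hwv ?leba_2k //; under eq_bigr => S _ do rewrite psi_pipi_col.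
rewrite (sum_set_card _ (fun j => (-1) ^+ j *: (Pm j * Pm (2 * k - j)))).
by apply: eq_bigr => j _; rewrite scalerA mulrC.
Qed.

(** The terms [j] and [2 k - j] coincide, so half of the full alternating sum is the sum over
    [j < k] plus half of the middle term: the origin of the 1/2 in the relation. *)
Lemma Psi_pipi_hwv_half : 2%:R^-1 *: Psi psi_pipi (hwv K m a b) =
  ((-1) ^+ k * 2%:R^-1 * 'C(2 * k, k)%:R) *: Pm k ^+ 2
  + \sum_(0 <= j < k) ((-1) ^+ j * 'C(2 * k, j)%:R) *: (Pm j * Pm (2 * k - j)).
Proof.
rewrite Psi_pipi_hwv.
rewrite (sum_symmetric (f := fun j => ((-1) ^+ j * 'C(2 * k, j)%:R) *: (Pm j * Pm (2 * k - j)))).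
  rewrite scalerDr -[X in _ + _ *: X]scaler_nat scalerA scalerA mulVf ?pnatr_eq0 //.
  rewrite scale1r; congr (_ + _); congr (_ *: _); first by rewrite mulrCA mulrA.
  by rewrite expr2; congr (_ * Pm _); lia.
move=> j j2k; rewrite bin_sub // subKn // [Pm _ * _]mulrC.
by rewrite -[(-1) ^+ (_ - _)]signr_odd oddB // oddM /= signr_odd.
Qed.

End Row2k.

End Realization.

Section Rhos.
Variables (K : numClosedFieldType) (n m k : nat).
Hypotheses (n_gt0 : (0 < n)%N) (k_gt0 : (0 < k)%N) (le2k : (2 * k <= n)%N).
Local Notation F := (F K n m.+2).
Local Notation a := (2 * n - 2 * k)%N.
Local Notation b := (2 * k)%N.
Local Notation d := (sumn [:: a; b]).
Local Notation Rm := (Rm K n m).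

Definition letter (S : {set 'I_b}) (j : nat) : bool :=
  if (j < a)%N then in_set_nat S j else ~~ in_set_nat S (j - a).

Lemma psi_rhos_letter (S : {set 'I_b}) :
  psi_rhos K (m := m) n_gt0 k_gt0 le2k (col_word m a S) =
  \prod_(i < n) Rm (letter S (2 * i) + letter S (2 * i).+1).
Proof.
apply: eq_bigr => i _; rewrite cont01 => [|e]; last by rewrite ffunE col_word01.
have E j (jd : (j < d)%N) : nat_of_ord (col_word m a S (Ordinal jd)) = letter S j.
  by rewrite ffunE /letter /=; case: ifP; case: ifP.
rewrite card_bool (eq_bigr (fun e : bool => letter S (2 * i + ~~ e) : nat)).
  by rewrite big_bool /= addn0 addn1.
by move=> e _; rewrite ffunE E.
Qed.

(** The two factors that a pair of neighbouring columns contributes, one per row; [p] tells which of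
    the two columns are exchanged. *)
Definition pair_rho (p : bool * bool) : F :=
  Rm (p.1 + p.2) * Rm (~~ p.1 + ~~ p.2).

Lemma psi_rhos_col (S : {set 'I_b}) :
  psi_rhos K (m := m) n_gt0 k_gt0 le2k (col_word m a S) = Rm 0 ^+ (n - 2 * k) *
  \prod_(i < k) pair_rho (in_set_nat S (2 * i), in_set_nat S (2 * i).+1).
Proof.
rewrite psi_rhos_letter.
rewrite -(big_mkord xpredT (fun i => Rm (letter S (2 * i) + letter S (2 * i).+1))).
have kn : (k <= n - k)%N by lia.
(* The first [k] pairs of places are upper boxes of the [2 k] columns, the last [k] pairs their
   lower boxes; the [n - 2 k] pairs in between read [i0 i0]. *)
rewrite (big_cat_nat (n := n - k)) ?leq_subr //= (big_cat_nat (n := k)) //=.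
rewrite [X in _ * X * _](_ : _ = Rm 0 ^+ (n - 2 * k)); last first.
  have -> : (n - 2 * k = n - k - k)%N by lia.
  rewrite -prodr_const_nat big_nat [RHS]big_nat; apply: eq_bigr => i /andP[ki ink].
  rewrite /letter (_ : (2 * i < a)%N); last by lia.
  rewrite (_ : ((2 * i).+1 < a)%N); last by lia.
  by rewrite !in_set_nat_ge //; lia.
rewrite [X in X * _]mulrC -mulrA; congr (_ * _).
rewrite -{1}[(n - k)%N]add0n big_addn subKn; last by lia.
rewrite !big_mkord -big_split /=; apply: eq_bigr => i _.
have ik := ltn_ord i.
rewrite /pair_rho /= /letter.
rewrite (_ : (2 * i < a)%N); last by lia.
rewrite (_ : ((2 * i).+1 < a)%N); last by lia.
rewrite (_ : (2 * (i + (n - k)) < a)%N = false); last by lia.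
rewrite (_ : ((2 * (i + (n - k))).+1 < a)%N = false); last by lia.
rewrite (_ : (2 * (i + (n - k)) - a)%N = (2 * i)%N); last by lia.
by rewrite (_ : ((2 * (i + (n - k))).+1 - a)%N = (2 * i).+1); last by lia.
Qed.

Definition set_pairs (S : {set 'I_b}) : {ffun 'I_k -> bool * bool} :=
  [ffun i : 'I_k => (in_set_nat S (2 * i), in_set_nat S (2 * i).+1)].

Lemma set_pairs_bij : bijective set_pairs.
Proof.
apply: inj_card_bij => [S S' /ffunP E|]; last first.
  rewrite card_ffun card_prod !card_bool !card_ord -cardsT.
  have -> : [set: {set 'I_b}] = powerset [set: 'I_b].
    by apply/setP => S; rewrite !inE subsetT.
  by rewrite card_powerset cardsT card_ord expnM.
apply/setP => c; rewrite -!in_set_natE; have cb := ltn_ord c.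
have ck : (c./2 < k)%N by lia.
have := E (Ordinal ck); rewrite !ffunE /= => -[E0 E1].
by have [ec|ec] : nat_of_ord c = (2 * c./2)%N \/ nat_of_ord c = (2 * c./2).+1;
  [lia|rewrite ec|rewrite ec].
Qed.

(** The sum over [S] factors over the [k] pairs of columns, and each pair contributes 2 rho_20
    rho_02 - 2 rho_11^2. *)
Lemma Psi_rhos_hwv : Psi (psi_rhos K (m := m) n_gt0 k_gt0 le2k) (hwv K m a b) =
  (-2%:R) ^+ k *: (Rm 0 ^+ (n - 2 * k) * (Rm 1 ^+ 2 - Rm 0 * Rm 2) ^+ k).
Proof.
rewrite Psi_hwv ?leba_2k //.
pose H (p : bool * bool) : F := (-1) ^+ (p.1 + p.2) * pair_rho p.
have E (S : {set 'I_b}) : (-1) ^+ #|S| *: psi_rhos K (m := m) n_gt0 k_gt0 le2k (col_word m a S) =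
    Rm 0 ^+ (n - 2 * k) * \prod_(i < k) H (set_pairs S i).
  rewrite psi_rhos_col scalerAr; congr (_ * _).
  rewrite -(sum_in_set S (leqnn _)).
  have -> : (\sum_(j < 2 * k) in_set_nat S j =
      \sum_(i < k) (in_set_nat S (2 * i) + in_set_nat S (2 * i).+1))%N.
    rewrite -(big_mkord xpredT (fun j => in_set_nat S j : nat)).
    rewrite -(big_mkord xpredT (fun i => in_set_nat S (2 * i) + in_set_nat S (2 * i).+1)%N).
    move: (in_set_nat S) => f; elim: (k) => [|l IH]; first by rewrite !big_geq.
    have -> : (2 * l.+1 = (2 * l).+2)%N by lia.
    by rewrite !big_nat_recr //= IH addnA.
  rewrite -prodrXr -scaler_prod; apply: eq_bigr => i _.
  rewrite ffunE /H /= -signr_odd -[in RHS]signr_odd.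
  by case: odd; rewrite ?expr1 ?scaleN1r ?mulN1r // expr0 scale1r mul1r.
under eq_bigr => S _ do rewrite E.
rewrite -mulr_sumr scalerAr; congr (_ * _).
transitivity (\sum_(f : {ffun 'I_k -> bool * bool}) \prod_(i < k) H (f i)).
  by rewrite [RHS](reindex set_pairs) //; exact: onW_bij set_pairs_bij.
rewrite -(bigA_distr_bigA (fun (_ : 'I_k) p => H p)) /= prodr_const card_ord -exprZn.
congr (_ ^+ k).
rewrite -(pair_bigA _ (fun x y => H (x, y))) /= !big_bool /H /pair_rho /=.
rewrite scaleNr scaler_nat expr0 expr1 expr2 mulr2n.
ring.
Qed.

(** The coefficient -(-2)^k is chosen to turn the factor (-2)^k of [Psi_rhos_hwv] into -4^k. *)
Lemma Psi_2k_hwv :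
  Psi (fun w => 2%:R^-1 *: psi_pipi K (m := m) n_gt0 k_gt0 le2k w +
                (- (-2%:R) ^+ k) *: psi_rhos K n_gt0 k_gt0 le2k w) (hwv K m a b) =
  rel_2k K n m k.
Proof.
rewrite Psi_lin Psi_pipi_hwv_half // Psi_rhos_hwv scalerA mulNr scaleNr /rel_2k.
by congr (_ - _ *: _); rewrite -exprMn mulrNN -natrM.
Qed.

Lemma psi_2k_equivariant :
  equivariant_words (fun w => 2%:R^-1 *: psi_pipi K (m := m) n_gt0 k_gt0 le2k w +
                (- (-2%:R) ^+ k) *: psi_rhos K n_gt0 k_gt0 le2k w).
Proof.
apply: equivariant_lin; first exact: psi_pipi_equivariant.
exact: psi_rhos_equivariant.
Qed.

End Rhos.

(** * Power sum identities: the relations are nonzero and lie in the kernel *)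

Section PowerSums.
Variables (R : comNzRingType) (a b c d : R).

Definition psum n j : R := a ^+ (n - j) * b ^+ j + c ^+ (n - j) * d ^+ j.

(** The linear recurrence of a sequence that combines the powers of b/a and d/c, the roots of a c
    X^2 - (a d + c b) X + b d, with denominators cleared. *)
Lemma psum_rel_n2 n : (2 <= n)%N ->
  psum n 0 * (b * d) - psum n 1 * (a * d + c * b) + psum n 2 * (a * c) = 0.
Proof.
move=> n2; have [k ->] : exists k, n = k.+2 by exists (n - 2)%N; lia.
rewrite /psum (_ : (k.+2 - 0 = k.+2)%N) // (_ : (k.+2 - 1 = k.+1)%N) //.
rewrite (_ : (k.+2 - 2 = k)%N); last by lia.
by rewrite expr0 expr1 mulr1 !exprS; ring.
Qed.

Lemma sgn_exprB (u v : R) l : \sum_(j < l.+1) ((-1) ^+ j * (u ^+ (l - j) * v ^+ j)) *+ 'C(l, j)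
  = (u - v) ^+ l.
Proof. by rewrite exprBn; apply: eq_bigr => j _; rewrite mulrA. Qed.

(** Of the four kinds of terms, the two pure ones sum to a multiple of (1 - 1)^(2k); the two mixed
    ones are expansions of (a d - b c)^(2k) and (b c - a d)^(2k), equal because the exponent is
    even. *)
Lemma psum_binomial n k : (0 < k)%N -> (2 * k <= n)%N ->
  \sum_(j < (2 * k).+1) ((-1) ^+ j * (psum n j * psum n (2 * k - j))) *+ 'C(2 * k, j)
  = ((a * c) ^+ (n - 2 * k) * (a * d - b * c) ^+ (2 * k)) *+ 2.
Proof.
move=> k0 kn; pose T (u v : R) (j : nat) := ((-1) ^+ j * (u ^+ (2 * k - j) * v ^+ j)) *+ 'C(2 * k, j).
pose A := a ^+ (n + (n - 2 * k)) * b ^+ (2 * k).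
pose B := c ^+ (n + (n - 2 * k)) * d ^+ (2 * k).
pose C := (a * c) ^+ (n - 2 * k).
have E j : (j <= 2 * k)%N ->
   ((-1) ^+ j * (psum n j * psum n (2 * k - j))) *+ 'C(2 * k, j) =
   (A + B) * T 1 1 j + C * T (a * d) (b * c) j + C * T (b * c) (a * d) j.
  move=> j2k; have {j2k} [i e2] : exists i, (2 * k = j + i)%N by exists (2 * k - j)%N; lia.
  have [r er] : exists r, n = (r + (j + i))%N by exists (n - 2 * k)%N; lia.
  rewrite /psum /T !mulrnAr -!mulrnDl; congr (_ *+ _).
  rewrite /A /B /C e2 addKn er addnK.
  rewrite (_ : (r + (j + i) - j = r + i)%N); last by lia.
  rewrite (_ : (r + (j + i) - i = r + j)%N); last by lia.
  by rewrite !expr1n !exprMn !exprD; ring.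
rewrite (eq_bigr _ (fun j _ => E (nat_of_ord j) (leq_ord j))) !big_split /= -!mulr_sumr !sgn_exprB.
rewrite subrr expr0n (_ : (2 * k == 0)%N = false); last by lia.
rewrite mulr0 add0r mulr2n; congr (_ + _ * _).
by rewrite -opprB exprNn exprM sqrrN !expr1n mul1r.
Qed.

End PowerSums.

Section Relations.
Variables (K : numClosedFieldType) (n m : nat).
Hypothesis n_ge3 : (3 <= n)%N.
Local Notation F := (F K n m.+2).
Local Notation rho := (@rho K n m.+2).
Local Notation pi_ := (@pi_ K n m.+2).
Local Notation i0 := (i0 m).
Local Notation i1 := (i1 m).
Local Notation Pm := (Pm K n m).
Local Notation Rm := (Rm K n m).
Local Notation rel_n2 := (rel_n2 K n m).
Local Notation rel_2k := (rel_2k K n m).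

Definition two_mon d j : 'X_{1..m.+2} := (U_(i0) *+ (d - j) + U_(i1) *+ j)%MM.

Lemma two_mon_i0 d j : two_mon d j i0 = (d - j)%N.
Proof. by rewrite mnmDE !mulmnE !mnm1E eqxx mul1n (_ : (i1 == i0) = false) // addn0. Qed.

Lemma two_mon_i1 d j : two_mon d j i1 = j.
Proof. by rewrite mnmDE !mulmnE !mnm1E eqxx mul1n. Qed.

Lemma two_mon_ge2 d j (i : 'I_m) : two_mon d j (lift ord0 (lift ord0 i)) = 0%N.
Proof. by rewrite mnmDE !mulmnE !mnm1E. Qed.

Lemma mdeg_two_mon d j : (j <= d)%N -> mdeg (two_mon d j) = d.
Proof. by move=> jd; rewrite mdegD !mdegMn !mdeg1 !mul1n subnK. Qed.

Lemma two_mon_eq d j j' : (two_mon d j == two_mon d j') = (j == j').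
Proof. by apply/eqP/eqP => [/mnmP/(_ i1)|-> //]; rewrite !two_mon_i1. Qed.

Lemma prod_two_mon (R : comNzRingType) (f : 'I_m.+2 -> R) d j :
  \prod_(i < m.+2) f i ^+ two_mon d j i = f i0 ^+ (d - j) * f i1 ^+ j.
Proof.
rewrite !big_ord_recl two_mon_i0 -[lift ord0 ord0]/i1 two_mon_i1.
by rewrite big1 ?mulr1 // => i _; rewrite two_mon_ge2.
Qed.

Local Notation x0 := (x_ K i0).
Local Notation x1 := (x_ K i1).
Local Notation y0 := (y_ K i0).
Local Notation y1 := (y_ K i1).

Lemma phi_Pm j : (j <= n)%N -> phi (Pm j) = psum x0 x1 y0 y1 n j.
Proof.
move=> jn; rewrite phi_pi; last exact: mdeg_two_mon.
by rewrite /p_ !prod_two_mon.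
Qed.

Lemma phi_Rm0 : phi (Rm 0) = x0 * y0.
Proof.
rewrite phi_rho; last exact: (@mdeg_two_mon 2 0).
have -> : (U_(i0) *+ (2 - 0) + U_(i1) *+ 0)%MM = (U_(i0) + U_(i0))%MM.
  by apply/mnmP => i; rewrite !mnmDE !mulmnE; lia.
by rewrite q_UU [y0 * _]mulrC -mulr2n -scaler_nat scalerA mulVf ?scale1r ?pnatr_eq0.
Qed.

Lemma phi_Rm1 : phi (Rm 1) = 2%:R^-1 *: (x0 * y1 + y0 * x1).
Proof.
rewrite phi_rho; last exact: (@mdeg_two_mon 2 1).
have -> : (U_(i0) *+ (2 - 1) + U_(i1) *+ 1)%MM = (U_(i0) + U_(i1))%MM.
  by apply/mnmP => i; rewrite !mnmDE !mulmnE; lia.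
by rewrite q_UU.
Qed.

Lemma phi_Rm2 : phi (Rm 2) = x1 * y1.
Proof.
rewrite phi_rho; last exact: (@mdeg_two_mon 2 2).
have -> : (U_(i0) *+ (2 - 2) + U_(i1) *+ 2)%MM = (U_(i1) + U_(i1))%MM.
  by apply/mnmP => i; rewrite !mnmDE !mulmnE; lia.
by rewrite q_UU [y1 * _]mulrC -mulr2n -scaler_nat scalerA mulVf ?scale1r ?pnatr_eq0.
Qed.

Lemma phiB (x y : F) : phi (x - y) = phi x - phi y. Proof. exact: rmorphB. Qed.
Lemma phiXn (x : F) e : phi (x ^+ e) = phi x ^+ e. Proof. exact: rmorphXn. Qed.

Lemma phi_rel_n2 : phi rel_n2 = 0.
Proof.
rewrite /rel_n2 !(phiB, phiD, phiM, phiZ) phi_Rm0 phi_Rm1 phi_Rm2 !phi_Pm; try by lia.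
rewrite -scalerAr scalerA mulfV ?pnatr_eq0 // scale1r.
by apply: psum_rel_n2; lia.
Qed.

Lemma rel_2kE k : (0 < k)%N -> (2 * k <= n)%N -> rel_2k k =
  2%:R^-1 *: (\sum_(j < (2 * k).+1) ((-1) ^+ j * 'C(2 * k, j)%:R) *: (Pm j * Pm (2 * k - j)))
  - 4%:R ^+ k *: (Rm 0 ^+ (n - 2 * k) * (Rm 1 ^+ 2 - Rm 0 * Rm 2) ^+ k).
Proof.
move=> k0 kn; have n0 : (0 < n)%N by lia.
by rewrite /rel_2k -(Psi_pipi_hwv K m n0 k0 kn) Psi_pipi_hwv_half.
Qed.

(** The quadratic part maps to (x0 y0)^(n-2k) (x0 y1 - x1 y0)^(2k) by [psum_binomial], and rho_11^2
    - rho_20 rho_02 maps to a quarter of the squared minor. *)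
Lemma phi_rel_2k k : (0 < k)%N -> (2 * k <= n)%N -> phi (rel_2k k) = 0.
Proof.
move=> k0 kn; rewrite rel_2kE // phiB !phiZ !phiM !phiXn phiB phiM phiXn.
rewrite phi_Rm0 phi_Rm1 phi_Rm2.
rewrite (big_morph (@phi K n m.+2) (@phiD K n m.+2) (raddf0 _)).
rewrite (eq_bigr (fun j : 'I_(2 * k).+1 => ((-1) ^+ j *
  (psum x0 x1 y0 y1 n j * psum x0 x1 y0 y1 n (2 * k - j))) *+ 'C(2 * k, j))); last first.
  move=> j _; have := ltn_ord j; rewrite ltnS => j2k.
  rewrite phiZ phiM !phi_Pm; try by lia.
  rewrite mulrC -scalerA scaler_nat -signr_odd -[in RHS]signr_odd.
  by case: odd; rewrite ?expr1 ?scaleN1r ?mulN1r // expr0 scale1r mul1r.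
rewrite psum_binomial // -scaler_nat scalerA mulVf ?pnatr_eq0 // scale1r.
rewrite scalerAr -exprZn; apply/eqP; rewrite subr_eq0; apply/eqP; congr (_ * _).
rewrite exprM; congr (_ ^+ _).
rewrite exprZn scalerBr scalerA.
have -> : 4%:R * 2%:R^-1 ^+ 2 = 1 :> K by rewrite exprVn -natrX mulfV ?pnatr_eq0.
rewrite scale1r scaler_nat !expr2.
move: x0 x1 y0 y1 => a b c d; ring.
Qed.

Section Evaluation.
Variables (A : comNzRingType) (f : {rmorphism K -> A}) (hr hp : 'X_{1..m.+2} -> A).

Definition Feval : F -> A :=
  Fhom f (fun v => match v with inl a => hr (val a) | inr b => hp (val b) end).

HB.instance Definition _ := GRing.RMorphism.copy Feval
  (Fhom f (fun v => match v with inl a => hr (val a) | inr b => hp (val b) end)).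

Lemma Feval_rho a : mdeg a = 2 -> Feval (rho a) = hr a.
Proof. by move: a; apply: mindexP => a; rewrite rhoE /Feval FhomX. Qed.

Lemma Feval_pi b : mdeg b = n -> Feval (pi_ b) = hp b.
Proof. by move: b; apply: mindexP => b; rewrite piE /Feval FhomX. Qed.

Lemma FevalZ c x : Feval (c *: x) = f c * Feval x.
Proof. exact: FhomZ. Qed.

Lemma Feval_Pm j : (j <= n)%N -> Feval (Pm j) = hp (two_mon n j).
Proof. by move=> jn; rewrite Feval_pi // mdeg_two_mon. Qed.

Lemma Feval_Rm j : (j <= 2)%N -> Feval (Rm j) = hr (two_mon 2 j).
Proof. by move=> jn; rewrite Feval_rho // mdeg_two_mon. Qed.

End Evaluation.

Lemma rel_n2_neq0 : rel_n2 != 0.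
Proof.
pose ev := Feval idfun (fun a => (a == two_mon 2 2)%:R : K) (fun b => (b == two_mon n 0)%:R).
apply/eqP => /(congr1 ev); rewrite /ev /rel_n2 rmorph0 rmorphD rmorphB /= FevalZ !rmorphM /=.
rewrite !Feval_Pm ?Feval_Rm //; try by lia.
rewrite !two_mon_eq !eqxx /= !mulr0 subr0 addr0 mulr1; apply/eqP; exact: oner_neq0.
Qed.

(** At the point where [Pm 0] and [Pm (2 * k)] are 1 and all other variables vanish, only the term
    [j = 0] survives, with value 1. *)
Lemma rel_2k_neq0 k : (0 < k)%N -> (2 * k <= n)%N -> rel_2k k != 0.
Proof.
move=> k0 kn.
pose ev := Feval idfun (fun a => 0 : K)
  (fun b => ((b == two_mon n 0) || (b == two_mon n (2 * k)))%:R).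
apply/eqP => /(congr1 ev); rewrite /ev /rel_2k rmorph0 rmorphB rmorphD /= !FevalZ.
rewrite rmorph_sum rmorphXn [X in _ - _ * X]rmorphM !rmorphXn rmorphB rmorphXn.
rewrite [X in (_ - X) ^+ _]rmorphM /= !Feval_Rm // mul0r subr0 [0 ^+ 2]expr0n [0%:R ^+ k]expr0n (_ : (k == 0)%N = false); last by lia.
rewrite !mulr0 subr0 Feval_Pm; last by lia.
rewrite !two_mon_eq (_ : (k == 0)%N = false); last by lia.
rewrite (_ : (k == 2 * k)%N = false); last by lia.
rewrite expr0n mulr0 add0r big_ltn //= big_nat big1 ?addr0.
  rewrite FevalZ /= rmorphM /= !Feval_Pm; try by lia.
  rewrite !two_mon_eq /= subn0 eqxx orbT bin0 expr0 !mulr1.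
  by apply/eqP; exact: oner_neq0.
move=> j /andP[j0 jk]; rewrite FevalZ /= rmorphM /= !Feval_Pm; try by lia.
rewrite !two_mon_eq (_ : (j == 0)%N = false); last by lia.
by rewrite (_ : (j == 2 * k)%N = false) ?mul0r ?mulr0 //; lia.
Qed.

Lemma relation_model lam : lam \in Lambda n ->
  exists a b, exists psi : {ffun 'I_(sumn [:: a; b]) -> 'I_m.+2} -> F,
  lam = [:: a; b] /\ [/\ (b <= a)%N, equivariant_words psi,
     Psi psi (hwv K m a b) != 0,
     phi (Psi psi (hwv K m a b)) = 0 &
     Psi psi (hwv K m a b) = if lam == [:: n; 2%N] then rel_n2 else rel_2k b./2].
Proof.
have n0 : (0 < n)%N by lia.
rewrite /Lambda inE; case: eqP => [-> _|nl /= /mapP[k]].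
  exists n, 2%N, (@psi_n2 K n m); have n2 : (2 <= n)%N by lia.
  rewrite Psi_n2_hwv // rel_n2_neq0 phi_rel_n2; split=> //; split=> //.
  exact: psi_n2_equivariant.
rewrite mem_iota => /andP[k1 kn] elam; have {}kn : (2 * k <= n)%N by lia.
exists (2 * n - 2 * k)%N, (2 * k)%N, (fun w => 2%:R^-1 *: psi_pipi K (m := m) n0 k1 kn w +
                (- (-2%:R) ^+ k) *: psi_rhos K n0 k1 kn w).
rewrite Psi_2k_hwv rel_2k_neq0 // phi_rel_2k //; split=> //; split=> //.
- by lia.
- exact: psi_2k_equivariant.
by rewrite mul2n doubleK.
Qed.

End Relations.

Section RelationModules.
Variables (K : numClosedFieldType) (n : nat).
Hypothesis n_ge3 : (3 <= n)%N.

Lemma append_zeros_two_mon m d j : (j <= d)%N ->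
  append_zeros m.+2 [multinom [tuple (d - j)%N; j]] = two_mon m d j.
Proof.
move=> jd; apply/mnmP => i; rewrite mnmE.
case: (unliftP ord0 i) => [i'|] ->; last by rewrite two_mon_i0.
case: (unliftP ord0 i') => [i''|] ->; last by rewrite two_mon_i1.
by rewrite two_mon_ge2 nth_default.
Qed.

Lemma multinom_two_mon d j : (j <= d)%N ->
  [multinom [tuple (d - j)%N; j]] = two_mon 0 d j.
Proof.
move=> jd; rewrite -append_zeros_two_mon //; apply/mnmP => i; rewrite mnmE.
by rewrite (mnm_nth 0%N).
Qed.

Section Incl.
Variable m : nat.
Local Notation incl := (@F_incl K n 2 m.+2).

Lemma F_incl_rho a : mdeg a = 2 -> incl (rho K n a) = rho K n (append_zeros m.+2 a).
Proof.
move: a; apply: mindexP => a.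
by rewrite rhoE /F_incl comp_mpolyXU -tnth_nth tnth_mktuple enum_rankK.
Qed.

Lemma F_incl_pi b : mdeg b = n -> incl (pi_ K n b) = pi_ K n (append_zeros m.+2 b).
Proof.
move: b; apply: mindexP => b.
by rewrite piE /F_incl comp_mpolyXU -tnth_nth tnth_mktuple enum_rankK.
Qed.

Lemma F_incl_Rm j : (j <= 2)%N -> incl (Rm K n 0 j) = Rm K n m j.
Proof.
move=> j2; rewrite F_incl_rho; last exact: (@mdeg_two_mon 0 2 j).
by rewrite -[(_ + _)%MM]/(two_mon 0 2 j) -multinom_two_mon // append_zeros_two_mon.
Qed.

Lemma F_incl_Pm j : (j <= n)%N -> incl (Pm K n 0 j) = Pm K n m j.
Proof.
move=> jn; rewrite F_incl_pi; last exact: mdeg_two_mon.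
by rewrite -[(_ + _)%MM]/(two_mon 0 n j) -multinom_two_mon // append_zeros_two_mon.
Qed.

Lemma F_inclM x y : incl (x * y) = incl x * incl y. Proof. exact: rmorphM. Qed.
Lemma F_inclD x y : incl (x + y) = incl x + incl y. Proof. exact: rmorphD. Qed.
Lemma F_inclB x y : incl (x - y) = incl x - incl y. Proof. exact: rmorphB. Qed.
Lemma F_inclX x e : incl (x ^+ e) = incl x ^+ e. Proof. exact: rmorphXn. Qed.
Lemma F_inclZ c x : incl (c *: x) = c *: incl x. Proof. exact: linearZ. Qed.

Lemma F_incl_n2 : incl (rel_n2 K n 0) = rel_n2 K n m.
Proof.
rewrite /rel_n2 F_inclD F_inclB F_inclZ !F_inclM !F_incl_Rm // !F_incl_Pm //; lia.
Qed.

Lemma F_incl_2k k : (2 * k <= n)%N -> incl (rel_2k K n 0 k) = rel_2k K n m k.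
Proof.
move=> kn; rewrite /rel_2k F_inclB F_inclD !F_inclZ F_inclX F_inclM !F_inclX.
rewrite F_inclB F_inclX F_inclM !F_incl_Rm // F_incl_Pm; last by lia.
congr (_ + _ - _); rewrite (big_morph _ F_inclD (raddf0 _)).
rewrite big_nat [RHS]big_nat; apply: eq_bigr => j /andP[_ jk].
by rewrite F_inclZ F_inclM !F_incl_Pm //; lia.
Qed.

End Incl.

Lemma pi_two_mon j b : (j <= n)%N -> b = (n - j)%N ->
  pi_ K n [multinom [tuple b; j]] = Pm K n 0 j.
Proof. by move=> jn ->; rewrite multinom_two_mon. Qed.

Lemma rho_two_mon j b : (j <= 2)%N -> b = (2 - j)%N ->
  rho K n [multinom [tuple b; j]] = Rm K n 0 j.
Proof. by move=> j2 ->; rewrite multinom_two_mon. Qed.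

Lemma R_n2E : R_n2 K n = rel_n2 K n 0.
Proof.
by rewrite /R_n2 !(@rho_two_mon 0) ?(@rho_two_mon 1) ?(@rho_two_mon 2) // !pi_two_mon //; lia.
Qed.

Lemma R_2kE k : (2 * k <= n)%N -> R_2k K n k = rel_2k K n 0 k.
Proof.
move=> kn.
pose p2 a b := pi_ K n [multinom [tuple a; b]].
pose r2 a b := rho K n [multinom [tuple a; b]].
have pE j b : (j <= n)%N -> b = (n - j)%N -> p2 b j = Pm K n 0 j by exact: pi_two_mon.
have rE j b : (j <= 2)%N -> b = (2 - j)%N -> r2 b j = Rm K n 0 j by exact: rho_two_mon.
rewrite -[LHS]/(((-1) ^+ k * 2%:R^-1 * 'C(2 * k, k)%:R) *: p2 (n - k)%N k ^+ 2
  + \sum_(0 <= j < k) ((-1) ^+ j * 'C(2 * k, j)%:R) *: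
      (p2 (n - j)%N j * p2 (n - 2 * k + j)%N (2 * k - j)%N)
  - 4%:R ^+ k *: (r2 2 0 ^+ (n - 2 * k) * (r2 1 1 ^+ 2 - r2 2 0 * r2 0 2) ^+ k)).
move: p2 r2 pE rE => p2 r2 pE rE.
have kn' : (k <= n)%N by lia.
rewrite (rE 0 2 isT erefl) (rE 1 1 isT erefl) (rE 2 0 isT erefl) (pE k _ kn' erefl).
congr (_ + _ - _); rewrite big_nat [RHS]big_nat; apply: eq_bigr => j /andP[_ jk].
have jn : (j <= n)%N by lia.
have jn' : (2 * k - j <= n)%N by lia.
have e : (n - 2 * k + j = n - (2 * k - j))%N by lia.
by rewrite (pE j _ jn erefl) (pE _ _ jn' e).
Qed.

Lemma LambdaP lam : lam \in Lambda n -> lam = [:: n; 2%N] \/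
  exists2 k, (0 < k)%N && (2 * k <= n)%N & lam = [:: (2 * n - 2 * k)%N; (2 * k)%N].
Proof.
rewrite inE => /orP[/eqP|/mapP[k]]; first by left.
by rewrite mem_iota => kn ->; right; exists k => //; lia.
Qed.

Lemma R_n2_lam : R_ K n [:: n; 2%N] = rel_n2 K n 0.
Proof. by rewrite /R_ eqxx R_n2E. Qed.

Lemma R_2k_lam k : (0 < k)%N -> (2 * k <= n)%N ->
  R_ K n [:: (2 * n - 2 * k)%N; (2 * k)%N] = rel_2k K n 0 k.
Proof.
move=> k0 kn; rewrite /R_ ifF; last by apply/eqP => -[]; lia.
by rewrite /= mul2n doubleK R_2kE.
Qed.

Lemma relation_Psi m lam : lam \in Lambda n ->
  exists a b, exists psi : {ffun 'I_(sumn [:: a; b]) -> 'I_m.+2} -> F K n m.+2,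
  lam = [:: a; b] /\ [/\ (b <= a)%N, equivariant_words psi,
     Psi psi (hwv K m a b) != 0,
     phi (Psi psi (hwv K m a b)) = 0 &
     Psi psi (hwv K m a b) = F_incl m.+2 (R_ K n lam)].
Proof.
move=> lamL; have [a [b [psi [elam [leba epsi n0 ph E]]]]] := relation_model K m n_ge3 lamL.
exists a, b, psi; split=> //; split=> //; rewrite E.
case/LambdaP: lamL => [el|[k /andP[k0 kn] el]].
  by rewrite el eqxx R_n2_lam F_incl_n2.
rewrite ifF; last by rewrite el; apply/eqP => -[]; lia.
rewrite el R_2k_lam // F_incl_2k //; congr rel_2k.
by move: elam; rewrite el => -[_ <-]; rewrite mul2n doubleK.
Qed.

Lemma F_incl_id (f : F K n 2) : F_incl 2 f = f.
Proof.
have az (a : 'X_{1..2}) : append_zeros 2 a = a.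
  by apply/mnmP => i; rewrite mnmE (mnm_nth 0%N).
elim/F_ind: f => [c|x y IHx IHy|[a|b] x IHx].
- exact: comp_mpolyC.
- by rewrite (@F_inclD 0) IHx IHy.
- by rewrite (@F_inclM 0) IHx -rhoE F_incl_rho ?az //; apply/eqP; case: a.
by rewrite (@F_inclM 0) IHx -piE F_incl_pi ?az //; apply/eqP; case: b.
Qed.

Lemma ker_phi_submod m : GL_submodule (@GL_act_F K n m) (@ker_phi K n m).
Proof.
have n0 : (0 < n)%N by lia.
split; first split.
- exact: raddf0.
- by move=> c u v; rewrite /ker_phi => u0 v0; rewrite phiD phiZ u0 v0 scaler0 addr0.
by move=> g u gu; rewrite /ker_phi phi_actF // => ->; exact: raddf0.
Qed.

Lemma relation_module m lam : lam \in Lambda n ->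
  let r := F_incl m.+2 (R_ K n lam) in
  let M := GL_generated (@GL_act_F K n m.+2) r in
  [/\ incl M (@ker_phi K n m.+2),
     GL_isomorphic (@GL_act_F K n m.+2) M (@tensor_act K m.+2 lam) (@schur_module K m.+2 lam)
   & GL_irreducible (@GL_act_F K n m.+2) M].
Proof.
move=> /(@relation_Psi m)[a [b [psi [-> [leba epsi n0 ph E]]]]]; rewrite /= -E.
have PsiG g t : g \in unitmx -> GL_act_F g (Psi psi t) = Psi psi (tensor_act g t).
  by move=> _; apply: Psi_act.
split.
- by move=> w; apply; first exact: ker_phi_submod.
- exact: (model_iso leba (PsiZD psi) PsiG).
exact: (model_irreducible leba (PsiZD psi) PsiG).
Qed.

End RelationModules.

(** * The lowering operator *)

Section Lowering.
Variables (K : numClosedFieldType) (n : nat).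
Hypothesis n_ge3 : (3 <= n)%N.
Local Notation F := (F K n 2).
Local Notation Pm := (Pm K n 0).
Local Notation Rm := (Rm K n 0).
Local Notation i0 := (i0 0).
Local Notation i1 := (i1 0).

Lemma ord2P (P : 'I_2 -> Prop) : P i0 -> P i1 -> forall i, P i.
Proof.
move=> P0 P1 i; case: (unliftP ord0 i) => [j|] -> //.
by rewrite (_ : lift ord0 j = i1) //; apply: ord_inj; rewrite [j]ord1.
Qed.

Lemma two_monP d (a : 'X_{1..2}) : mdeg a = d ->
  a = two_mon 0 d (a i1) /\ (a i1 <= d)%N.
Proof.
rewrite mdegE !big_ord_recl big_ord0 addn0 -[lift ord0 ord0]/i1 => <-.
split; last exact: leq_addl.
apply/mnmP; apply: ord2P; last by rewrite two_mon_i1.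
by rewrite two_mon_i0 addnK.
Qed.

Lemma F2_ind (P : F -> Prop) :
  (forall c, P c%:MP) -> (forall x y, P x -> P y -> P (x + y)) ->
  (forall j x, (j <= 2)%N -> P x -> P (Rm j * x)) ->
  (forall j x, (j <= n)%N -> P x -> P (Pm j * x)) -> forall x, P x.
Proof.
move=> PC PD PR PP; apply: F_ind => // -[a|b] x Px.
  by have [ea le] := two_monP (eqP (valP a)); rewrite -rhoE ea; apply: (PR (a i1)).
by have [eb le] := two_monP (eqP (valP b)); rewrite -piE eb; apply: (PP (b i1)).
Qed.

Definition constP (c : K) : {poly F} := (c%:MP)%:P.
HB.instance Definition _ := GRing.RMorphism.copy constP (polyC \o @mpolyC _ K).

Definition Grho (a : 'X_{1..2}) : {poly F} :=
  \poly_(l < (2 - a i1).+1) ('C(2 - a i1, l)%:R *: Rm (a i1 + l)).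
Definition Gpi (b : 'X_{1..2}) : {poly F} :=
  \poly_(l < (n - b i1).+1) ('C(n - b i1, l)%:R *: Pm (b i1 + l)).

(* The action of 1 + t E_10, with the parameter t as variable; its derivative at
   t = 0 is the lowering operator [low]. *)
Definition Gpoly : F -> {poly F} := Feval constP Grho Gpi.
HB.instance Definition _ := GRing.RMorphism.copy Gpoly (Feval constP Grho Gpi).

Lemma Gpoly_Rm j : (j <= 2)%N ->
  Gpoly (Rm j) = \poly_(l < (2 - j).+1) ('C(2 - j, l)%:R *: Rm (j + l)).
Proof. by move=> j2; rewrite /Gpoly Feval_Rm // /Grho two_mon_i1. Qed.

Lemma Gpoly_Pm j : (j <= n)%N ->
  Gpoly (Pm j) = \poly_(l < (n - j).+1) ('C(n - j, l)%:R *: Pm (j + l)).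
Proof. by move=> jn; rewrite /Gpoly Feval_Pm // /Gpi two_mon_i1. Qed.

Lemma GpolyC c : Gpoly c%:MP = (c%:MP)%:P.
Proof. by rewrite /Gpoly /Feval /Fhom mmapC. Qed.

Definition low_mx (t : K) : 'M[K]_2 := 1%:M + t *: delta_mx i1 i0.

Lemma low_mx_unit t : low_mx t \in unitmx.
Proof.
rewrite unitmxE det_trig; last first.
  apply/is_trig_mxP; apply: ord2P; apply: ord2P => //= _.
  by rewrite !mxE /= mulr0 addr0.
rewrite !big_ord_recl big_ord0 !mxE /= !mulr0 !addr0 !mulr1.
exact: unitr1.
Qed.

Lemma low_x t : GL_act_KV (low_mx t) (x_ K i0) = x_ K i0 + t *: x_ K i1 /\
  GL_act_KV (low_mx t) (x_ K i1) = x_ K i1.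
Proof.
rewrite !GL_act_x !big_ord_recl !big_ord0 -[lift ord0 ord0]/i1 -[ord0]/i0.
by rewrite !mxE /= !(mulr0, mulr1, addr0, add0r, scale1r, scale0r).
Qed.

Lemma low_y t : GL_act_KV (low_mx t) (y_ K i0) = y_ K i0 + t *: y_ K i1 /\
  GL_act_KV (low_mx t) (y_ K i1) = y_ K i1.
Proof.
rewrite !GL_act_y !big_ord_recl !big_ord0 -[lift ord0 ord0]/i1 -[ord0]/i0.
by rewrite !mxE /= !(mulr0, mulr1, addr0, add0r, scale1r, scale0r).
Qed.

End Lowering.

Section LoweringDerivation.
Variables (K : numClosedFieldType) (n : nat).
Hypothesis n_ge3 : (3 <= n)%N.
Local Notation F := (F K n 2).
Local Notation Pm := (Pm K n 0).
Local Notation Rm := (Rm K n 0).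
Local Notation i0 := (i0 0).
Local Notation i1 := (i1 0).
Local Notation x0 := (x_ K i0).
Local Notation x1 := (x_ K i1).
Local Notation y0 := (y_ K i0).
Local Notation y1 := (y_ K i1).
Local Notation Gpoly := (@Gpoly K n).

Lemma low_mon (A : comAlgType K) (u v : A) t e j :
  (u + t *: v) ^+ e * v ^+ j =
  \sum_(l < e.+1) ('C(e, l)%:R * t ^+ l) *: (u ^+ (e - l) * v ^+ (j + l)).
Proof.
rewrite exprDn mulr_suml; apply: eq_bigr => l _.
by rewrite exprZn -scalerAr -scaler_nat scalerA -scalerAl -mulrA -exprD addnC.
Qed.

Lemma low_Pm t j : (j <= n)%N -> GL_act_F (low_mx t) (Pm j) =
  \sum_(l < (n - j).+1) ('C(n - j, l)%:R * t ^+ l) *: Pm (j + l).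
Proof.
have n0 : (0 < n)%N by lia.
move=> jn; rewrite GL_act_F_pi; last exact: mdeg_two_mon.
have pE e : p_ K (two_mon 0 n e) =
    x0 ^+ (n - e) * x1 ^+ e + y0 ^+ (n - e) * y1 ^+ e :> KV K 2.
  by rewrite /p_ (prod_two_mon (@x_ K 2)) (prod_two_mon (@y_ K 2)).
rewrite -[(_ + _)%MM]/(two_mon 0 n j) pE GL_act_KVD 2!GL_act_KVM.
have actX (z : KV K 2) e : GL_act_KV (low_mx t) (z ^+ e) = GL_act_KV (low_mx t) z ^+ e.
  exact: rmorphXn.
rewrite 4!actX; have [-> ->] := low_x t; have [-> ->] := low_y t.
rewrite !low_mon -big_split /= (lin_sum (@lift_pZD K n 2)).
apply: eq_bigr => l _; have := ltn_ord l; rewrite ltnS => ln.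
rewrite -scalerDr (linZ (@lift_pZD K n 2)); congr (_ *: _).
rewrite -subnDA -pE; apply: lift_p_p => //.
by apply: mdeg_two_mon; lia.
Qed.

Lemma half_add (W : lmodType K) (u v : W) :
  2%:R^-1 *: (u + v *+ 2) = 2%:R^-1 *: u + v.
Proof. by rewrite scalerDr -scaler_nat scalerA mulVf ?pnatr_eq0 // scale1r. Qed.

Lemma sum_binom2 (W : lmodType K) (f : nat -> W) t :
  [/\ \sum_(l < 3) ('C(2, l)%:R * t ^+ l) *: f l =
        f 0%N + (2%:R * t) *: f 1%N + t ^+ 2 *: f 2%N,
      \sum_(l < 2) ('C(1, l)%:R * t ^+ l) *: f l = f 0%N + t *: f 1%N
    & \sum_(l < 1) ('C(0, l)%:R * t ^+ l) *: f l = f 0%N].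
Proof.
by split; rewrite !big_ord_recl big_ord0 /= addr0 ?bin0 ?bin1 ?binn !mul1r
  ?scale1r ?expr0 ?expr1 ?scale1r ?addrA.
Qed.

Lemma low_Rm t j : (j <= 2)%N -> GL_act_F (low_mx t) (Rm j) =
  \sum_(l < (2 - j).+1) ('C(2 - j, l)%:R * t ^+ l) *: Rm (j + l).
Proof.
have n0 : (0 < n)%N by lia.
pose lq := lin_sum (@lift_qZD K n 2).
have q_two j' : (j' <= 2)%N -> q_ K (two_mon 0 2 j') = phi (Rm j').
  by move=> ?; rewrite phi_rho // mdeg_two_mon.
have lqR j' : (j' <= 2)%N -> lift_q n (phi (Rm j')) = Rm j'.
  by move=> ?; rewrite -q_two // lift_q_q // mdeg_two_mon.
move=> j2; rewrite GL_act_F_rho; last exact: mdeg_two_mon.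
rewrite -[(_ + _)%MM]/(two_mon 0 2 j) q_two //.
transitivity (lift_q n (\sum_(l < (2 - j).+1) ('C(2 - j, l)%:R * t ^+ l) *: phi (Rm (j + l)))).
  congr lift_q; have [ex0 ex1] := low_x t; have [ey0 ey1] := low_y t.
  have [->|[->|->]] : j = 0%N \/ j = 1%N \/ j = 2%N by lia.
  - have [-> _ _] := sum_binom2 (fun l => phi (Rm (0 + l))) t; rewrite !add0n.
    rewrite (phi_Rm0 K 0 n_ge3) (phi_Rm1 K 0 n_ge3) (phi_Rm2 K 0 n_ge3).
    rewrite GL_act_KVM ex0 ey0.
    move: x0 x1 y0 y1 => a b c d.
    rewrite scalerA -mulrA [t * _]mulrC mulrA mulfV ?pnatr_eq0 // mul1r.
    rewrite mulrDl !mulrDr -!scalerAl -!scalerAr scalerA -expr2 scalerDr.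
    by rewrite [c * b]mulrC !addrA.
  - have [_ -> _] := sum_binom2 (fun l => phi (Rm (1 + l))) t; rewrite addn0 addn1.
    rewrite (phi_Rm1 K 0 n_ge3) (phi_Rm2 K 0 n_ge3).
    rewrite GL_act_KVZ GL_act_KVD GL_act_KVM GL_act_KVM ex0 ex1 ey0 ey1.
    move: x0 x1 y0 y1 => a b c d.
    rewrite !mulrDl -!scalerAl [d * b]mulrC.
    by rewrite addrACA -mulr2n half_add.
  have [_ _ ->] := sum_binom2 (fun l => phi (Rm (2 + l))) t; rewrite addn0.
  by rewrite (phi_Rm2 K 0 n_ge3) GL_act_KVM ex1 ey1.
rewrite lq; apply: eq_bigr => l _; have := ltn_ord l; rewrite ltnS => l2.
by rewrite (linZ (@lift_qZD K n 2)) lqR //; lia.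
Qed.

Lemma horner_poly_binom e (f : nat -> F) t :
  (\poly_(l < e.+1) ('C(e, l)%:R *: f l)).[t%:MP] =
  \sum_(l < e.+1) ('C(e, l)%:R * t ^+ l) *: f l.
Proof.
rewrite horner_poly; apply: eq_bigr => l _.
by rewrite -rmorphXn /= mulrC mul_mpolyC scalerA mulrC.
Qed.

Lemma GpolyD x y : Gpoly (x + y) = Gpoly x + Gpoly y. Proof. exact: rmorphD. Qed.
Lemma GpolyB x y : Gpoly (x - y) = Gpoly x - Gpoly y. Proof. exact: rmorphB. Qed.
Lemma GpolyM x y : Gpoly (x * y) = Gpoly x * Gpoly y. Proof. exact: rmorphM. Qed.

Lemma Gpoly_act t x : (Gpoly x).[t%:MP] = GL_act_F (low_mx t) x.
Proof.
elim/F2_ind: x => [c|x y IHx IHy|j x j2 IHx|j x jn IHx].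
- by rewrite GpolyC hornerC GL_act_FC.
- by rewrite GpolyD hornerD GL_act_FD; congr (_ + _).
- rewrite GpolyM hornerM GL_act_FM; congr (_ * _) => //.
  by rewrite Gpoly_Rm // horner_poly_binom low_Rm.
rewrite GpolyM hornerM GL_act_FM; congr (_ * _) => //.
by rewrite Gpoly_Pm // horner_poly_binom low_Pm.
Qed.

Definition low (x : F) : F := (Gpoly x)`_1.

Lemma Gpoly0 x : (Gpoly x)`_0 = x.
Proof.
elim/F2_ind: x => [c|x y IHx IHy|j x j2 IHx|j x jn IHx].
- by rewrite GpolyC coefC.
- by rewrite GpolyD coefD; congr (_ + _).
- rewrite GpolyM coef0M; congr (_ * _) => //.
  by rewrite Gpoly_Rm // coef_poly /= bin0 scale1r addn0.
rewrite GpolyM coef0M; congr (_ * _) => //.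
by rewrite Gpoly_Pm // coef_poly /= bin0 scale1r addn0.
Qed.

(** The Leibniz rule: [Gpoly] is multiplicative and [Gpoly x] has constant term [x]. *)
Lemma lowM x y : low (x * y) = low x * y + x * low y.
Proof.
rewrite /low GpolyM.
rewrite coefM.
rewrite 2!big_ord_recl big_ord0 addr0.
rewrite [RHS]addrC.
congr (_ * _ + _ * _).
  by rewrite Gpoly0.
by rewrite Gpoly0.
Qed.

Lemma lowD x y : low (x + y) = low x + low y.
Proof. by rewrite /low GpolyD coefD. Qed.

Lemma lowB x y : low (x - y) = low x - low y.
Proof. by rewrite /low GpolyB coefB. Qed.

Lemma lowC c : low c%:MP = 0.
Proof. by rewrite /low GpolyC coefC. Qed.

Lemma lowZ c x : low (c *: x) = c *: low x.
Proof. by rewrite -mul_mpolyC lowM lowC mul0r add0r mul_mpolyC. Qed.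

Lemma low_Pm1 j : (j <= n)%N -> low (Pm j) = (n%:R - j%:R) *: Pm j.+1.
Proof.
move=> jn; rewrite /low Gpoly_Pm // coef_poly bin1 addn1 -natrB //.
(* For [j = n] the polynomial is constant, and the factor [n - j] on the right vanishes as well. *)
by case: ltnP => //; rewrite ltnS leqn0 => /eqP ->; rewrite scale0r.
Qed.

Lemma low_Rm0 : low (Rm 0) = 2%:R *: Rm 1.
Proof. by rewrite /low Gpoly_Rm // coef_poly. Qed.
Lemma low_Rm1 : low (Rm 1) = Rm 2.
Proof. by rewrite /low Gpoly_Rm // coef_poly /= scale1r. Qed.
Lemma low_Rm2 : low (Rm 2) = 0.
Proof. by rewrite /low Gpoly_Rm // coef_poly. Qed.

(** The values of [Gpoly x] at scalars are images of [x] under invertible matrices, so interpolation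
    puts all its coefficients into [J], in particular the one of degree 1. *)
Lemma low_closed (J : F -> Prop) : subspace J ->
  (forall g x, g \in unitmx -> J x -> J (GL_act_F g x)) -> forall x, J x -> J (low x).
Proof.
move=> subJ JG x Jx; pose N := (size (Gpoly x)).+2.
apply: (@vandermonde_subspace K F J 1 N (fun k => (Gpoly x)`_k) subJ) => //.
  exact: oner_neq0.
move=> t _; have := JG _ _ (low_mx_unit t) Jx; congr J.
rewrite -Gpoly_act (@horner_coef_wide _ N) ?leqW //.
by apply: eq_bigr => k _; rewrite -rmorphXn /= mulrC mul_mpolyC.
Qed.

End LoweringDerivation.

(** * Exchange relations for products of two power sums *)

Section Differences.
Variables (K : numFieldType) (A : comAlgType K).

(** Differences along an antidiagonal: every term has index sum [i + j + r]. For
    [f i j = P i * P j], the value [dif f (2 * k) 0 0] is twice the quadratic part of the relation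
    of index [k]. *)
Fixpoint dif (f : nat -> nat -> A) (r i j : nat) : A :=
  if r is r'.+1 then dif f r' i j.+1 - dif f r' i.+1 j else f i j.

Lemma difS f r i j : dif f r.+1 i j = dif f r i j.+1 - dif f r i.+1 j.
Proof. by []. Qed.

Lemma dif_sym f r i j : (forall i j, f i j = f j i) ->
  dif f r j i = (-1) ^+ r *: dif f r i j.
Proof.
move=> fs; elim: r i j => [|r IH] i j; first by rewrite scale1r.
by rewrite /= (IH i.+1 j) (IH i j.+1) -scalerBr exprSr -scalerA scaleN1r opprB.
Qed.

Lemma dif_closed f r i j : dif f r i j =
  \sum_(a < r.+1) ((-1) ^+ a * 'C(r, a)%:R) *: f (i + a)%N (j + (r - a))%N.
Proof.
elim: r i j => [|r IH] i j.
  by rewrite big_ord_recl big_ord0 addr0 /= mulr1 scale1r !addn0.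
rewrite /= !IH [RHS]big_ord_recl /= [X in X - _]big_ord_recl.
rewrite /= !bin0 !addn0 !subn0 addSnnS -addrA; congr (_ + _).
have -> : \sum_(a < r) ((-1) ^+ bump 0 a * 'C(r, bump 0 a)%:R) *:
             f (i + bump 0 a)%N (j.+1 + (r - bump 0 a))%N =
          \sum_(a < r.+1) ((-1) ^+ a.+1 * 'C(r, a.+1)%:R) *: f (i + a.+1)%N (j + (r - a))%N.
  rewrite [RHS]big_ord_recr /= bin_small // mulr0 scale0r addr0.
  by apply: eq_bigr => a _; rewrite /bump add1n; congr (_ *: f _ _); have := ltn_ord a; lia.
rewrite -sumrB; apply: eq_bigr => a _.
rewrite /bump add1n subSS addSnnS -scalerBl; congr (_ *: _).
by rewrite binS natrD exprS mulrDr mulN1r !mulNr.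
Qed.

End Differences.

Section Descent.
Variables (K : numFieldType) (A : comAlgType K) (n : nat).
Variables (P : nat -> A) (r s t : A) (D : A -> A) (J Q : A -> Prop).
Hypothesis n_ge2 : (2 <= n)%N.
Hypotheses (DD : {morph D : x y / x + y})
  (DM : forall x y, D (x * y) = D x * y + x * D y)
  (DP : forall j, (j <= n)%N -> D (P j) = (n%:R - j%:R) * P j.+1)
  (Dr : D r = 2%:R * s) (Ds : D s = t) (Dt : D t = 0).
Hypotheses (subJ : subspace J) (JD : forall x, J x -> J (D x)).
Hypotheses (subQ : subspace Q) (QD : forall x, Q x -> Q (D x)).
Hypothesis J_n2 : J (P 0 * t - 2%:R * (P 1 * s) + P 2 * r).
Local Notation S := (dif (fun i j => P i * P j)).
Hypothesis Q_2k : forall k, (0 < k)%N -> (2 * k <= n)%N -> Q (S (2 * k) 0 0).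

Lemma D0 : D 0 = 0.
Proof. by apply: (addrI (D 0)); rewrite -DD !addr0. Qed.
Lemma DN x : D (- x) = - D x.
Proof. by apply: (addrI (D x)); rewrite -DD !addrN D0. Qed.
Lemma DB x y : D (x - y) = D x - D y.
Proof. by rewrite DD DN. Qed.
Lemma Dnat m x : D (m%:R * x) = m%:R * D x.
Proof.
by elim: m => [|m IH]; [rewrite !mul0r D0|rewrite -natr1 !mulrDl !mul1r DD IH].
Qed.

Lemma subspace_nat_inv (U : A -> Prop) m x : subspace U -> (0 < m)%N ->
  U (m%:R * x) -> U x.
Proof.
move=> subU m0; rewrite mulr_natl -scaler_nat; apply: subspaceZ_inv => //.
by rewrite pnatr_eq0 -lt0n.
Qed.

(** [D] sends the relation of index [j] to [n - j - 2] times the next one, a nonzero multiple as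
    long as the next one exists. *)
Lemma J_Rj j : (j.+2 <= n)%N ->
  J (P j * t - 2%:R * (P j.+1 * s) + P j.+2 * r).
Proof.
elim: j => // j IH jn; have Jj := JD (IH (ltnW jn)).
apply: (@subspace_nat_inv _ (n - j - 2)) => //; first by lia.
move: Jj; congr J; rewrite DD DB Dnat !DM !DP ?Dr ?Ds ?Dt; try by lia.
have [e ->] : exists e, n = (j + 2 + e)%N by exists (n - j - 2)%N; lia.
rewrite (_ : (j + 2 + e - j - 2 = e)%N); last by lia.
rewrite !natrD -!natr1; ring.
Qed.

(** Under [D], differences of order [l] behave like products of two sequences for which [n] is
    replaced by [n - l]. *)
Lemma D_S l i j : (i + l <= n)%N -> (j + l <= n)%N -> D (S l i j) =
  (n%:R - l%:R - i%:R) * S l i.+1 j + (n%:R - l%:R - j%:R) * S l i j.+1.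
Proof.
elim: l i j => [|l IH] i j il jl.
  by rewrite /= DM !DP; try lia; rewrite !subr0; ring.
rewrite /= DB !IH; try by lia.
by rewrite -!natr1; ring.
Qed.

Lemma S_sym l i j : S l j i = (-1) ^+ l *: S l i j.
Proof. by apply: dif_sym => i' j'; apply: mulrC. Qed.

(* On an antidiagonal the first differences are constant modulo Q; being also
   antisymmetric, they vanish. *)
Lemma Q_first_difference k :
  (forall i j, (i + 2 * k.+1 <= n)%N -> (j + 2 * k.+1 <= n)%N -> Q (S (2 * k).+2 i j)) ->
  forall i j, (i + 2 * k < n)%N -> (j + 2 * k < n)%N -> Q (S (2 * k).+1 i j).
Proof.
move=> Q2; have step d i j : (i + d + 2 * k < n)%N -> (j + d + 2 * k < n)%N ->
    Q (S (2 * k).+1 i (j + d)%N - S (2 * k).+1 (i + d)%N j).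
  elim: d i j => [|d IH] i j id jd; first by rewrite !addn0 subrr; apply: subspace0.
  have -> : S (2 * k).+1 i (j + d.+1)%N - S (2 * k).+1 (i + d.+1)%N j =
      S (2 * k).+2 i (j + d)%N +
      (S (2 * k).+1 i.+1 (j + d)%N - S (2 * k).+1 (i.+1 + d)%N j).
    rewrite [S (2 * k).+2 i _]difS addnS addSnnS.
    by rewrite addrA subrK.
  by apply: subspaceD => //; [apply: Q2|apply: IH]; lia.
move=> i j; wlog leij : i j / (i <= j)%N.
  move=> W; case: (leqP i j) => [/W //|/ltnW/W W' ik jk].
  by rewrite S_sym; apply: subspaceZ => //; apply: W'.
move=> ik jk; have := step (j - i)%N i i; rewrite subnKC // [S _ j i]S_sym.
rewrite exprS exprM sqrrN expr1n expr1n mulr1 scaleN1r opprK -mulr2n -mulr_natl.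
by move=> Qj; apply: (@subspace_nat_inv _ 2) => //; apply: Qj; lia.
Qed.

(** Induction on [i + j], starting from the relation itself. Applying [D] gives a combination of the
    values at [(i + 1, j)] and [(i, j + 1)]; these differ by a difference of order [2 k + 1], known
    to lie in [Q], so a positive multiple of one of them is in [Q]. *)
Lemma Q_second_difference k : (0 < k)%N -> (2 * k <= n)%N ->
  (forall i j, (i + 2 * k < n)%N -> (j + 2 * k < n)%N -> Q (S (2 * k).+1 i j)) ->
  forall i j, (i + 2 * k <= n)%N -> (j + 2 * k <= n)%N -> Q (S (2 * k) i j).
Proof.
move=> k0 kn Q1 i j; have [w wE] : exists w, w = (i + j)%N by exists (i + j)%N.
elim: w i j wE => [|w IH] i j wE ik jk.
  have [-> ->] : i = 0%N /\ j = 0%N by lia.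
  exact: Q_2k.
(* Differences of even order are symmetric, and [i] and [j] are not both 0. *)
wlog i0 : i j wE ik jk / (0 < i)%N.
  move=> W; case: (posnP i) => [i0|]; last exact: W.
  by rewrite S_sym; apply: subspaceZ => //; apply: W; lia.
case: i i0 wE ik => // i _ wE ik.
have ij : w = (i + j)%N by lia.
have i2k : (i + 2 * k <= n)%N by lia.
have := QD (IH i j ij i2k jk).
rewrite D_S // => QS.
apply: (@subspace_nat_inv _ (2 * n - 4 * k - w)) => //; first by lia.
case: (ltnP (j + 2 * k) n) => jn.
  have := subspaceB subQ QS (subspaceZ subQ (n%:R - (2 * k)%:R - j%:R) (Q1 i j _ jn)).
  move=> /(_ ltac:(lia)); congr Q.
  have -> : (n%:R - (2 * k)%:R - j%:R : K) = (n - 2 * k - j)%:R by rewrite !natrB //; lia.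
  rewrite scaler_nat -[_ *+ (n - 2 * k - j)]mulr_natl [S (2 * k).+1 i j]difS.
  have -> : (n%:R - (2 * k)%:R - j%:R : A) = (n - 2 * k - j)%:R by rewrite !natrB //; lia.
  have -> : (n%:R - (2 * k)%:R - i%:R : A) = (n - 2 * k - i)%:R by rewrite !natrB //; lia.
  rewrite (_ : (2 * n - 4 * k - w = (n - 2 * k - j) + (n - 2 * k - i))%N); last by lia.
  by rewrite natrD; ring.
(* At the border [j = n - 2 k] no difference of order [2 k + 1] is available, but the coefficient of
   the unwanted term vanishes. *)
have ej : (j = n - 2 * k)%N by lia.
move: QS; congr Q.
have -> : (n%:R - (2 * k)%:R - j%:R : A) = 0 by rewrite ej natrB // subrr.
have -> : (n%:R - (2 * k)%:R - i%:R : A) = (n - 2 * k - i)%:R by rewrite !natrB //; lia.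
by rewrite mul0r addr0; congr (_%:R * _); lia.
Qed.

(** Descending induction on [k]: for [2 k > n] there are no indices left, and each step passes from
    order [2 k + 3] through [2 k + 2] to [2 k + 1]. The case [k = 0] is the exchange relation. *)
Lemma Q_exchange i j : (i < n)%N -> (j < n)%N -> Q (P i * P j.+1 - P i.+1 * P j).
Proof.
suff H k : forall i j, (i + 2 * k < n)%N -> (j + 2 * k < n)%N -> Q (S (2 * k).+1 i j).
  by move=> ik jk; apply: (H 0%N); lia.
have [e] : exists e, (n < 2 * (k + e))%N by exists n; lia.
elim: e k => [|e IH] k ke {}i {}j ik jk; first by lia.
apply: Q_first_difference => // i' j' ik' jk'.
have -> : ((2 * k).+2 = 2 * k.+1)%N by lia.
apply: Q_second_difference => //; first by lia.
by apply: IH; lia.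
Qed.

End Descent.

(** * Normal forms modulo the relations *)

Section Coefficients.
Variables (K : comNzRingType) (A : comNzRingType) (f0 : {rmorphism K -> A}).
Variables (u v w : A).
Local Notation C := {poly {poly {poly K}}}.

(** [C] is a polynomial ring in three variables, iterated so that the outermost one, which stands
    for rho_02, can later be replaced by composition of univariate polynomials; the innermost stands
    for rho_20. *)
Definition ev1 : {poly K} -> A := horner_morph (fun c => mulrC u (f0 c)).
HB.instance Definition _ := GRing.RMorphism.copy ev1 (horner_morph (fun c => mulrC u (f0 c))).
Definition ev2 : {poly {poly K}} -> A := horner_morph (fun c => mulrC v (ev1 c)).
HB.instance Definition _ := GRing.RMorphism.copy ev2 (horner_morph (fun c => mulrC v (ev1 c))).
Definition ev : C -> A := horner_morph (fun c => mulrC w (ev2 c)).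
HB.instance Definition _ := GRing.RMorphism.copy ev (horner_morph (fun c => mulrC w (ev2 c))).

Lemma ev1C c : ev1 c%:P = f0 c. Proof. exact: horner_morphC. Qed.
Lemma ev2C c : ev2 c%:P = ev1 c. Proof. exact: horner_morphC. Qed.
Lemma evC c : ev c%:P = ev2 c. Proof. exact: horner_morphC. Qed.

Lemma evN x : ev (- x) = - ev x. Proof. exact: rmorphN. Qed.
Lemma evM x y : ev (x * y) = ev x * ev y. Proof. exact: rmorphM. Qed.
Lemma ev0 : ev 0 = 0. Proof. exact: rmorph0. Qed.
Lemma evD x y : ev (x + y) = ev x + ev y. Proof. exact: rmorphD. Qed.
Lemma evB x y : ev (x - y) = ev x - ev y. Proof. exact: rmorphB. Qed.
Lemma evX x k : ev (x ^+ k) = ev x ^+ k. Proof. exact: rmorphXn. Qed.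
Lemma ev_nat k : ev k%:R = k%:R. Proof. exact: rmorph_nat. Qed.

Lemma ev_const c : ev c%:P%:P%:P = f0 c.
Proof. by rewrite evC ev2C ev1C. Qed.
Lemma ev_r : ev 'X%:P%:P = u.
Proof. by rewrite evC ev2C; apply: horner_morphX. Qed.
Lemma ev_s : ev 'X%:P = v.
Proof. by rewrite evC; apply: horner_morphX. Qed.
Lemma ev_t : ev 'X = w.
Proof. exact: horner_morphX. Qed.

End Coefficients.

Lemma poly3_ind (K : nzRingType) (T : {poly {poly {poly K}}} -> Prop) :
  (forall c, T c%:P%:P%:P) -> (forall x y, T x -> T y -> T (x + y)) ->
  (forall x, T x -> T (x * 'X%:P%:P)) -> (forall x, T x -> T (x * 'X%:P)) ->
  (forall x, T x -> T (x * 'X)) -> forall x, T x.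
Proof.
move=> TC TD Tr Ts Tt.
have T1 (p : {poly K}) : T p%:P%:P.
  elim/poly_ind: p => [|p c IH]; first exact: TC.
  by rewrite !(polyCD, polyCM); apply: TD => //; apply: Tr.
have T2 (p : {poly {poly K}}) : T p%:P.
  elim/poly_ind: p => [|p c IH]; first exact: T1.
  by rewrite polyCD polyCM; apply: TD => //; apply: Ts.
elim/poly_ind => [|p c IH]; first exact: T2.
by apply: TD => //; apply: Tt.
Qed.

Section NormalForm.
Variables (K : numFieldType) (A : comAlgType K) (n : nat).
Variables (P : nat -> A) (r s t : A) (J : A -> Prop).
Hypothesis n_ge2 : (2 <= n)%N.
Local Notation C := {poly {poly {poly K}}}.
Local Notation evA := (ev (in_alg A) r s t).
Hypothesis idJ : ideal J.
Hypothesis subJ : subspace J.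
Hypothesis J_R : forall j, (j.+2 <= n)%N ->
  J (P j * t - 2%:R * (P j.+1 * s) + P j.+2 * r).
Definition rho_mod (x : A) := exists c : C, J (x - evA c).
Hypothesis Q_exch : forall i j, (i < n)%N -> (j < n)%N ->
  rho_mod (P i * P j.+1 - P i.+1 * P j).

Lemma JM x y : J y -> J (x * y). Proof. by case: idJ => _ _; apply. Qed.

Lemma rho_mod_sub : subspace rho_mod.
Proof.
split; first by exists 0; rewrite rmorph0 subrr; apply: subspace0.
move=> a x y [c Jc] [c' Jc']; exists (a%:P%:P%:P * c + c').
rewrite rmorphD rmorphM /= ev_const /= mulr_algl opprD addrACA -scalerBr.
exact: subspaceZD.
Qed.

Lemma Q_swap i j i' j' : (i <= n)%N -> (j <= n)%N -> (i' <= n)%N -> (j' <= n)%N ->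
  (i + j = i' + j')%N -> rho_mod (P i * P j - P i' * P j').
Proof.
have subQ := rho_mod_sub.
wlog lei : i j i' j' / (i <= i')%N.
  move=> W ? ? ? ? e; case: (leqP i i') => [|/ltnW] l; first exact: W.
  by rewrite -opprB; apply: subspaceN => //; apply: W.
move=> i_n jn i'n j'n; have [d ed] : exists d, i' = (i + d)%N by exists (i' - i)%N; lia.
elim: d i' j' {lei} ed i'n j'n => [|d IH] i' j' ed i'n j'n e.
  have -> : i' = i by lia.
  have -> : j' = j by lia.
  by rewrite subrr; apply: subspace0.
case: i' ed i'n e => [|i'] ed i'n e; first by lia.
rewrite -(subrKA (P i' * P j'.+1)); apply: subspaceD => //.
  by apply: IH; lia.
by apply: Q_exch; lia.
Qed.

(* Pi d e is a product of d elements P i with sum of indices e; it depends on d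
   and e only, up to terms of lower degree in P. NF d x states that, modulo J,
   x is a combination of products Pi d' e, d' < d, over the algebra generated by
   r, s and t. *)
Fixpoint Pi d e : A :=
  if d is d'.+1 then P (minn e n) * Pi d' (e - minn e n)%N else 1.

Definition lin_form d (p : {poly C}) : A := \sum_(e < (d * n).+1) evA p`_e * Pi d e.

Fixpoint NF d (x : A) : Prop :=
  if d is d'.+1 then exists2 p : {poly C}, (size p <= (d' * n).+1)%N & NF d' (x - lin_form d' p)
  else J x.

Lemma lin_formD d p q : lin_form d (p + q) = lin_form d p + lin_form d q.
Proof.
rewrite /lin_form -big_split; apply: eq_bigr => e _ /=.
by rewrite coefD rmorphD mulrDl.
Qed.

Lemma lin_form0 d : lin_form d 0 = 0.
Proof. by rewrite /lin_form big1 // => e _; rewrite coef0 rmorph0 mul0r. Qed.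

Lemma lin_formZ d c p : lin_form d (c *: p) = evA c * lin_form d p.
Proof.
rewrite /lin_form mulr_sumr; apply: eq_bigr => e _.
by rewrite coefZ rmorphM mulrA.
Qed.

Lemma lin_form_sum d (I : Type) (l : seq I) (R : pred I) (f : I -> {poly C}) :
  lin_form d (\sum_(i <- l | R i) f i) = \sum_(i <- l | R i) lin_form d (f i).
Proof. exact: (big_morph _ (lin_formD d) (lin_form0 d)). Qed.

Lemma lin_form_mon d c e : (e <= d * n)%N -> lin_form d (c *: 'X^e) = evA c * Pi d e.
Proof.
move=> le; rewrite /lin_form (bigD1 (Ordinal (le : (e < (d * n).+1)%N))) //=.
rewrite [X in _ + X]big1 ?addr0 => [|e' ne].
  by rewrite coefZ coefXn eqxx mulr1.
rewrite coefZ coefXn -val_eqE /= in ne *.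
by rewrite (negPf ne) mulr0 rmorph0 mul0r.
Qed.

Lemma NF0 d : NF d 0.
Proof.
elim: d => [|d IH] /=; first exact: subspace0.
by exists 0; rewrite ?size_poly0 // lin_form0 subr0.
Qed.

Lemma NFD d x y : NF d x -> NF d y -> NF d (x + y).
Proof.
elim: d x y => [|d IH] x y /=; first exact: subspaceD.
move=> [p sp Np] [q sq Nq]; exists (p + q).
  by rewrite (leq_trans (size_polyD _ _)) // geq_max sp.
by rewrite lin_formD opprD addrACA; apply: IH.
Qed.

Lemma NFev d c x : NF d x -> NF d (evA c * x).
Proof.
elim: d x => [|d IH] x /=; first exact: JM.
move=> [p sp Np]; exists (c *: p); first exact: leq_trans (size_scale_leq _ _) sp.
by rewrite lin_formZ -mulrBr; apply: IH.
Qed.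

Lemma NFN d x : NF d x -> NF d (- x).
Proof. by move=> Nx; rewrite -mulN1r -(rmorph1 evA) -rmorphN; apply: NFev. Qed.

Lemma NFB d x y : NF d x -> NF d y -> NF d (x - y).
Proof. by move=> Nx Ny; apply: NFD => //; apply: NFN. Qed.

Lemma NF_sum d (I : Type) (l : seq I) (R : pred I) (f : I -> A) :
  (forall i, R i -> NF d (f i)) -> NF d (\sum_(i <- l | R i) f i).
Proof. by move=> Nf; apply: big_ind => //; [apply: NF0|apply: NFD]. Qed.

Lemma NFS d x : NF d x -> NF d.+1 x.
Proof. by move=> Nx; exists 0; rewrite ?size_poly0 // lin_form0 subr0. Qed.

Lemma NF_le d d' x : (d <= d')%N -> NF d x -> NF d' x.
Proof.
move=> le Nx; rewrite -(subnK le); elim: (d' - d)%N => // e IH.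
by rewrite addSn; apply: NFS.
Qed.

Lemma NF_J d x : J x -> NF d x.
Proof. by move=> Jx; apply: (@NF_le 0). Qed.

Lemma NF_evPi d c e : (e <= d * n)%N -> NF d.+1 (evA c * Pi d e).
Proof.
move=> le; exists (c *: 'X^e).
  by rewrite (leq_trans (size_scale_leq _ _)) // size_polyXn.
by rewrite lin_form_mon // subrr; apply: NF0.
Qed.

Lemma NF_QPi d x e : rho_mod x -> (e <= d * n)%N -> NF d.+1 (x * Pi d e).
Proof.
move=> [c Jc] le; rewrite -[x](subrK (evA c)) mulrDl; apply: NFD.
  by apply: NF_J; rewrite mulrC; apply: JM.
exact: NF_evPi.
Qed.

(** Both halves are proved together, each step using both induction hypotheses. Multiplying
    [Pi d.+1 e] by [P j], one first exchanges [j] with the leading index so that the latter becomes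
    [minn (e + j) n]; the error lies in K[rho] modulo [J] and so costs two factors [P]. *)
Lemma Pi_mulP_mul d :
  (forall j e, (j <= n)%N -> (e <= d * n)%N -> NF d (P j * Pi d e - Pi d.+1 (e + j)%N))
  /\ (forall j x, (j <= n)%N -> NF d x -> NF d.+1 (P j * x)).
Proof.
elim: d => [|d [IHA IHM]].
  split=> [j e jn|j x jn Nx]; last by apply: NFS; apply: JM.
  rewrite leqn0 => /eqP ->; rewrite /= add0n (minn_idPl jn) subrr.
  exact: subspace0.
have M j x : (j <= n)%N -> NF d.+1 x -> NF d.+2 (P j * x).
  move=> jn [p sp Np].
  rewrite -[x](subrK (lin_form d p)) mulrDr; apply: NFD.
    by apply: NFS; apply: IHM.
  rewrite /lin_form mulr_sumr; apply: NF_sum => e _; rewrite mulrCA.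
  have len : (e <= d * n)%N by have := ltn_ord e; rewrite ltnS.
  rewrite -[P j * _](subrK (Pi d.+1 (e + j)%N)) mulrDr; apply: NFD.
    by apply: NFS; apply: NFS; apply: NFev; apply: IHA.
  by apply: NF_evPi; rewrite mulSn addnC leq_add.
split=> // j e jn le.
pose k := minn e n; pose k' := minn (e + j) n.
rewrite -[Pi d.+1 e]/(P k * Pi d (e - k)%N) -[Pi d.+2 _]/(P k' * Pi d.+1 (e + j - k')%N).
have le' : (e - k <= d * n)%N by rewrite mulSn in le; rewrite /k; lia.
have e1 : (e + j - k' = e - k + (j + k - k'))%N by rewrite /k /k'; lia.
have kn : (j + k - k' <= n)%N by rewrite /k /k'; lia.
have -> : P j * (P k * Pi d (e - k)%N) - P k' * Pi d.+1 (e + j - k')%N =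
  (P j * P k - P k' * P (j + k - k')%N) * Pi d (e - k)%N +
  P k' * (P (j + k - k')%N * Pi d (e - k)%N - Pi d.+1 (e - k + (j + k - k'))%N).
  by rewrite -e1; ring.
apply: NFD; last by apply: IHM; [rewrite /k'; lia|apply: IHA].
apply: NF_QPi => //; apply: Q_swap => //; rewrite ?/k ?/k'; lia.
Qed.

Lemma NF_mulP d j x : (j <= n)%N -> NF d x -> NF d.+1 (P j * x).
Proof. by have [_] := Pi_mulP_mul d; apply. Qed.

Lemma Pi_mulP d j e : (j <= n)%N -> (e <= d * n)%N ->
  NF d (P j * Pi d e - Pi d.+1 (e + j)%N).
Proof. by have [H _] := Pi_mulP_mul d; apply: H. Qed.

(** Multiply a relation [J_R] by a product of one factor less: each of its three terms is a [Pi d]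
    up to fewer factors. The cap [n - 2] on the leading index leaves room for [j + 2]. *)
Lemma NF_relation d e : (e.+2 <= d * n)%N ->
  NF d (t * Pi d e - 2%:R * s * Pi d e.+1 + r * Pi d e.+2).
Proof.
case: d => [|d]; first by rewrite mul0n.
rewrite mulSn => le; pose j := minn e (n - 2); pose e' := (e - j)%N.
have le' : (e' <= d * n)%N by rewrite /e' /j; lia.
have j2 : (j.+2 <= n)%N by rewrite /j; lia.
have D i : (i <= 2)%N -> NF d (P (j + i)%N * Pi d e' - Pi d.+1 (e + i)%N).
  move=> i2; rewrite (_ : (e + i = e' + (j + i))%N); last by rewrite /e' /j; lia.
  by apply: Pi_mulP; lia.
have := D 0%N isT; have := D 1%N isT; have := D 2%N isT.
rewrite !addn0 !addn1 !addn2 => D2 D1 D0; apply: NFS.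
have -> : t * Pi d.+1 e - 2%:R * s * Pi d.+1 e.+1 + r * Pi d.+1 e.+2 =
  Pi d e' * (P j * t - 2%:R * (P j.+1 * s) + P j.+2 * r)
  - evA 'X * (P j * Pi d e' - Pi d.+1 e)
  + evA (2%:R * 'X%:P) * (P j.+1 * Pi d e' - Pi d.+1 e.+1)
  - evA 'X%:P%:P * (P j.+2 * Pi d e' - Pi d.+1 e.+2).
  by rewrite rmorphM rmorph_nat /= ev_r ev_s ev_t; ring.
by apply: NFB; [apply: NFD; [apply: NFB; [apply: NF_J; apply: JM; apply: J_R|]|]|]; try apply: NFev.
Qed.

End NormalForm.

Lemma mon_mul_trinomial (R : comNzRingType) (a u v w : R) e :
  a *: 'X^e * (u%:P - v *: 'X + w *: 'X^2) =
  (a * u) *: 'X^e - (a * v) *: 'X^(e.+1) + (a * w) *: 'X^(e.+2).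
Proof. by rewrite -!mul_polyC !polyCM !exprS expr0; ring. Qed.

(** * Divisibility by the quadric *)

Section Quadric.
Variable K : numFieldType.
Local Notation C := {poly {poly {poly K}}}.

Definition cst (c : K) : C := c%:P%:P%:P.

(* The variables of C stand for rho_20, rho_11 (inner ones) and either rho_02 or
   T; the quadric rho_02 - 2 rho_11 T + rho_20 T^2 vanishes at T = x_2 / x_1. *)
Definition quad_root : C := 2%:R * 'X%:P * 'X - 'X%:P%:P * 'X^2.

Definition quadric : {poly C} :=
  ('X : C)%:P - (2%:R * 'X%:P) *: 'X + 'X%:P%:P *: 'X^2.

Lemma quadricE : quadric = ('X : C)%:P - map_poly polyC quad_root.
Proof.
rewrite /quadric /quad_root rmorphB !rmorphM /= rmorph_nat !map_polyC /= !map_polyX.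
rewrite -!mul_polyC polyCM (polyC_natr {poly {poly {poly K}}} 2); ring.
Qed.

Lemma size_quadric : size quadric = 3.
Proof.
rewrite /quadric addrC size_polyDl size_scale ?size_polyXn ?polyC_eq0 ?polyX_eq0 //.
rewrite (leq_ltn_trans (size_polyD _ _)) // size_polyN.
rewrite gtn_max (leq_ltn_trans (size_polyC_leq1 _)) //.
by rewrite (leq_ltn_trans (size_scale_leq _ _)) // size_polyX.
Qed.

(** In [{poly C}] the constant ['X%:P] is rho_02 and the variable ['X] is T, while [quad_root]
    writes T as the outer variable of [C]; [map_poly polyC] renames the latter into the former.
    Modulo the quadric, rho_02 equals [quad_root]. *)
Lemma quadric_mod (c : C) : exists g : {poly C},
  c%:P = map_poly polyC (c \Po quad_root) + g * quadric.
Proof.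
elim/poly_ind: c => [|c a [g IH]].
  by exists 0; rewrite comp_poly0 polyC0 map_poly0 mul0r addr0.
rewrite comp_polyD comp_polyM comp_polyX comp_polyC.
exists (g * 'X%:P + map_poly polyC (c \Po quad_root)).
rewrite polyCD polyCM IH rmorphD rmorphM /= map_polyC /= quadricE; ring.
Qed.

(** Reduce every coefficient by [quadric_mod]: the remainders add up to the hypothesis with its
    variable renamed, that is, to 0. *)
Lemma quadric_dvd (p : {poly C}) N : (size p <= N)%N ->
  \sum_(e < N) (p`_e \Po quad_root) * 'X^e = 0 -> exists G, p = G * quadric.
Proof.
move=> sp H; have [g gE] := boolp.choice quadric_mod.
exists (\sum_(e < N) g p`_e * 'X^e).
transitivity (\sum_(e < N) (p`_e)%:P * 'X^e).
  rewrite [LHS](_ : p = \poly_(e < N) p`_e); last first.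
    by apply/polyP => e; rewrite coef_poly; case: ltnP => // le; rewrite nth_default // (leq_trans sp).
  by rewrite poly_def; apply: eq_bigr => e _; rewrite mul_polyC.
have H' : \sum_(e < N) map_poly polyC (p`_e \Po quad_root) * 'X^e = 0 :> {poly C}.
  transitivity (map_poly polyC (\sum_(e < N) (p`_e \Po quad_root) * 'X^e)).
    by rewrite rmorph_sum; apply: eq_bigr => e _; rewrite rmorphM /= map_polyXn.
  by rewrite H map_poly0.
transitivity (\sum_(e < N) map_poly polyC (p`_e \Po quad_root) * 'X^e +
              (\sum_(e < N) g p`_e * 'X^e) * quadric); last by rewrite H' add0r.
rewrite mulr_suml -big_split /=; apply: eq_bigr => e _.
by rewrite {1}gE mulrDl mulrAC.
Qed.

Lemma const_roots (H : {poly C}) :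
  (forall z, z != 0 -> H.[cst z] = 0) -> H = 0.
Proof.
move=> Hz; apply/eqP; apply: contraT => H0.
pose rs : seq C := [seq cst i.+1%:R | i <- iota 0 (size H)].
have := @max_poly_roots _ H rs H0; rewrite size_map size_iota ltnn => -> //.
  by apply/allP => _ /mapP[i _ ->]; apply/eqP/Hz; rewrite pnatr_eq0.
rewrite map_inj_in_uniq ?iota_uniq // => i j _ _ /polyC_inj/polyC_inj/polyC_inj.
by move/eqP; rewrite eqr_nat => /eqP[].
Qed.

End Quadric.

Section KernelDescent.
Variables (K : numFieldType) (A : comAlgType K) (n : nat).
Variables (P : nat -> A) (r s t : A) (J : A -> Prop).
Hypothesis n_ge2 : (2 <= n)%N.
Local Notation C := {poly {poly {poly K}}}.
Local Notation evA := (ev (in_alg A) r s t).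
Hypothesis idJ : ideal J.
Hypothesis subJ : subspace J.
Hypothesis J_R : forall j, (j.+2 <= n)%N ->
  J (P j * t - 2%:R * (P j.+1 * s) + P j.+2 * r).
Hypothesis Q_exch : forall i j, (i < n)%N -> (j < n)%N ->
  rho_mod r s t J (P i * P j.+1 - P i.+1 * P j).
Local Notation Pi := (Pi n P).
Local Notation NF := (NF n P r s t J).
Local Notation lin_form := (lin_form n P r s t).

(** [chi z] stands for evaluation at the point of parameter [z]. Up to the factor z^n the value of
    [P j] is T^j, with a correction of order z^(2n), [U j], due to the y coordinates. *)
Variables (chi : K -> {rmorphism A -> C}) (U : nat -> C).
Hypotheses (chi_c : forall z a, chi z (a%:A) = cst a)
  (chi_r : forall z, z != 0 -> chi z r = 'X%:P%:P)
  (chi_s : forall z, z != 0 -> chi z s = 'X%:P)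
  (chi_t : forall z, z != 0 -> chi z t = quad_root K)
  (chi_P : forall z j, z != 0 -> (j <= n)%N ->
     chi z (P j) * cst z ^+ n = 'X^j + cst z ^+ (2 * n) * U j)
  (chi_J : forall z x, z != 0 -> J x -> chi z x = 0).

Lemma chi_ev z c : z != 0 -> chi z (evA c) = c \Po quad_root K.
Proof.
move=> z0; elim/poly3_ind: c => [a|x y IHx IHy|x IH|x IH|x IH].
- by rewrite ev_const chi_c comp_polyC.
- by rewrite [evA _]rmorphD [chi z _]rmorphD IHx IHy comp_polyD.
- by rewrite [evA _]rmorphM [chi z _]rmorphM IH /= ev_r chi_r // comp_polyM comp_polyC.
- by rewrite [evA _]rmorphM [chi z _]rmorphM IH /= ev_s chi_s // comp_polyM comp_polyC.
by rewrite [evA _]rmorphM [chi z _]rmorphM IH /= ev_t chi_t // comp_polyM comp_polyX.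
Qed.

Lemma ev_trinomial c : [/\ evA (c * 'X) = evA c * t,
  evA (- (c * (2%:R * 'X%:P))) = - (evA c * (2%:R * s)) & evA (c * 'X%:P%:P) = evA c * r].
Proof.
by split; rewrite ?evN ?evM ?ev_nat ?ev_r ?ev_s ?ev_t.
Qed.

(* The value of z^(d n) chi z (Pi d e) as a polynomial in z; its constant term is
   the monomial 'X^e. *)
Fixpoint PiZ d e : {poly C} :=
  if d is d'.+1 then
    (('X^(minn e n))%:P + (U (minn e n))%:P * 'X^(2 * n)) * PiZ d' (e - minn e n)%N
  else 1.

Lemma chi_Pi z d e : z != 0 -> chi z (Pi d e) * cst z ^+ (d * n) = (PiZ d e).[cst z].
Proof.
move=> z0; elim: d e => [|d IH] e.
  by rewrite mul0n expr0 mulr1 [LHS]rmorph1 hornerC.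
rewrite [Pi _ _]/= [PiZ _ _]/= rmorphM mulSn exprD mulrACA hornerM -IH.
rewrite chi_P ?geq_minr //; congr (_ * _).
by rewrite hornerD hornerM hornerXn !hornerC [X in _ + X]mulrC.
Qed.

Lemma PiZ0 d e : (e <= d * n)%N -> (PiZ d e).[0] = 'X^e.
Proof.
elim: d e => [|d IH] e; first by rewrite leqn0 => /eqP ->; rewrite hornerC.
rewrite mulSn => le; rewrite [PiZ _ _]/= hornerM IH; last by lia.
rewrite hornerD hornerM hornerXn !hornerC expr0n muln_eq0 /= gtn_eqF //; last by lia.
by rewrite mulr0 addr0 -exprD subnKC // geq_minl.
Qed.

Definition top_poly d (p : {poly C}) : {poly C} :=
  \sum_(e < (d * n).+1) (p`_e \Po quad_root K)%:P * PiZ d e.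

Lemma chi_lin_form z d p : z != 0 ->
  chi z (lin_form d p) * cst z ^+ (d * n) = (top_poly d p).[cst z].
Proof.
move=> z0; rewrite rmorph_sum mulr_suml horner_sum; apply: eq_bigr => e _.
by rewrite rmorphM -mulrA chi_Pi // chi_ev // hornerM hornerC.
Qed.

(** [NF d] involves at most [d - 1] factors [P], whose poles are cleared by z^((d-1)n); the spare
    z^n makes these terms vanish at z = 0. *)
Lemma chi_NF d x : NF d x -> exists H : {poly C}, forall z, z != 0 ->
  chi z x * cst z ^+ (d * n) = cst z ^+ n * H.[cst z].
Proof.
elim: d x => [|d IH] x /=.
  by move=> Jx; exists 0 => z z0; rewrite chi_J // mul0r horner0 mulr0.
move=> [p sp /IH[H HE]]; exists (top_poly d p + 'X^n * H) => z z0.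
rewrite mulSn exprD mulrCA; congr (_ * _).
rewrite -[x in LHS](subrK (lin_form d p)) rmorphD mulrDl HE // chi_lin_form //.
by rewrite hornerD hornerM hornerXn addrC.
Qed.

Lemma chi_kernel d x : NF d x -> (forall z, z != 0 -> chi z x = 0) -> J x.
Proof.
elim: d x => [|d IH] x //= [p sp Np] chi0; apply: IH => //.
have [H HE] := chi_NF Np.
(* A polynomial that vanishes at all nonzero constants is zero, so it may be evaluated at z = 0,
   where [chi] itself makes no sense and only the leading terms remain. *)
have top0 : top_poly d p + 'X^n * H = 0.
  apply: const_roots => z z0; rewrite hornerD hornerM hornerXn -HE // -chi_lin_form //.
  by rewrite -mulrDl -rmorphD addrC subrK chi0 // mul0r.
have [G pG] : exists G, p = G * quadric K.
  apply: (quadric_dvd sp); have /(congr1 (fun q : {poly C} => q.[0])) := top0.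
  rewrite hornerD hornerM hornerXn horner0 expr0n gtn_eqF ?mul0r ?addr0; last by lia.
  rewrite horner_sum => T; rewrite -[RHS]T; apply: eq_bigr => e _.
  rewrite hornerM hornerC PiZ0 //.
  by have := ltn_ord e; rewrite ltnS.
suff NL : NF d (lin_form d p) by rewrite -[x](subrK (lin_form d p)); apply: NFD.
have [G0|Gn0] := eqVneq G 0; first by rewrite pG G0 mul0r lin_form0; apply: NF0.
(* [G] has degree at most [d n - 2], so every shift of the quadric that occurs in [G * quadric] is
   within the range of [NF_relation]. *)
have sG : (size G + 2 <= (d * n).+1)%N.
  move: sp; rewrite pG size_mul // ?size_quadric ?addn3 ?addn2 //.
  by rewrite -size_poly_gt0 size_quadric.
rewrite pG -[G in G * _](coefK G) poly_def mulr_suml lin_form_sum.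
apply: NF_sum => // e _; have eG := ltn_ord e.
have -> : G`_e *: 'X^e * quadric K = (G`_e * 'X) *: 'X^e -
    (G`_e * (2%:R * 'X%:P)) *: 'X^(e.+1) + (G`_e * 'X%:P%:P) *: 'X^(e.+2).
  exact: mon_mul_trinomial.
rewrite !lin_formD -scaleNr !lin_form_mon; try by lia.
have NR : NF d (t * Pi d e - 2%:R * s * Pi d e.+1 + r * Pi d e.+2).
  by apply: NF_relation => //; lia.
have [-> -> ->] := ev_trinomial G`_e; have := NFev idJ G`_e NR.
move: (evA _) (Pi d e) (Pi d e.+1) (Pi d e.+2) => g a b c.
by rewrite mulrDr mulrBr mulNr !mulrA.
Qed.

End KernelDescent.

(** * The kernel of phi *)

Section ToricPoint.
Variables (K : numClosedFieldType) (n : nat).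
Hypothesis n_ge3 : (3 <= n)%N.
Local Notation F := (F K n 2).
Local Notation Pm := (Pm K n 0).
Local Notation Rm := (Rm K n 0).
Local Notation i0 := (i0 0).
Local Notation i1 := (i1 0).
Variables (E : comNzRingType) (f : {rmorphism K -> E}) (zi zc r s T : E).
Hypothesis zz : zi * zc = 1.

Definition toric_rho (a : 'X_{1..2}) : E :=
  match a i1 with 0 => r | 1 => s | _ => 2%:R * s * T - r * T ^+ 2 end.

Definition toric_pi (b : 'X_{1..2}) : E :=
  zi ^+ n * T ^+ b i1 + zc ^+ n * (r ^+ (n - b i1) * (2%:R * s - r * T) ^+ b i1).

Definition toric_eval : F -> E := Feval f toric_rho toric_pi.
HB.instance Definition _ := GRing.RMorphism.copy toric_eval (Feval f toric_rho toric_pi).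

(* The point x = zi (1, T), y = zc (r, 2 s - r T), at which rho_20 = r,
   rho_11 = s and rho_02 = 2 s T - r T^2. *)
Definition toric_point (k : 'I_(2 + 2)) : E :=
  match split k with
  | inl i => if i == i0 then zi else zi * T
  | inr i => if i == i0 then zc * r else zc * (2%:R * s - r * T)
  end.

(** Each q has degree 1 in x and in y, so [zi] and [zc] cancel in it, whereas p keeps [zi ^+ n] and
    [zc ^+ n]. It suffices to compare generators. *)
Lemma toric_phi x : toric_eval x = mmap f toric_point (phi x).
Proof.
have ex0 : mmap f toric_point (x_ K i0) = zi.
  by rewrite /x_ mmapX mmap1U /toric_point (unsplitK (inl _ i0 : 'I_2 + 'I_2)).
have ex1 : mmap f toric_point (x_ K i1) = zi * T.
  by rewrite /x_ mmapX mmap1U /toric_point (unsplitK (inl _ i1 : 'I_2 + 'I_2)).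
have ey0 : mmap f toric_point (y_ K i0) = zc * r.
  by rewrite /y_ mmapX mmap1U /toric_point (unsplitK (inr _ i0 : 'I_2 + 'I_2)).
have ey1 : mmap f toric_point (y_ K i1) = zc * (2%:R * s - r * T).
  by rewrite /y_ mmapX mmap1U /toric_point (unsplitK (inr _ i1 : 'I_2 + 'I_2)).
have MM p q : mmap f toric_point (p * q) =
    mmap f toric_point p * mmap f toric_point q by exact: rmorphM.
have MX p e : mmap f toric_point (p ^+ e) = mmap f toric_point p ^+ e by exact: rmorphXn.
elim/F2_ind: x => [c|x y IHx IHy|j x j2 IHx|j x jn IHx].
- by rewrite phiC mmapC [LHS]mmapC.
- by rewrite phiD mmapD -IHx -IHy; apply: rmorphD.
- rewrite phiM MM -IHx; transitivity (toric_eval (Rm j) * toric_eval x); first exact: rmorphM.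
  congr (_ * _); transitivity (toric_rho (two_mon 0 2 j)); first exact: Feval_Rm.
  rewrite /toric_rho two_mon_i1.
  have [->|[->|->]] : j = 0%N \/ j = 1%N \/ j = 2%N by lia.
  + by rewrite (phi_Rm0 K 0 n_ge3) MM ex0 ey0 mulrA zz mul1r.
  + rewrite (phi_Rm1 K 0 n_ge3) mmapZ mmapD !MM ex0 ex1 ey0 ey1.
    transitivity (f 2%:R^-1 * f 2%:R * (zi * zc) * s).
      by rewrite -rmorphM mulVf ?pnatr_eq0 // rmorph1 zz !mul1r.
    by rewrite rmorph_nat; ring.
  rewrite (phi_Rm2 K 0 n_ge3) MM ex1 ey1.
  transitivity (zi * zc * (2%:R * s * T - r * T ^+ 2)); first by rewrite zz mul1r.
  by ring.
rewrite phiM MM -IHx; transitivity (toric_eval (Pm j) * toric_eval x); first exact: rmorphM.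
congr (_ * _); transitivity (toric_pi (two_mon 0 n j)); first exact: Feval_Pm.
have -> : phi (Pm j) = x_ K i0 ^+ (n - j) * x_ K i1 ^+ j
    + y_ K i0 ^+ (n - j) * y_ K i1 ^+ j :> KV K 2 by exact: phi_Pm.
rewrite /toric_pi two_mon_i1 mmapD 2!MM 4!MX ex0 ex1 ey0 ey1.
have [i ->] : exists i, n = (i + j)%N by exists (n - j)%N; lia.
by rewrite addnK !exprMn !exprD; ring.
Qed.

End ToricPoint.

Lemma rmorph_mulVf (K : fieldType) (E : comNzRingType) (f : {rmorphism K -> E}) z :
  z != 0 -> f z^-1 * f z = 1.
Proof. by move=> z0; rewrite -rmorphM mulVf ?rmorph1. Qed.

Section KernelOfPhi.
Variables (K : numClosedFieldType) (n : nat).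
Hypothesis n_ge3 : (3 <= n)%N.
Local Notation F := (F K n 2).
Local Notation Pm := (Pm K n 0).
Local Notation Rm := (Rm K n 0).
Local Notation C := {poly {poly {poly K}}}.
Local Notation evF := (ev (in_alg F) (Rm 0) (Rm 1) (Rm 2)).

HB.instance Definition _ := GRing.RMorphism.copy (@cst K) (polyC \o (polyC \o @polyC K)).

Definition chi (z : K) : {rmorphism F -> C} :=
  @toric_eval K n C (@cst K) (cst z^-1) (cst z) 'X%:P%:P 'X%:P 'X.

Lemma cst_inv (z : K) : z != 0 -> cst z^-1 * cst z = 1.
Proof. exact: (rmorph_mulVf (@cst K)). Qed.

Lemma chi_kernel_phi z x : z != 0 -> phi x = 0 -> chi z x = 0.
Proof.
move=> z0 x0; transitivity (mmap (@cst K) (toric_point (cst z^-1) (cst z) 'X%:P%:P 'X%:P 'X) (phi x)).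
  by apply: toric_phi => //; apply: cst_inv.
by rewrite x0 mmap0.
Qed.

Lemma chi_rhos z : [/\ chi z (Rm 0) = 'X%:P%:P, chi z (Rm 1) = 'X%:P
  & chi z (Rm 2) = quad_root K].
Proof. by split; rewrite [LHS]Feval_Rm // /toric_rho two_mon_i1. Qed.

Lemma chi_pi z j : z != 0 -> (j <= n)%N ->
  chi z (Pm j) * cst z ^+ n = 'X^j + cst z ^+ (2 * n) *
    (('X%:P%:P) ^+ (n - j) * (2%:R * 'X%:P - 'X%:P%:P * 'X) ^+ j).
Proof.
move=> z0 jn; transitivity (toric_pi n (cst z^-1) (cst z) 'X%:P%:P 'X%:P 'X (two_mon 0 n j) * cst z ^+ n).
  by congr (_ * _); apply: Feval_Pm.
rewrite /toric_pi two_mon_i1; have := cst_inv z0.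
move: (cst z^-1) (cst z) (_ ^+ (n - j) * _) ('X^j) => a b u v ab.
rewrite mul2n -addnn exprD mulrDl mulrAC -exprMn ab expr1n mul1r.
by congr (_ + _); apply: mulrAC.
Qed.

Variable J : F -> Prop.
Hypotheses (idJ : ideal J) (J_phi : forall x, J x -> phi x = 0).
Hypothesis JG : forall g x, g \in unitmx -> J x -> J (GL_act_F g x).
Hypothesis J_n2 : J (rel_n2 K n 0).
Hypothesis J_2k : forall k, (0 < k)%N -> (2 * k <= n)%N -> J (rel_2k K n 0 k).

Lemma ideal_subspace : subspace J.
Proof.
case: idJ => J0 JD JM; split=> // c u v Ju Jv; apply: JD => //.
by rewrite -mul_mpolyC; apply: JM.
Qed.

(** Both conditions are carried along together because the Leibniz rule for [low (x * y)] involves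
    the factors themselves; they hold on all of K[rho]. *)
Definition ev_low_stable (x : F) :=
  (exists c, x = evF c) /\ (exists c, low x = evF c).

Lemma ev_lowM x y : ev_low_stable x -> ev_low_stable y -> ev_low_stable (x * y).
Proof.
move=> [[a ->] [a' ea]] [[b ->] [b' eb]]; split; first by exists (a * b); rewrite evM.
by exists (a' * b + a * b'); rewrite lowM ea eb evD !evM.
Qed.

Lemma ev_lowD x y : ev_low_stable x -> ev_low_stable y -> ev_low_stable (x + y).
Proof.
move=> [[a ->] [a' ea]] [[b ->] [b' eb]]; split; first by exists (a + b); rewrite evD.
by exists (a' + b'); rewrite lowD ea eb evD.
Qed.

Lemma ev_low_const c : ev_low_stable (evF c%:P%:P%:P).
Proof.
split; first by exists c%:P%:P%:P.
have l1 : low (1 : F) = 0 by rewrite -[1 : F]mpolyC1; apply: lowC.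
exists 0; symmetry; transitivity (0 : F); first exact: ev0.
by rewrite ev_const; symmetry; transitivity (c *: low (1 : F));
  [apply: lowZ|rewrite l1 scaler0].
Qed.

Lemma ev_low_Rm j : (j <= 2)%N -> ev_low_stable (Rm j).
Proof.
move=> j2; have [->|[->|->]] : j = 0%N \/ j = 1%N \/ j = 2%N by lia.
- split; first by exists 'X%:P%:P; rewrite ev_r.
  by exists (2%:R * 'X%:P); rewrite low_Rm0 evM ev_nat ev_s scaler_nat mulr_natl.
- split; first by exists 'X%:P; rewrite ev_s.
  by exists 'X; rewrite low_Rm1 ev_t.
split; first by exists 'X; rewrite ev_t.
by exists 0; rewrite low_Rm2 //; symmetry; apply: ev0.
Qed.

Lemma low_ev c : ev_low_stable (evF c).
Proof.
elim/poly3_ind: c => [c|x y Sx Sy|x Sx|x Sx|x Sx]; first exact: ev_low_const.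
- by rewrite evD; apply: ev_lowD.
- by rewrite evM; apply: ev_lowM; [exact: Sx|rewrite ev_r; exact: ev_low_Rm].
- by rewrite evM; apply: ev_lowM; [exact: Sx|rewrite ev_s; exact: ev_low_Rm].
by rewrite evM; apply: ev_lowM; [exact: Sx|rewrite ev_t; exact: ev_low_Rm].
Qed.

Local Notation Q := (rho_mod (Rm 0) (Rm 1) (Rm 2) J).

Lemma rho_mod_low x : Q x -> Q (low x).
Proof.
move=> [c Jc]; have [_ [c' ec]] := low_ev c; exists c'.
by rewrite -ec -lowB; apply: low_closed => //; apply: ideal_subspace.
Qed.

Lemma low_PmE j : (j <= n)%N -> low (Pm j) = (n%:R - j%:R) * Pm j.+1.
Proof. by move=> jn; rewrite low_Pm1 // scalerBl mulrBl !scaler_nat !mulr_natl. Qed.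

(** The difference is twice the relation plus an element of K[rho], namely twice its rho part. *)
Lemma rho_mod_dif k : (0 < k)%N -> (2 * k <= n)%N ->
  Q (dif (fun i j => Pm i * Pm j) (2 * k) 0 0).
Proof.
move=> k0 kn; have := rel_2kE K 0 n_ge3 k0 kn.
set S := \sum_(j < (2 * k).+1) _ => e.
have eS : S = 2%:R *: rel_2k K n 0 k + (2%:R * 4%:R ^+ k) *:
    (Rm 0 ^+ (n - 2 * k) * (Rm 1 ^+ 2 - Rm 0 * Rm 2) ^+ k).
  by rewrite e -scalerA -scalerDr subrK scalerA mulfV ?scale1r ?pnatr_eq0.
rewrite dif_closed -/S; exists ((2%:R * 4%:R ^+ k)%:P%:P%:P *
   ('X%:P%:P ^+ (n - 2 * k) * ('X%:P ^+ 2 - 'X%:P%:P * 'X) ^+ k)).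
have ev1 a u v l : evF (a%:P%:P%:P * (u ^+ l * v ^+ k)) = a *: (evF u ^+ l * evF v ^+ k).
  by rewrite evM evM ev_const evX evX /= mulr_algl.
have ev2 u v w : evF (u ^+ 2 - v * w) = evF u ^+ 2 - evF v * evF w.
  by rewrite evB evX evM.
rewrite ev1 ev2 ev_r ev_s ev_t.
rewrite eS addrK.
by apply: subspaceZ; [apply: ideal_subspace|apply: J_2k].
Qed.

Lemma kernel_sub_ideal x : phi x = 0 -> J x.
Proof.
have subJ := ideal_subspace.
have n2 : (2 <= n)%N by lia.
have JD y : J y -> J (low y) by apply: low_closed.
have J0 : J (Pm 0 * Rm 2 - 2%:R * (Pm 1 * Rm 1) + Pm 2 * Rm 0).
  by move: J_n2; rewrite /rel_n2 scaler_nat mulr_natl.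
have low0 : low (Rm 0) = 2%:R * Rm 1 by rewrite low_Rm0 // scaler_nat mulr_natl.
have JR := J_Rj n2 (@lowD K n) (@lowM K n) low_PmE low0 (low_Rm1 K n) (low_Rm2 K n) subJ JD J0.
have QE := Q_exchange n2 (@lowD K n) (@lowM K n) low_PmE
  (rho_mod_sub (Rm 0) (Rm 1) (Rm 2) subJ) rho_mod_low rho_mod_dif.
move=> x0; suff [d Nd] : exists d, NF n Pm (Rm 0) (Rm 1) (Rm 2) J d x.
  apply: (@chi_kernel K F n Pm (Rm 0) (Rm 1) (Rm 2) J n2 idJ subJ JR QE chi
    (fun j => ('X%:P%:P) ^+ (n - j) * (2%:R * 'X%:P - 'X%:P%:P * 'X) ^+ j) _ _ _ _ _ _ d x Nd).
  - move=> z a; transitivity (cst a * chi z 1); first exact: FevalZ.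
    transitivity (cst a * 1); last exact: mulr1.
    by congr (_ * _); apply: rmorph1.
  - by move=> z _; have [] := chi_rhos z.
  - by move=> z _; have [] := chi_rhos z.
  - by move=> z _; have [] := chi_rhos z.
  - exact: chi_pi.
  - by move=> z y z0 Jy; apply: chi_kernel_phi => //; apply: J_phi.
  by move=> z z0; apply: chi_kernel_phi.
(* Every element has a normal form: multiplication by a rho keeps [d], multiplication by a pi raises
   it by one. *)
elim/F2_ind: x {x0} => [c|x y [d Nx] [d' Ny]|j x j2 [d Nx]|j x jn [d Nx]].
- exists 1%N; have := @NF_evPi K F n Pm (Rm 0) (Rm 1) (Rm 2) J subJ 0 (c%:P%:P%:P) 0 isT.
  by rewrite ev_const mulr1 /= -mul_mpolyC mulr1.
- exists (maxn d d'); apply: NFD => //.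
    by apply: NF_le Nx => //; apply: leq_maxl.
  by apply: NF_le Ny => //; apply: leq_maxr.
- have [[c ->] _] := ev_low_Rm j2.
  by exists d; apply: NFev.
by exists d.+1; apply: NF_mulP.
Qed.

End KernelOfPhi.

(** * Minimality and directness *)

Section Grading.
Variables (K : numClosedFieldType) (n : nat).
Hypothesis n_ge3 : (3 <= n)%N.
Local Notation F := (F K n 2).
Local Notation Rm := (Rm K n 0).
Local Notation evF := (ev (in_alg F) (Rm 0) (Rm 1) (Rm 2)).
Local Notation act := (@GL_act_F K n 2).

Lemma quad_root_size : (1 < size (quad_root K))%N.
Proof.
rewrite /quad_root addrC size_polyDl; rewrite size_polyN mul_polyC size_scale ?size_polyXn ?polyC_eq0 ?polyX_eq0 //.
by rewrite -[2%:R]polyC_natr -polyCM mul_polyC (leq_ltn_trans (size_scale_leq _ _)) // size_polyX.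
Qed.

(** At z = 1, [chi] turns [evF c] into the composition of [c] with [quad_root], which has positive
    degree in T; a nonzero [c] would keep a nonzero leading coefficient. *)
Lemma rho_independent c : phi (evF c) = 0 -> c = 0.
Proof.
move=> ph; have E : chi n 1 (evF c) = c \Po quad_root K.
  apply: (@chi_ev K F (Rm 0) (Rm 1) (Rm 2) (@chi K n)); last exact: oner_neq0.
  - move=> z a; transitivity (cst a * chi n z 1); first exact: FevalZ.
    transitivity (cst a * 1); last exact: mulr1.
    by congr (_ * _); apply: rmorph1.
  - by move=> z _; have [] := chi_rhos n z.
  - by move=> z _; have [] := chi_rhos n z.
  by move=> z _; have [] := chi_rhos n z.
apply/eqP; rewrite -lead_coef_eq0 -(mulIr_eq0 _ (mulIf (x := lead_coef (quad_root K) ^+ (size c).-1) _)).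
  rewrite -lead_coef_comp ?quad_root_size // -E lead_coef_eq0; apply/eqP.
  by apply: chi_kernel_phi => //; apply: oner_neq0.
rewrite expf_neq0 // lead_coef_eq0 -size_poly_gt0; exact: ltnW quad_root_size.
Qed.

(* Multiplying every variable of F by 'X makes the coefficients of degp x the
   components of x for the grading in which all variables have degree 1. *)
Definition hom_rho (a : 'X_{1..2}) : {poly F} := (rho K n a)%:P * 'X.
Definition hom_pi (b : 'X_{1..2}) : {poly F} := (pi_ K n b)%:P * 'X.
Definition degC (c : K) : {poly F} := (c%:MP)%:P.
HB.instance Definition _ := GRing.RMorphism.copy degC (polyC \o @mpolyC _ K).

Definition degp : F -> {poly F} := Feval degC hom_rho hom_pi.
HB.instance Definition _ := GRing.RMorphism.copy degp (Feval degC hom_rho hom_pi).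

Lemma degpD x y : degp (x + y) = degp x + degp y. Proof. exact: rmorphD. Qed.
Lemma degpM x y : degp (x * y) = degp x * degp y. Proof. exact: rmorphM. Qed.
Lemma degpC c : degp c%:MP = (c%:MP)%:P.
Proof. by rewrite /degp /Feval /Fhom mmapC. Qed.
Lemma degpZ c x : degp (c *: x) = (c%:MP)%:P * degp x.
Proof. exact: FevalZ. Qed.
Lemma degp_rho a : mdeg a = 2 -> degp (rho K n a) = (rho K n a)%:P * 'X.
Proof. exact: Feval_rho. Qed.
Lemma degp_pi b : mdeg b = n -> degp (pi_ K n b) = (pi_ K n b)%:P * 'X.
Proof. exact: Feval_pi. Qed.

Lemma degp_coefZD k c x y :
  (degp (c *: x + y))`_k = c *: (degp x)`_k + (degp y)`_k.
Proof. by rewrite degpD degpZ coefD coefCM mul_mpolyC. Qed.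

Lemma degp_coefD k x y : (degp (x + y))`_k = (degp x)`_k + (degp y)`_k.
Proof. by rewrite degpD coefD. Qed.

Definition form_of d (x : F) := degp x = x%:P * 'X^d.

Lemma form_ZD d c x y : form_of d x -> form_of d y -> form_of d (c *: x + y).
Proof.
rewrite /form_of degpD degpZ => -> ->.
by rewrite mulrA -polyCM -mulrDl mul_mpolyC polyCD.
Qed.

Lemma form_subspace d : subspace (form_of d).
Proof.
split; last by move=> c x y; apply: form_ZD.
by rewrite /form_of polyC0 mul0r; apply: rmorph0.
Qed.

Lemma formM d d' x y : form_of d x -> form_of d' y -> form_of (d + d') (x * y).
Proof.
rewrite /form_of degpM => -> ->.
by rewrite polyCM exprD; ring.
Qed.

Lemma formX d x k : form_of d x -> form_of (d * k) (x ^+ k).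
Proof.
move=> hx; elim: k => [|k IH]; last by rewrite exprS mulnS; apply: formM.
by rewrite muln0 /form_of !expr0 mulr1 polyC1; apply: rmorph1.
Qed.

Lemma act_linear g v : form_of 1 (act g 'X_(enum_rank v)).
Proof.
case: v => [a|b].
  have a2 : mdeg a = 2 by apply/eqP; case: a.
  rewrite -rhoE GL_act_F_rho // /lift_q; apply: subspace_sum => [|c _].
    exact: (form_subspace 1).
  apply: subspaceZ; first exact: (form_subspace 1).
  by apply: degp_rho; apply/eqP; case: c.
have bn : mdeg b = n by apply/eqP; case: b.
rewrite -piE GL_act_F_pi // /lift_p; apply: subspace_sum => [|c _].
  exact: (form_subspace 1).
apply: subspaceZ; first exact: (form_subspace 1).
by apply: degp_pi; apply/eqP; case: c.
Qed.

Lemma degp_X v : degp 'X_(enum_rank v) = ('X_(enum_rank v))%:P * 'X.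
Proof.
case: v => [a|b]; first by rewrite -rhoE; apply: degp_rho; apply/eqP; case: a.
by rewrite -piE; apply: degp_pi; apply/eqP; case: b.
Qed.

Lemma degp_coef_linM k u x : form_of 1 u ->
  (degp (u * x))`_k = if k == 0%N then 0 else u * (degp x)`_k.-1.
Proof.
by rewrite /form_of degpM expr1 => ->; rewrite mulrAC coefMX coefCM.
Qed.

Lemma degp_act g x k : (degp (act g x))`_k = act g (degp x)`_k.
Proof.
elim/F_ind: x k => [c|x y IHx IHy|v x IHx] k.
- rewrite GL_act_FC degpC coefC; case: eqP => _; first by rewrite GL_act_FC.
  by symmetry; apply: raddf0.
- have e1 : (degp (act g (x + y)))`_k = (degp (act g x))`_k + (degp (act g y))`_k.
    by rewrite GL_act_FD; exact: degp_coefD.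
  apply: (etrans e1); symmetry.
  apply: (etrans (congr1 (act g) (degp_coefD k x y))).
  apply: (etrans (GL_act_FD g _ _)).
  exact: (congr2 +%R (esym (IHx k)) (esym (IHy k))).
have e1 : (degp (act g ('X_(enum_rank v) * x)))`_k =
    (if k == 0 then 0 else act g 'X_(enum_rank v) * (degp (act g x))`_k.-1).
  by rewrite GL_act_FM; exact: degp_coef_linM (act_linear g v).
apply: (etrans e1); symmetry.
apply: (etrans (congr1 (act g) (degp_coef_linM k x (degp_X v)))).
case: eqP => _; first exact: raddf0.
apply: (etrans (GL_act_FM g _ _)).
exact: (congr2 *%R erefl (esym (IHx k.-1))).
Qed.

Lemma act_ev g c : exists c', act g (evF c) = evF c'.
Proof.
have subE : subspace (fun x : F => exists c', x = evF c').
  split; first by exists 0; symmetry; apply: ev0.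
  move=> a _ _ [u ->] [v ->]; exists (a%:P%:P%:P * u + v).
  by rewrite evD evM ev_const /= mulr_algl.
have Rim j : (j <= 2)%N -> exists c', act g (Rm j) = evF c'.
  move=> j2; rewrite GL_act_F_rho; last exact: mdeg_two_mon.
  rewrite /lift_q; apply: (subspace_sum subE) => c' _; apply: (subspaceZ subE).
  have [ec le] := two_monP (eqP (valP c')).
  by have [[c2 e] _] := ev_low_Rm K n_ge3 le; exists c2; apply: etrans e; exact: (congr1 (fun a => rho K n a) ec).
have M u v c1 c2 : act g u = evF c1 -> act g v = evF c2 ->
    exists c', act g (u * v) = evF c'.
  by move=> e1 e2; exists (c1 * c2); rewrite GL_act_FM e1 e2 evM.
elim/poly3_ind: c => [c|x y [x' ex] [y' ey]|x [x' ex]|x [x' ex]|x [x' ex]].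
- exists c%:P%:P%:P; rewrite ev_const; transitivity (c *: act g 1); first exact: GL_act_FZ.
  by congr (_ *: _); apply: rmorph1.
- by exists (x' + y'); rewrite [in LHS]evD GL_act_FD ex ey [in RHS]evD.
- by have [c1 e1] := Rim 0%N isT; rewrite evM; apply: M ex _; rewrite ev_r; exact: e1.
- by have [c1 e1] := Rim 1%N isT; rewrite evM; apply: M ex _; rewrite ev_s; exact: e1.
by have [c1 e1] := Rim 2%N isT; rewrite evM; apply: M ex _; rewrite ev_t; exact: e1.
Qed.

End Grading.

Section QuadraticPart.
Variables (K : fieldType) (m : nat) (A : comAlgType K).
Variables (act : 'M[K]_m -> A -> A) (gr : nat -> A -> A) (aug : A -> K).
Variable E : A -> Prop.
Hypothesis grZD : forall k c x y, gr k (c *: x + y) = c *: gr k x + gr k y.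
Hypothesis actZD : forall g c x y, act g (c *: x + y) = c *: act g x + act g y.
Hypothesis gr_act : forall k g x, gr k (act g x) = act g (gr k x).
Hypothesis E_submod : GL_submodule act E.

(** [E] will be K[rho] and [gr k] the component of degree [k] in the variables of F. The condition
    defines a submodule, so it passes from the relations to the modules they generate. *)
Definition relation_like (x : A) :=
  [/\ gr 0 x = 0, gr 1 x = 0 & E (x - gr 2 x)].

Lemma gr_0 k : gr k 0 = 0.
Proof. exact: (lin0 (grZD k)). Qed.

Lemma relation_like_submod : GL_submodule act relation_like.
Proof.
have [[E0 EZD] Eact] := E_submod.
split; first split.
- by split; rewrite !gr_0 // subr0.
- move=> a x y [x0 x1 Ex] [y0 y1 Ey].
  split; rewrite grZD ?x0 ?x1 ?y0 ?y1 ?scaler0 ?addr0 //.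
  by rewrite opprD addrACA -scalerBr; apply: EZD.
move=> g x gu [x0 x1 Ex]; have a0 : act g 0 = 0 := lin0 (actZD g).
split; rewrite gr_act ?x0 ?x1 //.
have -> : act g x - act g (gr 2 x) = act g (x - gr 2 x).
  by rewrite addrC -scaleN1r -actZD scaleN1r addrC.
exact: Eact.
Qed.

Hypothesis gr_id : forall x b, gr 0 x = 0 -> gr 1 x = 0 ->
  [/\ gr 0 (b * x) = 0, gr 1 (b * x) = 0 & gr 2 (b * x) = aug b *: gr 2 x].
Variable I : A -> Prop.
Hypothesis EI0 : forall x, E x -> I x -> x = 0.

(** In lowest degree 2, multiplication by [b] acts as the scalar [aug b], so elements whose
    quadratic part comes from [S'] form an ideal [J]. It contains all of [I]; hence [x] in [S] has
    the quadratic part of some [s] in [S'], and [x - s] lies in both [E] and [I]. *)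
Lemma minimal_of_quadratic_part (S : A -> Prop) :
  subspace S -> incl S relation_like -> incl S I ->
  (forall a, ideal_generated S a <-> I a) -> minimal_generating_subspace I S.
Proof.
move=> subS Srel SI genS; split=> // S' subS' S'S genS' x Sx.
pose J y := [/\ gr 0 y = 0, gr 1 y = 0 & exists2 s, S' s & gr 2 y = gr 2 s].
have idJ : ideal J.
  split.
  - by split; rewrite ?gr_0 //; exists 0; rewrite ?gr_0 //; case: subS'.
  - move=> a b [a0 a1 [s Ss es]] [b0 b1 [t St et]].
    rewrite -[a]scale1r; split; rewrite grZD ?a0 ?a1 ?scaler0 ?add0r //.
    by exists (1 *: s + t); [case: subS' => _; apply | rewrite grZD es et].
  move=> a b [b0 b1 [s Ss es]]; have [c0 c1 c2] := gr_id a b0 b1; split=> //.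
  exists (aug a *: s); first exact: subspaceZ.
  by rewrite c2 es -[aug a *: s]addr0 grZD gr_0 addr0.
have S'J : incl S' J.
  by move=> s Ss; have [s0 s1 _] := Srel s (S'S s Ss); split=> //; exists s.
have Ix : ideal_generated S' x by apply/genS'/SI.
have [_ _ [s Ss es]] := Ix J idJ S'J.
suff -> : x = s by [].
have Sd : S (x - s) by apply: subspaceB => //; apply: S'S.
apply/eqP; rewrite -subr_eq0; apply/eqP/EI0; last exact: SI.
have [_ _] := Srel _ Sd; suff -> : gr 2 (x - s) = 0 by rewrite subr0.
by rewrite addrC -scaleN1r grZD es scaleN1r addNr.
Qed.

End QuadraticPart.

(** * Directness of the sum by weights *)

Section Directness.
Variables (K : numFieldType) (m : nat) (W : lmodType K) (act : 'M[K]_m -> W -> W).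
Hypothesis actZD : forall g c x y, act g (c *: x + y) = c *: act g x + act g y.

(** With exponents [i + 1] instead of [i], the weight of a word of length [d] is [d + wt x]. The
    degree must contribute, since (n, 2) and (2n-2, 2) have the same second row. *)
Definition weight_torus (t : K) : 'M[K]_m := diag_mx (\row_i t ^+ i.+1).

(** The weight decomposition of [x], with weights below [N] and none below [c]; [v k] is the
    component of weight [k]. *)
Definition weights_in (N c : nat) (x : W) := exists2 v : nat -> W,
  forall k, (k < c)%N -> v k = 0 &
  forall t, t != 0 -> act (weight_torus t) x = \sum_(k < N) t ^+ k *: v k.

Lemma weights_in_subspace N c : subspace (weights_in N c).
Proof.
split=> [|a x y [v v0 ev] [v' v'0 ev']].
  exists (fun=> 0) => // t t0; rewrite (lin0 (actZD _)).
  by rewrite big1 // => k _; rewrite scaler0.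
exists (fun k => a *: v k + v' k) => [k kc|t t0].
  by rewrite v0 // v'0 // scaler0 addr0.
rewrite actZD ev // ev' // scaler_sumr -big_split; apply: eq_bigr => k _ /=.
by rewrite scalerDr !scalerA [a * _]mulrC.
Qed.

Lemma weights_in_le N c c' x : (c' <= c)%N -> weights_in N c x -> weights_in N c' x.
Proof. by move=> cc' [v v0 ev]; exists v => // k kc; apply: v0; apply: leq_trans cc'. Qed.

Lemma weight_vector_eq0 N c x : (c < N)%N -> weights_in N c.+1 x ->
  (forall t, t != 0 -> act (weight_torus t) x = t ^+ c *: x) -> x = 0.
Proof.
move=> cN [v v0 ev] ex.
have subT : subspace (fun w : W => w = 0).
  by split=> // a u w -> ->; rewrite scaler0 addr0.
have := @vandermonde_subspace K W _ 'X N (fun k => v k - (k == c)%:R *: x) subT.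
rewrite polyX_eq0 => /(_ isT) H.
have /H/(_ c cN) : forall t, ~~ root 'X t ->
    \sum_(k < N) t ^+ k *: (v k - (k == c :> nat)%:R *: x) = 0.
  move=> t; rewrite rootX => t0; under eq_bigr => k _ do rewrite scalerBr.
  rewrite sumrB -ev // ex // (bigD1 (Ordinal cN)) //= eqxx scale1r.
  rewrite big1 ?addr0 ?subrr // => k kc.
  by rewrite (_ : (k == c :> nat) = false) ?scale0r ?scaler0 //; apply/negbTE.
by rewrite eqxx v0 // scale1r sub0r => /eqP; rewrite oppr_eq0 => /eqP.
Qed.

(* The generator of U i has a weight which does not occur in the U j, i < j. *)
Lemma direct_sum_of_weights (s N : nat) (r : 'I_s -> W) (e : 'I_s -> nat) :
  let U i := GL_generated act (r i) in
  (forall i, GL_irreducible act (U i)) ->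
  (forall i j : 'I_s, (i < j)%N -> (e i < e j)%N) -> (forall i, (e i < N)%N) ->
  (forall i t, t != 0 -> act (weight_torus t) (r i) = t ^+ e i *: r i) ->
  (forall i x, U i x -> weights_in N (e i) x) ->
  direct_sum U.
Proof.
move=> U irr emon eN er eU u Uu su i.
have subU j : GL_submodule act (U j) by case: (irr j).
have [k] := ubnP i; elim: k i => // k IH i; rewrite ltnS => ik.
apply: boolp.contrapT => ui0.
(* [T] is the sum of the later modules. By induction it contains [- u i], so irreducibility puts the
   generator [r i] into [T], all of whose weights exceed [e i]. *)
pose T x := exists2 v : 'I_s -> W,
  forall j, U j (v j) /\ ((j <= i)%N -> v j = 0) & x = \sum_j v j.
have GLT : GL_submodule act T.
  split; first split.
  - exists (fun=> 0); last by rewrite big1.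
    by move=> j; split=> //; apply: subspace0; case: (subU j).
  - move=> a _ _ [v Uv ->] [w Uw ->]; exists (fun j => a *: v j + w j).
      move=> j; have [Uvj vj0] := Uv j; have [Uwj wj0] := Uw j.
      split; first by case: (subU j) => -[_ H] _; apply: H.
      by move=> ji; rewrite vj0 // wj0 // scaler0 addr0.
    by rewrite scaler_sumr -big_split.
  move=> g _ gu [v Uv ->]; exists (fun j => act g (v j)).
    move=> j; have [Uvj vj0] := Uv j; split; first by case: (subU j) => _; apply.
    by move=> ji; rewrite vj0 // (lin0 (actZD g)).
  exact: (lin_sum (actZD g)).
have [_ _ irri] := irr i.
have GLT' : GL_submodule act (fun x => U i x /\ T x).
  have [[Ui0 UiZD] Uig] := subU i; have [[T0 TZD] Tg] := GLT.
  split; first split=> //.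
  - by move=> a x y [? ?] [? ?]; split; [apply: UiZD|apply: TZD].
  by move=> g x gu [? ?]; split; [apply: Uig|apply: Tg].
have Tui : T (- u i).
  exists (fun j : 'I_s => if (j <= i)%N then 0 else u j : W).
    move=> j; case: leqP => ji; split=> //.
    by case: (subU j) => -[].
  have : \sum_j u j - u i = - u i by rewrite su sub0r.
  move=> <-; rewrite (bigD1 i) //= addrAC subrr add0r [RHS](bigD1 i) //= leqnn add0r.
  apply: eq_bigr => j ji; case: leqP => // lji; apply: IH.
  by apply: leq_trans ik; rewrite ltn_neqAle lji andbT.
have [U0|Ui] := irri _ GLT' (fun x H => proj1 H).
  apply: ui0; apply: U0; split; first exact: Uu.
  by rewrite -[u i]opprK; apply: subspaceN => //; case: GLT.
have [_ [v Uv er0]] := Ui (r i) (fun _ _ Vr => Vr).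
have r0 : r i = 0.
  apply: (weight_vector_eq0 (eN i)); last exact: er.
  rewrite er0; apply: subspace_sum; first exact: weights_in_subspace.
  move=> j _; have [Uvj vj0] := Uv j.
  case: (leqP j i) => ji; first by rewrite vj0 //; apply: subspace0; apply: weights_in_subspace.
  by apply: weights_in_le (eU j _ Uvj); apply: emon.
apply: ui0; apply: (Uu i (fun x => x = 0)) => //; split; first split=> //.
  by move=> a x y -> ->; rewrite scaler0 addr0.
by move=> g x _ ->; apply: lin0 (actZD g).
Qed.

End Directness.

Section RelationWeights.
Variables (K : numClosedFieldType) (n : nat).
Hypothesis n_ge3 : (3 <= n)%N.
Local Notation act := (@GL_act_F K n 2).

Lemma actZD g c (x y : F K n 2) : act g (c *: x + y) = c *: act g x + act g y.
Proof. by rewrite GL_act_FD GL_act_FZ. Qed.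

Section Model.
Variables (a b : nat).
Hypothesis leba : (b <= a)%N.
Local Notation d := (sumn [:: a; b]).
Local Notation word := {ffun 'I_d -> 'I_2}.

Lemma tensor_act_torus t (z : tensor K 2 [:: a; b]) (x : word) :
  tensor_act (weight_torus 2 t) z x = t ^+ (d + wt x) * z x.
Proof.
rewrite tensor_act_diag; congr (_ * _).
under eq_bigr => k _ do rewrite mxE exprS.
by rewrite big_split prodr_const card_ord exprD -prodrXr.
Qed.

Lemma wt_le (x : word) : (wt x <= d)%N.
Proof.
rewrite -[X in (_ <= X)%N]card_ord -sum1_card; apply: leq_sum => k _.
by rewrite -ltnS ltn_ord.
Qed.

Variable psi : word -> F K n 2.
Hypothesis psiE : equivariant_words (psi : {ffun 'I_d -> 'I_2} -> F K n 2).

Lemma Psi_torus t z : act (weight_torus 2 t) (Psi psi z) =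
  \sum_(x : word) (t ^+ (d + wt x) * z x) *: psi x.
Proof.
by rewrite Psi_act //; apply: eq_bigr => x _; rewrite tensor_act_torus.
Qed.

(** An antisymmetric tensor has no coordinates of weight below [b], because each column of two boxes
    needs two distinct letters. *)
Lemma Psi_weights_in N z : (2 * d < N)%N -> schur_module z ->
  weights_in act N (d + b) (Psi psi z).
Proof.
move=> dN sz; have az := schur_antisym leba sz.
exists (fun k => \sum_(x : word | (d + wt x)%N == k) z x *: psi x) => [k kd|t _].
  apply: big1 => x /eqP ek; rewrite (antisym_wt_lt leba az) ?scale0r //.
  by move: kd; rewrite -ek ltn_add2l.
have lt (x : word) : (d + wt x < N)%N.
  by apply: leq_ltn_trans dN; rewrite mul2n -addnn leq_add2l; exact: wt_le.
rewrite Psi_torus (partition_big (fun x => Ordinal (lt x)) xpredT) //=.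
apply: eq_bigr => k _; rewrite scaler_sumr; apply: eq_big => [x|x /eqP <-].
  by rewrite -val_eqE.
by rewrite scalerA.
Qed.

Lemma Psi_hwv_torus t : act (weight_torus 2 t) (Psi psi (hwv K 0 a b)) =
  t ^+ (d + b) *: Psi psi (hwv K 0 a b).
Proof.
rewrite Psi_torus scaler_sumr; apply: eq_bigr => x _; rewrite scalerA.
have [->|wx] := eqVneq (wt x) b; first by [].
by rewrite hwv_wt // !mulr0.
Qed.

End Model.

Lemma relation_weights lam : lam \in Lambda n ->
  (forall t, act (weight_torus 2 t) (R_ K n lam) =
     t ^+ (sumn lam + nth 0 lam 1)%N *: R_ K n lam) /\
  (forall x, GL_generated act (R_ K n lam) x ->
     weights_in act (4 * n).+1 (sumn lam + nth 0 lam 1)%N x).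
Proof.
move=> lamL; have [a [b [psi [elam [leba psiE n0 _]]]]] := relation_Psi K n_ge3 0 lamL.
rewrite F_incl_id => <-.
(* Torus weights of words of length [d] are at most [2 d], whence the bound [4 n]. *)
have dn : (sumn [:: a; b] <= 2 * n)%N.
  by rewrite -elam; case: (LambdaP n_ge3 lamL) => [->|[k kn ->]] /=; lia.
rewrite elam; split=> [t|x]; first exact: Psi_hwv_torus.
case/(modelP (PsiZD psi)) => [g t _|z sz <-]; first exact: Psi_act.
by apply: Psi_weights_in => //; lia.
Qed.

Local Notation r := [seq R_ K n lam | lam <- Lambda n].
Local Notation U := (fun i : 'I_(size r) => GL_generated act r`_i).

Lemma Lambda_nth i : (i < size r)%N -> nth [::] (Lambda n) i \in Lambda n /\
  r`_i = R_ K n (nth [::] (Lambda n) i).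
Proof. by rewrite size_map => il; rewrite mem_nth // (nth_map [::]). Qed.

(** The weights are n + 4 < 2n + 2 < 2n + 4 < ..., the first inequality being n >= 3. *)
Lemma Lambda_weight_mono i j : (i < j < size (Lambda n))%N ->
  let e k := (sumn (nth [::] (Lambda n) k) + nth 0 (nth [::] (Lambda n) k) 1)%N in
  (e i < e j <= 4 * n)%N.
Proof.
rewrite /= size_map size_iota; case: j => // j; rewrite ltnS => /andP[ij].
rewrite ltnS => jn /=.
rewrite (nth_map 0%N) ?size_iota // nth_iota //=.
case: i ij => [|i] ij /=; first by lia.
rewrite (nth_map 0%N) ?size_iota ?nth_iota //=; lia.
Qed.

Lemma Lambda_irreducible i : GL_irreducible act (U i).
Proof.
have [lamL ->] := Lambda_nth (ltn_ord i).
have /= [_ _ +] := relation_module K n_ge3 0 lamL; by rewrite F_incl_id.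
Qed.

Lemma Lambda_direct : direct_sum U.
Proof.
apply: (direct_sum_of_weights actZD (s := size r) (N := (4 * n).+1)
  (r := fun i : 'I_(size r) => r`_i)
  (e := fun i : 'I_(size r) => (sumn (nth [::] (Lambda n) i) + nth 0 (nth [::] (Lambda n) i) 1)%N)).
- exact: Lambda_irreducible.
- move=> i j ij; have := @Lambda_weight_mono i j; rewrite ij /=.
  by have := ltn_ord j; rewrite [X in (_ < X)%N]size_map => -> /(_ isT)/andP[].
- move=> i; rewrite ltnS.
  have il := ltn_ord i; rewrite [X in (_ < X)%N]size_map in il.
  have [lamL _] := Lambda_nth (ltn_ord i).
  by case: (LambdaP n_ge3 lamL) => [->|[k kn ->]] /=; lia.
- move=> i t _; have [lamL ->] := Lambda_nth (ltn_ord i).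
  by case: (relation_weights lamL).
move=> i x; have [lamL ->] := Lambda_nth (ltn_ord i).
by case: (relation_weights lamL) => _; apply.
Qed.

End RelationWeights.

Lemma coefM_order2 (R : nzRingType) (p q : {poly R}) : q`_0 = 0 -> q`_1 = 0 ->
  [/\ (p * q)`_0 = 0, (p * q)`_1 = 0 & (p * q)`_2 = p`_0 * q`_2].
Proof.
move=> q0 q1; rewrite !coefM !big_ord_recl !big_ord0 /= /bump /=.
by rewrite !subn0 !subnn q0 q1 !mulr0 !addr0.
Qed.

Section Minimality.
Variables (K : numClosedFieldType) (n : nat).
Hypothesis n_ge3 : (3 <= n)%N.
Local Notation F := (F K n 2).
Local Notation Pm := (Pm K n 0).
Local Notation Rm := (Rm K n 0).
Local Notation evF := (ev (in_alg F) (Rm 0) (Rm 1) (Rm 2)).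
Local Notation act := (@GL_act_F K n 2).

Definition gr k (x : F) : F := (degp x)`_k.
Definition aug (x : F) : K := mcoeff 0%MM (gr 0 x).
Definition rho_subalgebra (x : F) := exists c, x = evF c.

Lemma grZD k c x y : gr k (c *: x + y) = c *: gr k x + gr k y.
Proof. exact: degp_coefZD. Qed.

Lemma gr_act k g x : gr k (act g x) = act g (gr k x).
Proof. exact: degp_act. Qed.

Lemma gr0_const x : gr 0 x = (aug x)%:MP.
Proof.
suff [c e] : exists c, gr 0 x = c%:MP by rewrite /aug e mcoeffC eqxx mulr1.
elim/F_ind: x => [c|x y [c ec] [c' ec']|v x IHx].
- exists c; apply: (etrans (congr1 (fun p : {poly F} => p`_0) (degpC n c))).
  by rewrite coefC eqxx.
- exists (c + c'); rewrite mpolyCD -ec -ec'; exact: degp_coefD.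
exists 0; rewrite mpolyC0; exact: (degp_coef_linM 0 x (degp_X K v)).
Qed.

Lemma gr_mul x b : gr 0 x = 0 -> gr 1 x = 0 ->
  [/\ gr 0 (b * x) = 0, gr 1 (b * x) = 0 & gr 2 (b * x) = aug b *: gr 2 x].
Proof.
move=> x0 x1; have [e0 e1 e2] := coefM_order2 (degp b) x0 x1.
rewrite /gr degpM; split; [exact: e0|exact: e1|].
apply: (etrans e2); rewrite -mul_mpolyC; exact: (congr2 *%R (gr0_const b) erefl).
Qed.

Lemma rho_subalgebra_submod : GL_submodule act rho_subalgebra.
Proof.
split; first split.
- by exists 0; symmetry; apply: ev0.
- move=> a _ _ [u ->] [v ->]; exists (a%:P%:P%:P * u + v).
  by rewrite evD evM ev_const /= mulr_algl.
by move=> g _ _ [c ->]; apply: act_ev.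
Qed.

Lemma form_Rm j : (j <= 2)%N -> form_of 1 (Rm j).
Proof. by move=> j2; apply: degp_rho; apply: mdeg_two_mon. Qed.
Lemma form_Pm j : (j <= n)%N -> form_of 1 (Pm j).
Proof. by move=> jn; apply: degp_pi; apply: mdeg_two_mon. Qed.

Lemma form_gr d k x : form_of d x -> gr k x = if k == d then x else 0.
Proof.
rewrite /form_of /gr => ->; rewrite coefCM coefXn.
by case: eqP => _; [apply: mulr1|apply: mulr0].
Qed.

Lemma rel_n2_like : relation_like gr rho_subalgebra (rel_n2 K n 0).
Proof.
have h : form_of 2 (rel_n2 K n 0).
  have sub2 := form_subspace K n 2.
  apply: (subspaceD sub2); last by apply: (@formM K n 1 1); [apply: form_Pm; lia|exact: form_Rm].
  apply: (subspaceB sub2); first by apply: (@formM K n 1 1); [exact: form_Pm|exact: form_Rm].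
  apply: (subspaceZ sub2); apply: (@formM K n 1 1); [apply: form_Pm; lia|exact: form_Rm].
split; [exact: (form_gr 0 h)|exact: (form_gr 1 h)|].
rewrite (form_gr 2 h) eqxx subrr; exists 0; symmetry; exact: ev0.
Qed.

(** The pi part has degree 2 and the rho part degree (n - 2k) + 2k = n > 2, so the former is the
    whole quadratic part. *)
Lemma rel_2k_like k : (0 < k)%N -> (2 * k <= n)%N ->
  relation_like gr rho_subalgebra (rel_2k K n 0 k).
Proof.
move=> k0 kn; rewrite /rel_2k.
set A := (X in X - _); set B := (X in A - X).
have hA : form_of 2 A.
  have sub2 := form_subspace K n 2.
  apply: (subspaceD sub2).
    by apply: (subspaceZ sub2); apply: (@formX K n 1); apply: form_Pm; lia.
  rewrite big_nat; apply: (subspace_sum sub2) => j /andP[_ jk].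
  by apply: (subspaceZ sub2); apply: (@formM K n 1 1); apply: form_Pm; lia.
have hB : form_of n B.
  apply: (subspaceZ (form_subspace K n n)).
  have e : (1 * (n - 2 * k) + 2 * k = n)%N by lia.
  rewrite -[X in form_of X _]e; apply: formM; first exact: formX (form_Rm _).
  apply: formX; apply: (subspaceB (form_subspace K n 2)).
    exact: formX (form_Rm _).
  exact: formM (form_Rm _) (form_Rm _).
have [c eB] : rho_subalgebra B.
  exists ((4%:R ^+ k)%:P%:P%:P *
   ('X%:P%:P ^+ (n - 2 * k) * ('X%:P ^+ 2 - 'X%:P%:P * 'X) ^+ k)).
  have ev1 a u v l : evF (a%:P%:P%:P * (u ^+ l * v ^+ k)) = a *: (evF u ^+ l * evF v ^+ k).
    by rewrite evM evM ev_const evX evX /= mulr_algl.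
  have ev2 u v w : evF (u ^+ 2 - v * w) = evF u ^+ 2 - evF v * evF w.
    by rewrite evB evX evM.
  by rewrite ev1 ev2 ev_r ev_s ev_t.
move: A B hA hB eB => A B hA hB eB.
have g j : gr j (A - B) = (if j == 2 then A else 0) - (if j == n then B else 0).
  rewrite -(form_gr j hA) -(form_gr j hB) addrC -scaleN1r [RHS]addrC -[- gr j B]scaleN1r.
  exact: grZD.
split.
- by apply: (etrans (g 0%N)); rewrite ifN ?subrr //; lia.
- by apply: (etrans (g 1%N)); rewrite ifN ?subrr //; lia.
exists (- c); rewrite evN -eB.
apply: (etrans (congr1 (fun y => A - B - y) (g 2%N))).
by rewrite eqxx ifN ?subr0 ?[A - B]addrC ?addrK //; lia.
Qed.

Lemma rho_subalgebra_kernel x : rho_subalgebra x -> ker_phi x -> x = 0.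
Proof.
move=> [c ->] /(rho_independent n_ge3) ->; exact: ev0.
Qed.

Local Notation r := [seq R_ K n lam | lam <- Lambda n].
Local Notation U := (fun i : 'I_(size r) => GL_generated act r`_i).

Lemma ker_phi_ideal : ideal (@ker_phi K n 2).
Proof.
split.
- exact: raddf0.
- by move=> a b; rewrite /ker_phi => a0 b0; rewrite phiD a0 b0 addr0.
by move=> a b; rewrite /ker_phi => b0; rewrite phiM b0 mulr0.
Qed.

Lemma sum_submod (s : nat) (V : 'I_s -> F -> Prop) :
  (forall i, GL_submodule act (V i)) -> GL_submodule act (sum_of_subspaces V).
Proof.
move=> subV; split; first split.
- exists (fun=> 0); last by rewrite big1.
  by move=> i; case: (subV i) => -[].
- move=> a _ _ [u Uu ->] [v Uv ->]; exists (fun i => a *: u i + v i).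
    by move=> i; case: (subV i) => -[_ H] _; apply: H.
  by rewrite scaler_sumr -big_split.
move=> g _ gu [u Uu ->]; exists (fun i => act g (u i)).
  by move=> i; case: (subV i) => _; apply.
exact: (lin_sum (actZD g)).
Qed.

Lemma sum_min (s : nat) (V : 'I_s -> F -> Prop) (M : F -> Prop) :
  subspace M -> (forall i, incl (V i) M) -> incl (sum_of_subspaces V) M.
Proof. by move=> subM VM _ [u Uu ->]; apply: subspace_sum => // i _; apply: VM. Qed.

Lemma sum_mem (s : nat) (V : 'I_s -> F -> Prop) i :
  (forall i, V i 0) -> incl (V i) (sum_of_subspaces V).
Proof.
move=> V0 x Vx; exists (fun j => if j == i then x else 0).
  by move=> j; case: eqP => [->|].
by rewrite -big_mkcond big_pred1_eq.
Qed.

(** The preimage of an ideal under [act g] is an ideal, and it contains [S] because [S] is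
    stable. *)
Lemma ideal_generated_GL (S : F -> Prop) :
  (forall g x, g \in unitmx -> S x -> S (act g x)) ->
  GL_ideal act (ideal_generated S).
Proof.
move=> SG; split.
  split=> [I [] //|a b Ia Ib I idI SI|a b Ib I idI SI].
    by have [_ ID _] := idI; apply: ID; [apply: Ia|apply: Ib].
  by have [_ _ IM] := idI; apply: IM; apply: Ib.
move=> g x gu Ix I idI SI.
apply: (Ix (fun y => I (act g y))); last by move=> y Sy; apply: SI; apply: SG.
have [I0 ID IM] := idI; split.
- by rewrite (lin0 (actZD g)).
- by move=> a b Ia Ib; rewrite GL_act_FD; apply: ID.
by move=> a b Ib; rewrite GL_act_FM; apply: IM.
Qed.

Lemma Lambda_relation_like lam : lam \in Lambda n ->
  relation_like gr rho_subalgebra (R_ K n lam).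
Proof.
case/(LambdaP n_ge3) => [->|[k /andP[k0 kn] ->]].
  by rewrite R_n2_lam //; apply: rel_n2_like.
by rewrite R_2k_lam //; apply: rel_2k_like.
Qed.

Lemma kernel_minimally_generated : minimally_generates act (@ker_phi K n 2) r.
Proof.
have subU i : GL_submodule act (U i) by case: (Lambda_irreducible n_ge3 i).
have [subS SG] := sum_submod subU.
have GLker := ker_phi_submod K n_ge3 2.
have Sker : incl (sum_of_subspaces U) (@ker_phi K n 2).
  apply: (sum_min (proj1 GLker)) => i.
  have [lamL ->] := Lambda_nth (ltn_ord i).
  by have /= [+ _ _] := relation_module K n_ge3 0 lamL; rewrite F_incl_id.
have USr lam : lam \in Lambda n -> sum_of_subspaces U (R_ K n lam).
  move=> lamL; have il : (index lam (Lambda n) < size r)%N by rewrite size_map index_mem.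
  have e : r`_(Ordinal il) = R_ K n lam by have [_] := Lambda_nth il; rewrite nth_index.
  apply: (@sum_mem _ _ (Ordinal il)) => [i|]; first by case: (subU i) => -[].
  by rewrite -e => V _.
split.
- by split; [exact: ker_phi_ideal|case: GLker].
- exact: Lambda_irreducible.
- exact: Lambda_direct.
apply: (@minimal_of_quadratic_part K F gr aug rho_subalgebra grZD gr_mul) => //.
- exact: rho_subalgebra_kernel.
- have sub := relation_like_submod grZD (@actZD K n) gr_act rho_subalgebra_submod.
  apply: (sum_min (proj1 sub)) => i x Ux; apply: Ux => //.
  have [lamL ->] := Lambda_nth (ltn_ord i); exact: Lambda_relation_like.
move=> a; split=> [Ga|pa]; first exact: (Ga _ ker_phi_ideal Sker).
(* The ideal generated by the modules is stable, lies in the kernel and contains every relation,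
   which is what [kernel_sub_ideal] requires. *)
have [idJ JG] := ideal_generated_GL SG.
apply: (@kernel_sub_ideal K n n_ge3 _ idJ) => //.
- by move=> x Jx; apply: (Jx _ ker_phi_ideal Sker).
- move=> V _ SV; apply: SV; rewrite -R_n2_lam //; apply: USr; exact: mem_head.
move=> k k0 kn V _ SV; apply: SV; rewrite -R_2k_lam //; apply: USr.
rewrite inE; apply/orP; right; apply: (map_f (fun k => [:: (2 * n - 2 * k)%N; (2 * k)%N])).
by rewrite mem_iota; lia.
Qed.

End Minimality.

Theorem theorem5p1 (R : realType) (n : nat) (hn : (3 <= n)%N) :
  (forall (m : nat) (hm : (2 <= m)%N) (lam : seq nat), lam \in Lambda n ->
     let r : F R[i] n m := F_incl m (R_ R[i] n lam) in
     let M := GL_generated (@GL_act_F R[i] n m) r in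
     incl M (@ker_phi R[i] n m)
     /\ GL_isomorphic (@GL_act_F R[i] n m) M
          (@tensor_act R[i] m lam) (@schur_module R[i] m lam))
  /\ minimally_generates (@GL_act_F R[i] n 2) (@ker_phi R[i] n 2)
       [seq R_ R[i] n lam | lam <- Lambda n].
Proof.
split; last exact: (kernel_minimally_generated R[i] hn).
case=> [|[|m]] // _ lam lamL.
by have [kerM isoM _] := relation_module R[i] hn m lamL.
Qed.
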